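(* Let $\mathsf A\colon\mathsf H\to2^{\mathsf H}$ be a set-valued maximally monotone operator, let $\vartheta\in\,]0,+\infty[$, and let $\mathsf B\colon\mathsf H\to\mathsf H$ be $\vartheta$-cocoercive, i.e., $\langle\mathsf x-\mathsf y\mid\mathsf B\mathsf x-\mathsf B\mathsf y\rangle\ge\vartheta\|\mathsf B\mathsf x-\mathsf B\mathsf y\|^2$ for all $\mathsf x,\mathsf y\in\mathsf H$. Suppose that $\mathsf F=\{\mathsf z\in\mathsf H:\mathsf 0\in\mathsf A\mathsf z+\mathsf B\mathsf z\}\neq\varnothing$. Let $x_0$, $(u_n)_{n\in\mathbb N}$, and $(a_n)_{n\in\mathbb N}$ be random variables in $L^2(\Omega,\mathcal F,\mathsf P;\mathsf H)$, let $(\lambda_n)_{n\in\mathbb N}$ be a sequence in $]0,1]$, let $(\gamma_n)_{n\in\mathbb N}$ be a sequence in $]0,2\vartheta[$, and let $(x_n)_{n\in\mathbb N}$ be generated by $$(\forall n\in\mathbb N)\quad x_{n+1}=x_n+\lambda_n\big(\mathsf J_{\gamma_n\mathsf A}(x_n-\gamma_nu_n)+a_n-x_n\big).$$ Let $(\tau_n)_{n\in\mathbb N}$ be a sequence in $[0,+\infty[$ and let $\mathscr X=(\mathcal X_n)_{n\in\mathbb N}$ be a sequence of sub-sigma-algebras of $\mathcal F$. Assume that the following are satisfied: (a) For every $n\in\mathbb N$, $\sigma(x_0,\ldots,x_n)\subset\mathcal X_n\subset\mathcal X_{n+1}$. (b) $\sum_{n\in\mathbb N}\lambda_n\sqrt{\mathsf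 E(\|a_n\|^2\mid\mathcal X_n)}<+\infty$. (c) $\sum_{n\in\mathbb N}\sqrt{\lambda_n}\,\|\mathsf E(u_n\mid\mathcal X_n)-\mathsf Bx_n\|<+\infty$. (d) For every $\mathsf z\in\mathsf F$, there exists $(\zeta_n(\mathsf z))_{n\in\mathbb N}\in\ell_+^\infty(\mathscr X)$ such that $(\lambda_n\zeta_n(\mathsf z))_{n\in\mathbb N}\in\ell_+^{1/2}(\mathscr X)$ and $$(\forall n\in\mathbb N)\quad\mathsf E\big(\|u_n-\mathsf E(u_n\mid\mathcal X_n)\|^2\mid\mathcal X_n\big)\le\tau_n\|\mathsf Bx_n-\mathsf B\mathsf z\|^2+\zeta_n(\mathsf z).$$ (e) $\inf_{n\in\mathbb N}\gamma_n>0$, $\sup_{n\in\mathbb N}\tau_n<+\infty$, and $\sup_{n\in\mathbb N}(1+\tau_n)\gamma_n<2\vartheta$. (f) Either $\inf_{n\in\mathbb N}\lambda_n>0$, or [$(\gamma_n)_{n\in\mathbb N}$ is constant ($\gamma_n\equiv\gamma$), $\sum_{n\in\mathbb N}\tau_n<+\infty$, and $\sum_{n\in\mathbb N}\lambda_n=+\infty$]. Then the following hold for some $\mathsf F$-valued random variable $x$: (i) For every $\mathsf z\in\mathsf F$, $\sum_{n\in\mathbb N}\lambda_n\|\mathsf Bx_n-\mathsf B\mathsf z\|^2<+\infty$ $\mathsf P$-a.s. (ii) For every $\mathsf z\in\mathsf F$, $\sum_{n\in\mathbb N}\lambda_n\|x_n-\gamma_n\mathsf Bx_n-\mathsf J_{\gamma_n\mathsf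 A}(x_n-\gamma_n\mathsf Bx_n)+\gamma_n\mathsf B\mathsf z\|^2<+\infty$ $\mathsf P$-a.s. (iii) $(x_n)_{n\in\mathbb N}$ converges weakly $\mathsf P$-a.s. to $x$. (iv) Suppose that one of the following is satisfied: (g) $\mathsf A$ is demiregular at every $\mathsf z\in\mathsf F$; (h) $\mathsf B$ is demiregular at every $\mathsf z\in\mathsf F$. Then $(x_n)_{n\in\mathbb N}$ converges strongly $\mathsf P$-a.s. to $x$.
   Context: $\mathsf H$ is a separable real Hilbert space with scalar product $\langle\cdot\mid\cdot\rangle$, norm $\|\cdot\|$, and Borel $\sigma$-algebra $\mathcal B$. $(\Omega,\mathcal F,\mathsf P)$ is the underlying probability space. An $\mathsf H$-valued random variable is a measurable map $x\colon(\Omega,\mathcal F)\to(\mathsf H,\mathcal B)$; $L^2(\Omega,\mathcal F,\mathsf P;\mathsf H)$ is the space of (equivalence classes of) $\mathsf H$-valued random variables $x$ with $\int_\Omega\|x\|^2d\mathsf P<+\infty$. $\sigma(\Phi)$ is the smallest $\sigma$-algebra generated by a family $\Phi$ of random variables, and $\mathsf E(\cdot\mid\mathcal E)$ denotes conditional expectation with respect to a sub-sigma-algebra $\mathcal E$ of $\mathcal F$. Equalities and inequalities involving random variables are always understood to hold $\mathsf P$-almost surely, even when not expressly mentioned. For a sequence $\mathscr X=(\mathcal X_n)_{n\in\mathbb N}$ of sub-sigma-algebras as in (a), $\ell_+(\mathscr X)$ is the set of sequences $(\xi_n)_{n\in\mathbb N}$ of $[0,+\infty[$-valued random variables such that, for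 every $n$, $\xi_n$ is $\mathcal X_n$-measurable. For $p\in\,]0,+\infty[$, $\ell_+^p(\mathscr X)=\{(\xi_n)_{n\in\mathbb N}\in\ell_+(\mathscr X): \sum_{n\in\mathbb N}\xi_n^p<+\infty\ \mathsf P\text{-a.s.}\}$, and $\ell_+^\infty(\mathscr X)=\{(\xi_n)_{n\in\mathbb N}\in\ell_+(\mathscr X):\sup_{n\in\mathbb N}\xi_n<+\infty\ \mathsf P\text{-a.s.}\}$. The resolvent of a maximally monotone operator $\mathsf A$ is $\mathsf J_{\mathsf A}=(\mathrm{Id}+\mathsf A)^{-1}$, which is single-valued and defined on all of $\mathsf H$. An operator $\mathsf A\colon\mathsf H\to2^{\mathsf H}$ is demiregular at $\mathsf x\in\operatorname{dom}\mathsf A=\{\mathsf y\in\mathsf H:\mathsf A\mathsf y\ne\varnothing\}$ if, for every sequence $(\mathsf x_n,\mathsf u_n)_{n\in\mathbb N}$ in the graph $\{(\mathsf y,\mathsf u):\mathsf u\in\mathsf A\mathsf y\}$ of $\mathsf A$ and every $\mathsf u\in\mathsf A\mathsf x$ such that $\mathsf x_n\to\mathsf x$ weakly and $\mathsf u_n\to\mathsf u$ strongly, we have $\mathsf x_n\to\mathsf x$ strongly. A single-valued operator is identified with the corresponding set-valued one. *)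

(* Defs.v *)
From HB Require Import structures.
From mathcomp Require Import all_boot all_order all_algebra.
From mathcomp Require Import all_classical all_reals all_analysis.

Set Implicit Arguments.
Unset Strict Implicit.
Unset Printing Implicit Defensive.

Import Order.TTheory GRing.Theory Num.Theory.
Import numFieldNormedType.Exports.

Local Open Scope classical_set_scope.
Local Open Scope ring_scope.

(* The inner product of a real Hilbert space H is a positive definite symmetric
   form [dot : {dot H for idfun}] that induces the norm of the complete normed
   module H. *)
Definition induces_norm (R : realType) (H : completeNormedModType R)
    (dot : {dot H for idfun}) : Prop :=
  forall v : H, `|v| ^+ 2 = dot v v.

Definition separable (T : topologicalType) : Prop :=
  exists2 D : set T, countable D & dense D.

(* By the Riesz representation theorem, every continuous linear form on H is
   [dot ^~ h] for some h. *)
Definition weakly_converges (R : realType) (H : completeNormedModType R)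
    (dot : {dot H for idfun}) (v : nat -> H) (l : H) : Prop :=
  forall h : H, dot (v n) h @[n --> \oo] --> dot l h.

(* Set-valued operators: [u \in A x] is [A x u]. *)
Section operators.
Variables (R : realType) (H : completeNormedModType R).
Variable (dot : {dot H for idfun}).

Definition operator := H -> set H.

Implicit Types A B : operator.

Definition of_fun (f : H -> H) : operator := fun x => [set f x].

Definition op_add A B : operator :=
  fun x => [set u + v | u in A x & v in B x].

Definition op_scale (c : R) A : operator :=
  fun x => [set c *: u | u in A x].

Definition op_inv A : operator := fun u => [set x | A x u].

Definition zeros A : set H := [set z | A z 0].

Definition monotone A : Prop :=
  forall x u y v, A x u -> A y v -> 0 <= dot (x - y) (u - v).

Definition maximally_monotone A : Prop :=
  monotone A /\
  forall A', monotone A' -> (forall x, A x `<=` A' x) ->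
    forall x, A' x `<=` A x.

(* The point chosen in (Id + A)^-1 x; for maximally monotone A this set is a
   singleton for every x (Minty), so the default value 0 is never taken. *)
Definition resolvent A (x : H) : H :=
  xget 0 (op_inv (op_add (of_fun id) A) x).

Definition cocoercive (c : R) (B : H -> H) : Prop :=
  forall x y, c * `|B x - B y| ^+ 2 <= dot (x - y) (B x - B y).

Definition demiregular A (x : H) : Prop :=
  A x !=set0 /\
  forall (xs us : nat -> H) (u : H),
    (forall n, A (xs n) (us n)) -> A x u ->
    weakly_converges dot xs x -> us @ \oo --> u -> xs @ \oo --> x.

End operators.

(* H with its Borel sigma-algebra *)
Definition borel (R : realType) (H : completeNormedModType R) :=
  g_sigma_algebraType (@open H).

Section probability.
Variables (d : measure_display) (Omega : measurableType d) (R : realType).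
Variable (P : probability Omega R).

Definition sub_sigma_field (G : set (set Omega)) : Prop :=
  sigma_algebra setT G /\ G `<=` measurable.

Definition measurable_wrt (G : set (set Omega)) (d' : measure_display)
    (T : measurableType d') (f : Omega -> T) : Prop :=
  forall B : set T, measurable B -> G (f @^-1` B).

Variable (H : completeNormedModType R).

Definition hmeasurable (G : set (set Omega)) (f : Omega -> H) : Prop :=
  @measurable_wrt G _ (borel H) f.

Definition hilbert_rv (f : Omega -> H) : Prop := hmeasurable measurable f.

Definition L2 (f : Omega -> H) : Prop :=
  hilbert_rv f /\ (\int[P]_w (`|f w| ^+ 2)%:E < +oo)%E.

(* sigma(x_0, ..., x_n) *)
Definition sigma_upto (x : nat -> Omega -> H) (n : nat) : set (set Omega) :=
  <<s \bigcup_(k in `I_n.+1)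
        preimage_set_system setT (x k : Omega -> borel H) measurable >>.

(* Step functions \sum_(i < m) 1_(E i) c_i and their integrals over D *)
Definition step_fun (m : nat) (E : nat -> set Omega) (c : nat -> H)
    (w : Omega) : H :=
  \sum_(i < m) (\1_(E i) w : R) *: c i.

Definition step_integral (D : set Omega) (m : nat) (E : nat -> set Omega)
    (c : nat -> H) : H :=
  \sum_(i < m) fine (P (D `&` E i)) *: c i.

(* f is Bochner integrable over D, with integral v *)
Definition bochner_integral (D : set Omega) (f : Omega -> H) (v : H) : Prop :=
  hilbert_rv f /\
  exists (m : nat -> nat) (E : nat -> nat -> set Omega) (c : nat -> nat -> H),
    [/\ forall k i, measurable (E k i),
        (\int[P]_(w in D) `|f w - step_fun (m k) (E k) (c k) w|%:E)%E
          @[k --> \oo] --> 0%E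
      & step_integral D (m k) (E k) (c k) @[k --> \oo] --> v].

(* g is a version of the conditional expectation E(f | G); it is only
   determined up to P-almost sure equality. *)
Definition cond_exp_H (G : set (set Omega)) (f g : Omega -> H) : Prop :=
  hmeasurable G g /\
  forall D, G D ->
    exists2 v, bochner_integral D f v & bochner_integral D g v.

Definition cond_exp (G : set (set Omega)) (f g : Omega -> R) : Prop :=
  [/\ measurable_wrt G g,
      P.-integrable setT (EFin \o f),
      P.-integrable setT (EFin \o g)
    & forall D, G D ->
        (\int[P]_(w in D) (f w)%:E = \int[P]_(w in D) (g w)%:E)%E].

Section adapted_sequences.
Variable X : nat -> set (set Omega).

Definition ell_plus (xi : nat -> Omega -> R) : Prop :=
  forall n, (forall w, 0 <= xi n w) /\ measurable_wrt (X n) (xi n).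

Definition ell_plus_p (p : R) (xi : nat -> Omega -> R) : Prop :=
  ell_plus xi /\
  {ae P, forall w, (\sum_(0 <= n <oo) (xi n w `^ p)%:E < +oo)%E}.

Definition ell_plus_infty (xi : nat -> Omega -> R) : Prop :=
  ell_plus xi /\
  {ae P, forall w, (ereal_sup (range (fun n => (xi n w)%:E)) < +oo)%E}.

End adapted_sequences.

End probability.

(* Main.v *)
Require Import Defs.
From HB Require Import structures.
From mathcomp Require Import all_boot all_order all_algebra.
From mathcomp Require Import all_classical all_reals all_analysis.
From mathcomp Require Import ring lra zify measurable_realfun.

Set Implicit Arguments.
Unset Strict Implicit.
Unset Printing Implicit Defensive.

Import Order.TTheory GRing.Theory Num.Theory.
Import numFieldNormedType.Exports.

Local Open Scope classical_set_scope.
Local Open Scope ring_scope.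

(* Fix z in F. Firm nonexpansiveness of the resolvents, cocoercivity of B and
   the orthogonality of u_n - E(u_n | X_n) to X_n-measurable vectors give
     E(V_{n+1} | X_n) + theta_n <= (1 + chi_n) V_n + eta_n,  V_n = |x_n - z|^2,
   with a.s. summable chi_n and eta_n, where theta_n dominates the terms of (i)
   and (ii) up to a constant factor. Robbins and Siegmund's theorem (stopping,
   then Doob's upcrossing inequality) yields the convergence of |x_n - z| and
   (i), (ii). The residuals |x_n - T_n x_n| of the forward-backward operators
   T_n then tend to 0: at once if lambda_n is bounded below; otherwise they
   satisfy a recursion of the same type, so they converge, and their limit is 0
   because the lambda_n |x_n - T_n x_n|^2 are summable while the lambda_n are
   not. On a path where |x_n - z| converges for every z in F, which is an almost
   sure event because F is separable, weak convergence is Opial's lemma, and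
   strong convergence follows from demiregularity since B x_n -> B x by
   cocoercivity and monotonicity.

   No weak compactness is used. Minty's theorem is obtained by maximizing a
   function that is strongly concave in the relevant variable, so maximizing
   sequences are Cauchy, and Opial's lemma uses asymptotic centers: the
   asymptotic center of a sequence with vanishing residuals is a fixed point of
   the nonexpansive operator, and along any filter finer than the Frechet filter
   it is the same point. *)

(** * Geometry of Hilbert spaces and Minty's theorem *)

(** Conditional expectations of |x_{n+1} - z|^2 are never formed: conditional inequalities between
    nonnegative functions are comparisons of their integrals over the sets of X_n. Such inequalities
    survive multiplication by nonnegative X_n-measurable factors, which is what makes random adapted
    weights possible. The main one is kappa_n = sqrt(E(|a_n|^2 | X_n)) + 2^-n: Young's inequality
    with weight lambda_n kappa_n splits off the error a_n, and the resulting second-order term is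
    summable although (b) only concerns square roots. The definition of E(u_n | X_n) gives
    orthogonality of the noise to constant vectors on sets of X_n. Separability extends it to
    X_n-measurable vectors, by cutting the space into countably many pieces on which such a vector
    is nearly constant. The recursion of the residuals compares x_{n+1} and x_n under one and the
    same operator, which is where a constant gamma_n enters. *)

Section inner_product.
Variables (R : realType) (H : completeNormedModType R).
Variable (dot : {dot H for idfun}).
Hypothesis Hdot : induces_norm dot.
Implicit Types u v w : H.

Lemma dotC u v : dot u v = dot v u.
Proof. by rewrite hermitian_subproof expr0 mul1r. Qed.

Lemma dotDl u v w : dot (u + v) w = dot u w + dot v w.
Proof. by rewrite linearDl. Qed.
Lemma dotDr u v w : dot w (u + v) = dot w u + dot w v.
Proof. by rewrite dotC dotDl !(dotC w). Qed.
Lemma dotNl u v : dot (- u) v = - dot u v.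
Proof. by rewrite linearNl. Qed.
Lemma dotNr u v : dot v (- u) = - dot v u.
Proof. by rewrite dotC dotNl dotC. Qed.
Lemma dotZl c u v : dot (c *: u) v = c * dot u v.
Proof. by rewrite linearZl_LR. Qed.
Lemma dotZr c u v : dot v (c *: u) = c * dot v u.
Proof. by rewrite dotC dotZl dotC. Qed.
Lemma dot0l v : dot 0 v = 0.
Proof. by rewrite linear0l. Qed.
Lemma dot0r v : dot v 0 = 0.
Proof. by rewrite dotC dot0l. Qed.

Definition dotE := (dotDl, dotDr, dotNl, dotNr, dotZl, dotZr).

Lemma sqnormD u v : `|u + v| ^+ 2 = `|u| ^+ 2 + 2 * dot u v + `|v| ^+ 2.
Proof. by rewrite !Hdot !dotE (dotC v u); ring. Qed.

Lemma sqnormB u v : `|u - v| ^+ 2 = `|u| ^+ 2 - 2 * dot u v + `|v| ^+ 2.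
Proof. by rewrite !Hdot !dotE (dotC v u); ring. Qed.

Lemma sqnormZ (c : R) u : `|c *: u| ^+ 2 = c ^+ 2 * `|u| ^+ 2.
Proof. by rewrite !Hdot !dotE; ring. Qed.

Lemma cauchy_schwarz u v : `|dot u v| <= `|u| * `|v|.
Proof.
have [->|v0] := eqVneq v 0; first by rewrite dot0r !normr0 mulr0.
have nv : 0 < `|v| ^+ 2 by rewrite exprn_gt0 // normr_gt0.
suff : `|dot u v| ^+ 2 <= (`|u| * `|v|) ^+ 2.
  by rewrite ler_pXn2r ?nnegrE // mulr_ge0.
have := exprn_ge0 2 (normr_ge0 (u - (dot u v / `|v| ^+ 2) *: v)).
rewrite sqnormB sqnormZ dotZr real_normK ?num_real //.
set p := `|u| ^+ 2; set q := `|v| ^+ 2; set s := dot u v => h.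
have : 0 <= (p - 2 * (s / q * s) + (s / q) ^+ 2 * q) * q.
  exact: mulr_ge0 h (ltW nv).
have -> : (p - 2 * (s / q * s) + (s / q) ^+ 2 * q) * q = p * q - s ^+ 2.
  by field; rewrite gt_eqF.
by rewrite subr_ge0 exprMn.
Qed.

Lemma ler_dot u v : dot u v <= `|u| * `|v|.
Proof. exact: le_trans (ler_norm _) (cauchy_schwarz u v). Qed.

Lemma dot_cvgl (T : Type) (F : set_system T) {FF : Filter F} (f : T -> H) l h :
  f @ F --> l -> dot (f t) h @[t --> F] --> dot l h.
Proof.
move=> fl; apply/cvgrPdist_lt => e e0.
have h1 : 0 < `|h| + 1 by rewrite ltr_wpDl.
have /cvgrPdist_lt/(_ (e / (`|h| + 1))) := fl.
rewrite divr_gt0 // => /(_ isT); apply: filterS => t.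
rewrite ltr_pdivlMr // => lt_e; rewrite -dotNl -dotDl.
apply: le_lt_trans (cauchy_schwarz _ _) (le_lt_trans _ lt_e).
by rewrite ler_wpM2l // lerDl.
Qed.

Lemma norm_le_dot (r : R) v : 0 <= r -> (forall h, dot v h <= r * `|h|) ->
  `|v| <= r.
Proof.
move=> r0 /(_ v); rewrite -Hdot expr2.
have [->|v0] := eqVneq v 0; first by rewrite normr0.
by rewrite ler_pM2r // normr_gt0.
Qed.

Lemma dot_eq0 v : (forall h, dot v h = 0) -> v = 0.
Proof.
move=> v0; apply/eqP; rewrite -normr_le0; apply: norm_le_dot => // h.
by rewrite v0 mul0r.
Qed.

Lemma dot_inj u v : (forall h, dot u h = dot v h) -> u = v.
Proof.
move=> uv; apply/eqP; rewrite -subr_eq0; apply/eqP/dot_eq0 => h.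
by rewrite dotDl dotNl uv subrr.
Qed.

Lemma sqnorm_le (r : R) v : 0 <= r -> (`|v| <= r) = (`|v| ^+ 2 <= r ^+ 2).
Proof. by move=> r0; rewrite ler_pXn2r ?nnegrE. Qed.

Lemma sqnorm_mid w u v : `|w - 2^-1 *: (u + v)| ^+ 2 =
  2^-1 * `|w - u| ^+ 2 + 2^-1 * `|w - v| ^+ 2 - 4^-1 * `|u - v| ^+ 2.
Proof.
rewrite !Hdot !dotE (dotC u w) (dotC v w) (dotC v u).
by field.
Qed.

Lemma cvg_sqnorm (T : Type) (F : set_system T) {FF : Filter F} (f : T -> H) l :
  f @ F --> l -> `|f t| ^+ 2 @[t --> F] --> `|l| ^+ 2.
Proof.
move=> /cvg_norm fl; rewrite expr2; under eq_fun do rewrite expr2.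
exact: cvgM.
Qed.

(** The form in which the parallelogram law controls [k.+1%:R^-1]-optimal points, in [minty_core]
    and in [asymptotic_center_exists]. *)
Lemma cauchy_of_sqdist (f : nat -> H) (K : R) :
  (forall k l, `|f k - f l| ^+ 2 <= K * (k.+1%:R^-1 + l.+1%:R^-1)) -> cvgn f.
Proof.
move=> fK; apply/cauchy_cvgP/cauchy_exP => e e0.
have K0 : 0 <= K.
  have := fK 0%N 0%N; rewrite subrr normr0 expr0n /=.
  by rewrite pmulr_lge0 // invr1 addr_gt0.
(* [K] times the sum of two inverses below this bound is at most [K / (K + 1) * e ^+ 2]; the [+ 1]
   keeps the divisor positive when [K = 0]. *)
have /cvgrPdist_lt/(_ (e ^+ 2 / (2 * (K + 1)))) := @cvg_harmonic R.
have Kp : 0 < 2 * (K + 1) by lra.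
rewrite divr_gt0 ?exprn_gt0 // => /(_ isT) [N _ NP].
exists (f N); exists N => // l /= lN; rewrite -ball_normE /=.
rewrite -(ltr_pXn2r (n := 2)) ?nnegrE ?(ltW e0) //.
have inv_lt n : (N <= n)%N -> n.+1%:R^-1 < e ^+ 2 / (2 * (K + 1)).
  move=> /NP /=; rewrite sub0r normrN ger0_norm //.
apply: le_lt_trans (fK N l) _.
have := inv_lt _ (leqnn N); have := inv_lt _ lN.
rewrite !ltr_pdivlMr //; move: (N.+1%:R^-1) (l.+1%:R^-1) => a b.
nra.
Qed.

End inner_product.

Section minty.
Variables (R : realType) (H : completeNormedModType R).
Variable (dot : {dot H for idfun}).
Hypothesis Hdot : induces_norm dot.

(** The convex hull of the points [(a, b, dot a b)] with [M a b], generated by binary combinations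
    so that facts about it follow by induction. *)
Inductive hull (M : H -> H -> Prop) : H -> H -> R -> Prop :=
| hull_gen a b : M a b -> hull M a b (dot a b)
| hull_conv t a b s a' b' s' : 0 <= t <= 1 ->
    hull M a b s -> hull M a' b' s' ->
    hull M ((1 - t) *: a + t *: a') ((1 - t) *: b + t *: b')
           ((1 - t) * s + t * s').

Variable M : H -> H -> Prop.
Hypothesis M_mono : forall a b a' b', M a b -> M a' b' ->
  0 <= dot (a - a') (b - b').

(** Both sides are affine in each of the two points separately, so two inductions reduce the claim
    to pairs of [M], where it is the expanded monotonicity inequality. Its diagonal case is
    [hull_dot_le]. *)
Lemma hull_fitzpatrick a b s y v r : hull M a b s -> hull M y v r ->
  dot y b + dot a v <= s + r.
Proof.
move=> hab; elim=> {y v r} [y v Myv|t y v r y' v' r' /andP[t0 t1] _ IH _ IH'].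
  elim: hab => {a b s} [a b Mab|t a b s a' b' s' /andP[t0 t1] _ IH _ IH'].
    have := M_mono Mab Myv; rewrite !dotE; lra.
  rewrite !dotE; move: (dot y v) IH IH' => r IH IH'.
  by nra.
by rewrite !dotE; nra.
Qed.

Lemma hull_dot_le a b s : hull M a b s -> dot a b <= s.
Proof. by move=> h; have := hull_fitzpatrick h h; lra. Qed.

(* The concave function [- |(a - b) / 2| ^ 2 - s] is dual to the maximum over
   M of the convex functions [y |-> dot (y - a) (y + b)]; a maximizing sequence
   is Cauchy for (a - b) / 2. *)
Let D (a b : H) (s : R) : R := - `|2^-1 *: (a - b)| ^+ 2 - s.

Let D_le0 a b s : hull M a b s -> D a b s <= 0.
Proof.
move=> /hull_dot_le; rewrite /D (sqnormZ Hdot) (sqnormB Hdot) => ab.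
have : 0 <= `|a + b| ^+ 2 by rewrite exprn_ge0.
rewrite (sqnormD Hdot); lra.
Qed.

(** At a maximum of [D] over the hull, of value [m], with [y] half the difference of the two
    components, the derivative of [D] towards a point of [M] is [dot (y - a) (y + b) - m]. It cannot
    be positive, and [m <= 0] by monotonicity. The maximum is only approached, hence the errors
    [k.+1%:R^-1]. The conclusion makes [(y, - y)] monotonically related to [M], as in the
    Debrunner-Flor theorem. *)
Lemma minty_core : exists y, forall a b, M a b -> dot (y - a) (y + b) <= 0.
Proof.
have [[a0 [b0 M0]]|noM] := pselect (exists a b, M a b); last first.
  by exists 0 => a b Mab; case: noM; exists a, b.
pose S := [set r | exists a b s, hull M a b s /\ r = D a b s].
have S0 : S !=set0 by exists (D a0 b0 (dot a0 b0)), a0, b0, (dot a0 b0); split=> //;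
  exact: hull_gen.
have Sub : has_ubound S by exists 0 => _ [a [b [s [h ->]]]]; exact: D_le0.
have Ssup : has_sup S by split.
pose m := sup S.
have m0 : m <= 0 by apply: ge_sup => // _ [a [b [s [h ->]]]]; exact: D_le0.
have Dm a b s : hull M a b s -> D a b s <= m.
  by move=> h; apply: ub_le_sup => //; exists a, b, s.
have /choice[f fP] : forall k : nat, exists p : H * H * R,
    hull M p.1.1 p.1.2 p.2 /\ m - k.+1%:R^-1 < D p.1.1 p.1.2 p.2.
  move=> k; have [|_ [a [b [s [h ->]]]] lt] := @sup_adherent _ S k.+1%:R^-1 _ Ssup.
    by rewrite invr_gt0.
  by exists (a, b, s).
pose c : nat -> H := fun k => 2^-1 *: ((f k).1.1 - (f k).1.2).
have cE k : 2^-1 *: ((f k).1.1 - (f k).1.2) = c k by [].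
clearbody c; pose s k := (f k).2.
have ccvg : cvgn c.
  apply: (cauchy_of_sqdist (K := 2)) => k l.
  have [hk Dk] := fP k; have [hl Dl] := fP l.
  have half : 0 <= (2^-1 : R) <= 1 by lra.
  have := Dm _ _ _ (hull_conv half hk hl); rewrite /D.
  have -> : 2^-1 *: ((1 - 2^-1) *: (f k).1.1 + 2^-1 *: (f l).1.1 -
      ((1 - 2^-1) *: (f k).1.2 + 2^-1 *: (f l).1.2)) = 2^-1 *: (c k + c l).
    rewrite (_ : 1 - 2^-1 = 2^-1 :> R); last by field.
    by rewrite -!cE -!scalerDr -scalerBr opprD addrACA.
  move: Dk Dl; rewrite /D !cE -/(s k) -/(s l).
  rewrite (sqnormZ Hdot _ (c k + c l)) (sqnormD Hdot (c k)) (sqnormB Hdot (c k)).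
  move: (k.+1%:R^-1) (l.+1%:R^-1) => ik il; lra.
pose y : H := limn c.
have cy : c @ \oo --> y by exact: ccvg.
exists y => a b Mab.
have hab := hull_gen Mab.
pose g := 2^-1 *: (a - b).
have gE : 2^-1 *: (a - b) = g by [].
clearbody g.
have quad z : dot (z - a) (z + b) = `|z| ^+ 2 - 2 * dot z g - dot a b.
  by rewrite Hdot -gE !dotE (dotC _ a); field.
(* [m] bounds [D] at parameter [t] of the segment from the [k]-th near-maximizer to
   [(a, b, dot a b)]; expand in [t]. *)
have slope k t : 0 <= t <= 1 ->
    t * (dot (c k - a) (c k + b) - m) <= k.+1%:R^-1 + t ^+ 2 * `|g - c k| ^+ 2.
  move=> t01; have [hk Dk] := fP k.
  have := Dm _ _ _ hk; have := Dm _ _ _ (hull_conv t01 hk hab); rewrite /D.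
  have -> : 2^-1 *: ((1 - t) *: (f k).1.1 + t *: a -
      ((1 - t) *: (f k).1.2 + t *: b)) = c k + t *: (g - c k).
    have -> : 2^-1 *: ((1 - t) *: (f k).1.1 + t *: a - ((1 - t) *: (f k).1.2 + t *: b))
       = (1 - t) *: c k + t *: g.
      rewrite opprD addrACA -!scalerBr scalerDr !scalerA ![2^-1 * _]mulrC.
      by rewrite -!scalerA cE gE.
    move: (c k) (g) => v v1.
    by rewrite scalerBl scale1r scalerBr -addrA [- _ + _]addrC.
  move: Dk; rewrite /D cE -/(s k) (sqnormD Hdot (c k)) (sqnormZ Hdot t).
  have -> : dot (c k) (t *: (g - c k)) = t * (dot (c k) g - `|c k| ^+ 2).
    by rewrite Hdot !dotE.
  rewrite quad; case/andP: t01 => t0 _ lo up hi.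
  have : 0 <= t * (m - (- `|c k| ^+ 2 - s k)) by rewrite mulr_ge0 // subr_ge0.
  move: (k.+1%:R^-1) (s k) lo up hi => ik sk lo up hi; lra.
rewrite leNgt; apply/negP => pos.
have lim_slope t : 0 <= t <= 1 ->
    t * (dot (y - a) (y + b) - m) <= t ^+ 2 * `|g - y| ^+ 2.
  move=> t01; rewrite -[leRHS]add0r.
  have lhs : t * (dot (c k - a) (c k + b) - m) @[k --> \oo] -->
      t * (dot (y - a) (y + b) - m).
    apply: cvgMl_tmp; apply: cvgB; last exact: cvg_cst.
    rewrite quad; under eq_fun do rewrite quad.
    apply: cvgB; last exact: cvg_cst.
    apply: cvgB; last by apply: cvgMl_tmp; exact: (dot_cvgl Hdot).
    exact: cvg_sqnorm.
  have rhs : k.+1%:R^-1 + t ^+ 2 * `|g - c k| ^+ 2 @[k --> \oo] -->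
      0 + t ^+ 2 * `|g - y| ^+ 2.
    apply: cvgD; first exact: cvg_harmonic.
    apply: cvgMl_tmp; apply: cvg_sqnorm.
    by apply: cvgB => //; exact: cvg_cst.
  by apply: (ler_cvg_to lhs rhs); apply: nearW => k; exact: slope.
move: lim_slope pos; move: (dot _ _) (`|g - y| ^+ 2) (exprn_ge0 2 (normr_ge0 (g - y))).
move=> v K K0 h v0.
have : 0 < v - m by lra.
move: h; move: (v - m) => e h e0.
(* [t = e / (K + e)] violates [t * e <= t ^+ 2 * K], because [t * K = e - t * e < e]; it is defined
   and at most 1 even when [K = 0]. *)
have Ke : 0 < K + e by lra.
have t0 : 0 < e / (K + e) by rewrite divr_gt0.
have t1 : e / (K + e) <= 1 by rewrite ler_pdivrMr // mul1r lerDr.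
have tE : e / (K + e) * (K + e) = e by rewrite divfK ?gt_eqF.
have := h (e / (K + e)); rewrite ltW // t1 => /(_ isT).
move: (e / (K + e)) t0 tE => t t0 tE te.
have : 0 < t * (t * e) by rewrite !mulr_gt0.
have -> : t * e = e - t * K by lra.
by rewrite mulrBr; lra.
Qed.

End minty.

(** * Resolvents and forward-backward operators *)

Section resolvents.
Variables (R : realType) (H : completeNormedModType R).
Variable (dot : {dot H for idfun}).
Hypothesis Hdot : induces_norm dot.
Variable A : H -> set H.
Hypothesis HA : maximally_monotone dot A.

Let J (c : R) := resolvent (op_scale c A).

(** [M] is the graph of [A] under the substitution [b = c *: v - x], so [minty_core] makes
    [(y, c^-1 *: (x - y))] monotonically related to all of [A]. Adjoining this pair keeps [A]
    monotone, and maximality says that it was there already. *)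
Lemma minty c x : 0 < c -> exists y, A y (c^-1 *: (x - y)).
Proof.
move=> c0; have [A_mono A_max] := HA.
pose M a b := A a (c^-1 *: (x + b)).
have [a b a' b' Ma Ma'|y yM] := @minty_core _ _ _ Hdot M.
  have := A_mono _ _ _ _ Ma Ma'.
  rewrite -scalerBr dotZr pmulr_rge0 ?invr_gt0 //.
  by rewrite opprD addrACA subrr add0r.
exists y; pose A' : H -> set H :=
  fun y' => A y' `|` [set v | y' = y /\ v = c^-1 *: (x - y)].
have yA a v : A a v -> 0 <= dot (y - a) (c^-1 *: (x - y) - v).
  move=> Aav; have := yM a (c *: v - x).
  rewrite /M addrC subrK scalerA mulVf ?gt_eqF // scale1r => /(_ Aav) le0.
  have -> : c^-1 *: (x - y) - v = - c^-1 *: (y + (c *: v - x)).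
    by apply: (dot_inj Hdot) => h; rewrite !dotE; field; rewrite gt_eqF.
  by rewrite dotZr mulNr oppr_ge0 pmulr_rle0 ?invr_gt0.
apply: (A_max A'); last by right.
  move=> a u b v [Aa|[-> ->]] [Ab|[-> ->]]; first exact: A_mono.
  - have := yA _ _ Aa; rewrite -opprB -(opprB u) dotNl dotNr opprK //.
  - exact: yA.
  - by rewrite subrr dot0l.
by move=> z v Azv; left.
Qed.

Lemma resolventP c x : 0 < c -> A (J c x) (c^-1 *: (x - J c x)).
Proof.
move=> c0; have [y Ay] := minty x c0.
have : op_inv (op_add (of_fun id) (op_scale c A)) x (J c x).
  apply: xgetPex; exists y; exists y => //; exists (x - y); last by rewrite addrC subrK.
  by exists (c^-1 *: (x - y)) => //; rewrite scalerA divff ?gt_eqF // scale1r.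
move=> [_ /= -> [_ [v Av <-]] xE].
have -> : x - J c x = c *: v by apply/eqP; rewrite subr_eq addrC xE.
by rewrite scalerA mulVf ?gt_eqF // scale1r.
Qed.

(** Firm nonexpansiveness: the square of [(J c r - z) + (r - J c r - c *: w)] has a nonnegative
    cross term by monotonicity. The graph point [(z, w)] stands for a second resolvent value, as
    [z = J c (z + c *: w)]; the Lipschitz bounds of [J c] and of its complement each keep one of the
    squares. *)
Lemma resolvent_step c r z w : 0 < c -> A z w ->
  `|J c r - z| ^+ 2 <= `|r - (z + c *: w)| ^+ 2 - `|r - J c r - c *: w| ^+ 2.
Proof.
move=> c0 Azw; have [A_mono _] := HA.
have := A_mono _ _ _ _ (resolventP r c0) Azw.
have -> : c^-1 *: (r - J c r) - w = c^-1 *: (r - J c r - c *: w).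
  by apply: (dot_inj Hdot) => h; rewrite !dotE; field; rewrite gt_eqF.
rewrite dotZr pmulr_rge0 ?invr_gt0 // => ge0.
have -> : r - (z + c *: w) = (J c r - z) + (r - J c r - c *: w).
  by apply: (dot_inj Hdot) => h; rewrite !dotE; ring.
rewrite [X in _ <= X - _](sqnormD Hdot); lra.
Qed.

Lemma resolvent_fix c z w : 0 < c -> A z w -> J c (z + c *: w) = z.
Proof.
move=> c0 /(resolvent_step (z + c *: w) c0).
rewrite subrr normr0 expr0n /= => le0.
apply/eqP; rewrite -subr_eq0 -normr_le0 -(@ler_pXn2r _ 2) ?nnegrE //.
by rewrite expr0n /= (le_trans le0) // sub0r oppr_le0 exprn_ge0.
Qed.

Lemma resolvent_nonexp c x y : 0 < c -> `|J c x - J c y| <= `|x - y|.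
Proof.
move=> c0; rewrite sqnorm_le //.
have := resolvent_step x c0 (resolventP y c0).
rewrite scalerA divff ?gt_eqF // scale1r [J c y + _]addrC subrK.
by move/le_trans; apply; rewrite gerBl exprn_ge0.
Qed.

Lemma resolvent_conexp c x y : 0 < c ->
  `|(x - J c x) - (y - J c y)| <= `|x - y|.
Proof.
move=> c0; rewrite sqnorm_le //.
have := resolvent_step x c0 (resolventP y c0).
rewrite scalerA divff ?gt_eqF // scale1r [J c y + _]addrC subrK => h.
rewrite -subr_ge0; apply: le_trans h; exact: exprn_ge0.
Qed.

Variables (theta : R) (B : H -> H).
Hypothesis theta_gt0 : 0 < theta.
Hypothesis HB : cocoercive dot theta B.

Lemma cocoercive_lipschitz x y : theta * `|B x - B y| <= `|x - y|.
Proof.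
have [->|Bxy] := eqVneq (B x - B y) 0; first by rewrite normr0 mulr0.
have := le_trans (HB x y) (ler_dot Hdot _ _).
by rewrite expr2 mulrA ler_pM2r // normr_gt0.
Qed.

Lemma forward_step c x y : 0 <= c ->
  `|x - y - c *: (B x - B y)| ^+ 2 <=
  `|x - y| ^+ 2 - c * (2 * theta - c) * `|B x - B y| ^+ 2.
Proof.
move=> c0; rewrite (sqnormB Hdot (x - y)) (sqnormZ Hdot) dotZr.
have : 0 <= c * (dot (x - y) (B x - B y) - theta * `|B x - B y| ^+ 2).
  by rewrite mulr_ge0 // subr_ge0.
lra.
Qed.

Definition forward_backward c x := J c (x - c *: B x).
Let T := forward_backward.

Lemma forward_backward_nonexp c x y : 0 < c < 2 * theta ->
  `|T c x - T c y| <= `|x - y|.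
Proof.
move=> /andP[c0 c2]; apply: le_trans (resolvent_nonexp _ _ c0) _.
have -> : x - c *: B x - (y - c *: B y) = x - y - c *: (B x - B y).
  by rewrite opprD addrACA -opprD -scalerBr.
rewrite sqnorm_le //; apply: le_trans (forward_step _ _ (ltW c0)) _.
by rewrite gerBl !mulr_ge0 ?exprn_ge0 ?subr_ge0 // ltW.
Qed.

Lemma zeros_sumE z : zeros (op_add A (of_fun B)) z <-> A z (- B z).
Proof.
split=> [[v Av [_ /= ->]] /eqP|Az].
  by rewrite addr_eq0 => /eqP <-.
by exists (- B z) => //; exists (B z) => //; rewrite addNr.
Qed.

Lemma forward_backward_fix c z : 0 < c -> T c z = z <-> A z (- B z).
Proof.
move=> c0; split=> [Tz|Az].
  have : A (T c z) (c^-1 *: (z - c *: B z - T c z)) := resolventP _ c0.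
  rewrite Tz.
  rewrite [z - _ - z]addrAC subrr add0r scalerN scalerA mulVf ?gt_eqF //.
  by rewrite scale1r.
by have := resolvent_fix c0 Az; rewrite scalerN.
Qed.

(* With [p = T c x] and [v = (x - p) / c - B x \in A p], both residuals are
   controlled by [B x + v = (x - p) / c]. *)
Lemma forward_backward_residual c c' x : 0 < c -> 0 < c' ->
  `|x - T c' x| <= (2 + c' / c) * `|x - T c x|.
Proof.
move=> c0 c'0; 
have : A (T c x) (c^-1 *: (x - c *: B x - T c x)) := resolventP _ c0.
set p := T c x => Ap; have := resolvent_fix c'0 Ap.
set v := c^-1 *: _; move=> pE.
have -> : x - T c' x = (x - p) + (p - T c' x) by rewrite addrA subrK.
apply: le_trans (ler_normD _ _) _.
have : `|p - T c' x| <= `|p + c' *: v - (x - c' *: B x)|.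
  by rewrite -{1}pE; exact: resolvent_nonexp.
have -> : p + c' *: v - (x - c' *: B x) = (p - x) + (c' / c) *: (x - p).
  by rewrite /v; apply: (dot_inj Hdot) => h; rewrite !dotE; field; rewrite gt_eqF.
move/le_trans => /(_ _ (ler_normD _ _)).
rewrite normrZ gtr0_norm ?divr_gt0 // (distrC p x); lra.
Qed.

End resolvents.

(** * Asymptotic centers and Opial's lemma *)

Section asymptotic_center.
Variables (R : realType) (H : completeNormedModType R).
Variable (dot : {dot H for idfun}).
Hypothesis Hdot : induces_norm dot.
Implicit Types (F : set_system nat) (x : nat -> H) (y : H).

(** [y] minimizes the upper limit of [|x n - y| ^+ 2] along [F], and [m] is the minimal value, the
    square of the asymptotic radius. Eventual bounds spare the upper limits; [F] is arbitrary
    because [opial] compares two filters. *)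
Definition asymptotic_center F x y (m : R) :=
  (forall e, 0 < e -> \forall n \near F, `|x n - y| ^+ 2 <= m + e) /\
  (forall y' c, (\forall n \near F, `|x n - y'| ^+ 2 <= c) -> m <= c).

(** The midpoint of two near-minimizers would beat the infimum unless they are close, so by
    [sqnorm_mid] a minimizing sequence is Cauchy. *)
Lemma asymptotic_center_exists F {FF : ProperFilter F} x (M : R) :
  (\forall n \near F, `|x n| <= M) -> exists y m, asymptotic_center F x y m.
Proof.
move=> xM.
pose S := [set c | exists y, \forall n \near F, `|x n - y| ^+ 2 <= c].
have S0 : S !=set0.
  exists (M ^+ 2), 0; apply: filterS xM => n xn.
  by rewrite subr0 ler_pXn2r ?nnegrE // (le_trans _ xn).
have Sge0 c : S c -> 0 <= c.
  by move=> [y /filter_ex[n]]; apply: le_trans; exact: exprn_ge0.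
have Slb : has_inf S by split=> //; exists 0 => c; exact: Sge0.
pose m := inf S.
have Sm c : S c -> m <= c by apply: ge_inf; exact: (proj2 Slb).
have m0 : 0 <= m by apply: lb_le_inf.
have /choice[f fP] : forall k : nat, exists y,
    \forall n \near F, `|x n - y| ^+ 2 <= m + k.+1%:R^-1.
  move=> k; have [|c [y yc] cm] := @inf_adherent _ S k.+1%:R^-1 _ Slb.
    by rewrite invr_gt0.
  by exists y; apply: filterS yc => n /le_trans; apply; exact: ltW.
have fcvg : cvgn f.
  apply: (cauchy_of_sqdist (K := 2)) => k l.
  suff /Sm : S (m + 2^-1 * (k.+1%:R^-1 + l.+1%:R^-1) - 4^-1 * `|f k - f l| ^+ 2).
    by move: (k.+1%:R^-1) (l.+1%:R^-1) => ik il; lra.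
  exists (2^-1 *: (f k + f l)); apply: filterS2 (fP k) (fP l) => n.
  rewrite (sqnorm_mid Hdot); move: (k.+1%:R^-1) (l.+1%:R^-1) => ik il; lra.
have [y fy] : exists y, f @ \oo --> y by exists (limn f).
exists y, m; split=> [e e0|y' c y'c]; last by apply: Sm; exists y'.
(* This quantity eventually bounds [|x n - y| ^+ 2 - m]: [|x n - f k| ^+ 2 <= m + 1] gives
   [|x n - f k| <= m + 2], which controls the cross term. *)
have /cvgrPdist_lt/(_ _ e0) : k.+1%:R^-1 + `|f k - y| * (2 * (m + 2)) + `|f k - y| ^+ 2
    @[k --> \oo] --> (0 + `|y - y| * (2 * (m + 2)) + `|y - y| ^+ 2 : R).
  have fyy : f k - y @[k --> \oo] --> y - y by apply: cvgB => //; exact: cvg_cst.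
  apply: cvgD; last exact: cvg_sqnorm.
  apply: cvgD; first exact: cvg_harmonic.
  by apply: cvgMr_tmp; exact: cvg_norm.
rewrite subrr normr0 mul0r expr0n /= !add0r => -[k _ /(_ k (leqnn k))] /=.
rewrite sub0r normrN => /(le_lt_trans (ler_norm _)) ke.
apply: filterS (fP k) => n xk.
have -> : x n - y = (x n - f k) + (f k - y) by rewrite addrA subrK.
rewrite (sqnormD Hdot); have := ler_dot Hdot (x n - f k) (f k - y).
have i1 : k.+1%:R^-1 <= 1 :> R by rewrite invf_le1 // ler1n.
have : 0 <= `|x n - f k| by [].
have : 0 <= `|f k - y| by [].
move: (dot _ _) `|x n - f k| `|f k - y| (k.+1%:R^-1) xk ke i1 =>
  s p q i xk ke i1 q0 p0 sp.
have : q * p <= q * (m + 2) by rewrite ler_wpM2l //; nra.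
by nra.
Qed.

(** The midpoint of two centers would have a squared radius smaller by a quarter of
    [|y - y'| ^+ 2]. *)
Lemma asymptotic_center_unique F {FF : ProperFilter F} x y m y' :
  asymptotic_center F x y m ->
  (forall e, 0 < e -> \forall n \near F, `|x n - y'| ^+ 2 <= m + e) -> y = y'.
Proof.
move=> [yP ym] y'P; apply/eqP; rewrite -subr_eq0 -normr_le0.
rewrite (@sqnorm_le _ _ 0) // expr0n; apply/ler_addgt0Pr => e e0.
rewrite add0r; have e4 : 0 < e / 4 by rewrite divr_gt0.
have /ym : \forall n \near F, `|x n - 2^-1 *: (y + y')| ^+ 2 <=
    m + e / 4 - 4^-1 * `|y - y'| ^+ 2.
  apply: filterS2 (yP _ e4) (y'P _ e4) => n; rewrite (sqnorm_mid Hdot); lra.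
lra.
Qed.

(** [T y] is as central as [y], because [|x n - T y|] exceeds [|x n - y|] by at most the residual;
    uniqueness identifies them. *)
Lemma asymptotic_center_nonexp F {FF : ProperFilter F} x y m (T : H -> H) :
  (forall u v, `|T u - T v| <= `|u - v|) ->
  `|x n - T (x n)| @[n --> F] --> (0 : R) ->
  asymptotic_center F x y m -> T y = y.
Proof.
move=> Tne xT yP; have [yub ym] := yP; apply/esym.
have m0 : 0 <= m.
  apply/ler_addgt0Pr => e /yub/filter_ex[n]; apply: le_trans; exact: exprn_ge0.
apply: (asymptotic_center_unique yP) => e e0.
pose e' := Num.min 1 (e / 2).
have e'0 : 0 < e' by rewrite lt_min ltr01 divr_gt0.
(* With [b < d] the residual and [c = |x n - y|], [b ^+ 2 + 2 * b * c <= b * (2 * m + 5)] uses up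
   half of [e]; the slack [e'] in [c ^+ 2 <= m + e'] is the other half. *)
pose d := Num.min 1 (e / (2 * (2 * m + 5))).
have d0 : 0 < d by rewrite lt_min ltr01 divr_gt0 // mulr_gt0 //; lra.
move/cvgrPdist_lt : xT => /(_ _ d0); apply: filterS2 (yub _ e'0) => n le1.
rewrite sub0r normrN ger0_norm // lt_min => /andP[d1].
rewrite ltr_pdivlMr ?mulr_gt0 //; [|lra] => d2.
move: le1; rewrite /e'.
have le1' : Num.min 1 (e / 2) <= 1 by rewrite ge_min lexx.
have le2' : Num.min 1 (e / 2) <= e / 2 by rewrite ge_min lexx orbT.
have : `|x n - T y| <= `|x n - T (x n)| + `|x n - y|.
  have -> : x n - T y = (x n - T (x n)) + (T (x n) - T y) by rewrite addrA subrK.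
  by apply: le_trans (ler_normD _ _) _; rewrite lerD2l.
have : 0 <= `|x n - T (x n)| by [].
have : 0 <= `|x n - y| by [].
have : 0 <= `|x n - T y| by [].
move: le1' le2' d1 d2;
  move: (Num.min _ _) `|x n - T y| `|x n - T (x n)| `|x n - y| => e1 a b c *.
have : a ^+ 2 <= (b + c) ^+ 2 by rewrite ler_pXn2r ?nnegrE // addr_ge0.
have : b * c <= b * (c ^+ 2 + 1) by rewrite ler_wpM2l //; nra.
nra.
Qed.

Lemma opial x (T : H -> H) :
  (forall u v, `|T u - T v| <= `|u - v|) ->
  (exists z, T z = z) ->
  (forall z, T z = z -> cvgn (fun n => `|x n - z|)) ->
  `|x n - T (x n)| @[n --> \oo] --> (0 : R) ->
  exists2 y, T y = y & weakly_converges dot x y.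
Proof.
move=> Tne [z0 Tz0] xcvg xT.
have xsqr z : T z = z -> exists l : R, `|x n - z| ^+ 2 @[n --> \oo] --> l.
  move=> /xcvg /cvg_ex[l xl]; exists (l ^+ 2).
  by rewrite expr2; under eq_fun do rewrite expr2; exact: cvgM.
have [M xM] : exists M, \forall n \near \oo, `|x n| <= M.
  have /cvg_seq_bounded/= [M [_ MP]] := xcvg _ Tz0.
  exists (M + 1 + `|z0|); apply: nearW => n.
  have := MP (M + 1); rewrite ltrDl ltr01 => /(_ isT n I) /= h.
  rewrite -[x n](subrK z0); apply: le_trans (ler_normD _ _) _.
  by rewrite lerD2r (le_trans (ler_norm _)).
have [y [m yP]] := asymptotic_center_exists xM.
have Ty := asymptotic_center_nonexp Tne xT yP.
exists y; first exact: Ty.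
move=> h; apply: contrapT => ncvg.
(* Up to replacing [h] by [- h], failure of convergence is one-sided, so that it singles out a
   half-space. *)
have [e e0 [h' freq]] : exists2 e : R, 0 < e &
    exists h', ~ \forall n \near \oo, dot (x n - y) h' < e.
  apply: contrapT => all; apply: ncvg; apply/cvgrPdist_lt => e e0.
  have lt_e h' : \forall n \near \oo, dot (x n - y) h' < e.
    by apply: contrapT => nlt; apply: all; exists e => //; exists h'.
  apply: filterS2 (lt_e h) (lt_e (- h)) => n.
  by rewrite dotNr distrC -(dotNl dot y) -dotDl ltr_norml => *; lra.
(* The Frechet filter traced on the indices for which [x n] lies in this half-space; it plays the
   part of a subsequence. *)
pose G := within [set n | e <= dot (x n - y) h'] \oo.
have GF : ProperFilter G.
  apply: Build_ProperFilter_ex => A GA.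
  apply: contrapT => noA; apply: freq.
  have : \forall n \near \oo, e <= dot (x n - y) h' -> A n := GA.
  apply: filterS => n An.
  rewrite ltNge; apply/negP => en; apply: noA; exists n; exact: An.
have subG (Q : set nat) : (\forall n \near \oo, Q n) -> \forall n \near G, Q n.
  by apply: filterS => n Qn _.
have [y' [m' y'P]] := asymptotic_center_exists (subG _ xM).
have Ty' : T y' = y'.
  apply: asymptotic_center_nonexp Tne _ y'P.
  by move=> Q /xT; exact: subG.
have [l' xl'] := xsqr _ Ty'.
have xl'_le c : 0 < c -> \forall n \near \oo, `|x n - y'| ^+ 2 <= l' + c.
  move=> c0; move/cvgrPdist_lt : xl' => /(_ _ c0); apply: filterS => n.
  by rewrite ltr_norml => *; lra.
have l'm' : l' <= m'.
  apply/ler_addgt0Pr => c c0; have c2 : 0 < c / 2 by rewrite divr_gt0.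
  move/cvgrPdist_lt : xl' => /(_ _ c2)/subG; move: (y'P.1 _ c2).
  move=> h1 h2; have [n []] := filter_ex (filterI h1 h2).
  by rewrite /= ltr_norml => *; lra.
have m'm : m' <= m.
  apply/ler_addgt0Pr => c c0; apply: (y'P.2 y); apply: subG; exact: yP.1.
(* Along [G] the squared distances to the fixed point [y'] keep the limit [l'] of the whole
   sequence, whence [l' <= m' <= m]: for the whole sequence [y'] is as central as [y]. *)
have yy' : y = y'.
  apply: (asymptotic_center_unique yP) => c c0.
  by apply: filterS (xl'_le _ c0) => n; lra.
(* Since [s ^+ 2 * |h'| ^+ 2 = s * e - s ^+ 2], moving the center from [y] to [y + s *: h'] lowers
   the bound to [m' - s ^+ 2], below the minimum along [G]. *)
pose s := e / (`|h'| ^+ 2 + 1).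
have h1 : 0 < `|h'| ^+ 2 + 1 by rewrite ltr_wpDl ?exprn_ge0.
have s0 : 0 < s by rewrite divr_gt0.
have sE : s * (`|h'| ^+ 2 + 1) = e by rewrite /s divfK ?gt_eqF.
have se : 0 < s * e by rewrite mulr_gt0.
have : \forall n \near G, `|x n - (y + s *: h')| ^+ 2 <=
    m' + s * e - 2 * (s * e) + s ^+ 2 * `|h'| ^+ 2.
  near=> n.
  have -> : x n - (y + s *: h') = (x n - y) - s *: h' by rewrite opprD addrA.
  rewrite (sqnormB Hdot) (sqnormZ Hdot) dotZr.
  have le1 : `|x n - y| ^+ 2 <= m' + s * e.
    by rewrite {1}yy'; near: n; exact: y'P.1.
  have : s * e <= s * dot (x n - y) h'.
    by rewrite ler_pM2l //; near: n; exact: withinT.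
  lra.
move/y'P.2; nra.
Unshelve. all: by end_near.
Qed.

End asymptotic_center.

(** * Convergence of a single path with vanishing residuals *)

Section forward_backward_sequences.
Variables (R : realType) (H : completeNormedModType R).
Variable (dot : {dot H for idfun}).
Hypothesis Hdot : induces_norm dot.
Variables (A : H -> set H) (theta : R) (B : H -> H).
Hypothesis HA : maximally_monotone dot A.
Hypothesis theta_gt0 : 0 < theta.
Hypothesis HB : cocoercive dot theta B.
Let F : set H := zeros (op_add A (of_fun B)).
Let T := forward_backward A B.

(** [dot (x - y) (B x - B y)] is split at [p = T c x]: the Lipschitz bound of [B] controls the part
    with [x - p], monotonicity of [A] between [p] and [y] the part with [p - y]. Small residuals at
    bounded distance thus force [B x] close to [B y]. *)
Lemma forward_backward_gap c x y : 0 < c < 2 * theta -> F y ->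
  theta * `|B x - B y| ^+ 2 <= (theta^-1 + c^-1) * `|x - y| * `|x - T c x|.
Proof.
move=> c02 Fy; have /andP[c0 _] := c02; have [A_mono _] := HA.
have Ay := (zeros_sumE _ _ _).1 Fy.
have Ap : A (T c x) (c^-1 *: (x - c *: B x - T c x)) := resolventP Hdot HA _ c0.
have py : `|T c x - y| <= `|x - y|.
  rewrite -{1}((forward_backward_fix Hdot HA B y c0).2 Ay).
  exact: (forward_backward_nonexp Hdot).
have := A_mono _ _ _ _ Ap Ay; move: py; set p := T c x => py.
have -> : c^-1 *: (x - c *: B x - p) - - B y = c^-1 *: (x - p) - (B x - B y).
  by apply: (dot_inj Hdot) => h; rewrite !dotE; field; rewrite gt_eqF.
rewrite dotDr dotNr dotZr => mono.
apply: le_trans (HB x y) _.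
have -> : dot (x - y) (B x - B y) = dot (x - p) (B x - B y) + dot (p - y) (B x - B y).
  by rewrite -dotDl addrA subrK.
have := ler_dot Hdot (x - p) (B x - B y).
have : `|B x - B y| <= theta^-1 * `|x - y|.
  by rewrite ler_pdivlMl //; exact: (cocoercive_lipschitz Hdot).
move=> /(ler_wpM2l (normr_ge0 (x - p))) lipB /le_trans /(_ lipB) i1.
have : c^-1 * dot (p - y) (x - p) <= c^-1 * (`|x - y| * `|x - p|).
  rewrite ler_pM2l ?invr_gt0 //; apply: le_trans (ler_dot Hdot _ _) _.
  by rewrite ler_wpM2r.
by lra.
Qed.

Variables (gamma : nat -> R) (g : R).
Hypothesis g_gt0 : 0 < g.
Hypothesis g_gamma : forall n, g <= gamma n.
Hypothesis gamma_in : forall n, 0 < gamma n < 2 * theta.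
Variable x : nat -> H.
Hypothesis residual0 : `|x n - T (gamma n) (x n)| @[n --> \oo] --> (0 : R).
Hypothesis fejer : forall z, F z -> cvgn (fun n => `|x n - z|).

(** Opial's lemma wants one operator, whereas the residuals belong to [T (gamma n)]. All step sizes
    in []0, 2 * theta[] give the same fixed points, so [theta] itself is taken, and the residuals
    are transferred at the cost of the factor [2 + theta / g]. *)
Lemma forward_backward_weak : F !=set0 ->
  exists2 y, F y & weakly_converges dot x y.
Proof.
move=> [z0 Fz0].
have theta_in : 0 < theta < 2 * theta by rewrite theta_gt0 ltr_pMl // ltr1n.
have FT z : T theta z = z <-> F z.
  by rewrite /F zeros_sumE; exact: forward_backward_fix.
have [|| z Tz || y Ty xy] := @opial _ _ _ Hdot x (T theta).
- by move=> u v; exact: (forward_backward_nonexp Hdot).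
- by exists z0; exact: (FT z0).2.
- exact: fejer ((FT z).1 Tz).
- apply: (@squeeze_cvgr _ _ _ _ (fun=> 0)
    (fun n => (2 + theta / g) * `|x n - T (gamma n) (x n)|)).
  + apply: nearW => n; rewrite normr_ge0 /=.
    have /andP[gn0 _] := gamma_in n.
    apply: le_trans (forward_backward_residual Hdot HA B _ gn0 theta_gt0) _.
    rewrite ler_wpM2r // lerD2l ler_pM2l // lef_pV2 ?posrE //.
  + exact: cvg_cst.
  + by rewrite -[X in _ --> X](mulr0 (2 + theta / g)); exact: cvgMl_tmp.
- by exists y; first exact: (FT y).1.
Qed.

Lemma forward_backward_B_cvg y : F y -> B (x n) @[n --> \oo] --> B y.
Proof.
move=> Fy; have [M xM] : exists M, forall n, `|x n - y| <= M.
  have /cvg_seq_bounded/= [M [_ MP]] := fejer Fy.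
  exists (M + 1) => n; have := MP (M + 1); rewrite ltrDl ltr01 => /(_ isT n I) /=.
  exact: le_trans (ler_norm _).
have sqr0 : `|B y - B (x n)| ^+ 2 @[n --> \oo] --> (0 : R).
  pose C := theta^-1 * ((theta^-1 + g^-1) * M).
  apply: (@squeeze_cvgr _ _ _ _ (fun=> 0)
    (fun n => C * `|x n - T (gamma n) (x n)|)).
  + apply: nearW => n; rewrite exprn_ge0 //= distrC.
    rewrite /C -mulrA ler_pdivlMl //; have /andP[gn0 _] := gamma_in n.
    apply: le_trans (forward_backward_gap _ (gamma_in n) Fy) _.
    apply: ler_pM => //; first by rewrite mulr_ge0 // addr_ge0 ?invr_ge0 // ltW.
    apply: ler_pM => //; first by rewrite addr_ge0 ?invr_ge0 // ltW.
    by rewrite lerD2l lef_pV2.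
  + exact: cvg_cst.
  + by rewrite -[X in _ --> X](mulr0 C); exact: cvgMl_tmp.
apply/cvgrPdist_lt => e e0.
have /cvgrPdist_lt/(_ (e ^+ 2)) := sqr0; rewrite exprn_gt0 // => /(_ isT).
apply: filterS => n; rewrite sub0r normrN ger0_norm ?exprn_ge0 //.
by rewrite ltr_pXn2r ?nnegrE // ltW.
Qed.

(** Demiregularity of [A] is applied to [p n = T (gamma n) (x n)], which is paired in the graph with
    [(gamma n)^-1 *: (x n - p n) - B (x n)]; these vectors tend to [- B y] because [gamma n] stays
    above [g]. *)
Lemma forward_backward_strong y : F y -> weakly_converges dot x y ->
  demiregular dot A y \/ demiregular dot (of_fun B) y -> x @ \oo --> y.
Proof.
move=> Fy xy; have BxBy := forward_backward_B_cvg Fy.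
case=> [[_ reg]|[_ reg]]; last first.
  by apply: (reg x (fun n => B (x n)) (B y)).
pose p n := T (gamma n) (x n).
have xp0 : x n - p n @[n --> \oo] --> (0 : H) by apply/norm_cvg0P.
have py : p @ \oo --> y.
  apply: (reg p (fun n => (gamma n)^-1 *: (x n - gamma n *: B (x n) - p n)) (- B y)).
  - by move=> n; apply: (resolventP Hdot HA); have /andP[] := gamma_in n.
  - exact: (zeros_sumE _ _ _).1 Fy.
  - move=> h; have -> : p = (fun n => x n - (x n - p n)).
      by apply/funext => n; rewrite opprB addrC subrK.
    under eq_fun do rewrite dotDl dotNl.
    rewrite -[dot y h]subr0 -(dot0l dot h).
    by apply: cvgB; [exact: xy|exact: (dot_cvgl Hdot)].
  - have -> : (fun n => (gamma n)^-1 *: (x n - gamma n *: B (x n) - p n)) =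
      (fun n => (gamma n)^-1 *: (x n - p n) - B (x n)).
      apply/funext => n; have /andP[gn0 _] := gamma_in n.
      by apply: (dot_inj Hdot) => h; rewrite !dotE; field; rewrite gt_eqF.
    rewrite -[- B y]add0r; apply: cvgB => //; apply/norm_cvg0P.
    apply: (@squeeze_cvgr _ _ _ _ (fun=> 0) (fun n => g^-1 * `|x n - p n|)).
    + apply: nearW => n; have /andP[gn0 _] := gamma_in n.
      rewrite normr_ge0 normrZ gtr0_norm ?invr_gt0 //=.
      by rewrite ler_wpM2r // lef_pV2.
    + exact: cvg_cst.
    + by rewrite -[X in _ --> X](mulr0 g^-1); exact: cvgMl_tmp.
have -> : x = (fun n => p n + (x n - p n)).
  by apply/funext => n; rewrite addrC subrK.
by rewrite -[y]addr0; exact: cvgD.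
Qed.

End forward_backward_sequences.

(** * Summable nonnegative sequences *)

Section bounded_sums.
Variable R : realType.
Implicit Types u v : nat -> R.

(** For nonnegative sequences this is summability, in a form that passes to smaller sequences
    without any convergence argument. *)
Definition bounded_sums u := exists M, forall n, \sum_(i < n) u i <= M.

Lemma bounded_sumsD u v : bounded_sums u -> bounded_sums v ->
  bounded_sums (fun n => u n + v n).
Proof.
move=> [M uM] [N vN]; exists (M + N) => n.
by rewrite big_split lerD.
Qed.

Lemma bounded_sumsZ c u : 0 <= c -> bounded_sums u ->
  bounded_sums (fun n => c * u n).
Proof.
by move=> c0 [M uM]; exists (c * M) => n; rewrite -mulr_sumr ler_wpM2l.
Qed.

Lemma bounded_sums_le u v : (forall n, u n <= v n) -> bounded_sums v ->
  bounded_sums u.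
Proof.
by move=> uv [M vM]; exists M => n; apply: le_trans (vM n); exact: ler_sum.
Qed.

Lemma bounded_sums_bounded u : (forall n, 0 <= u n) -> bounded_sums u ->
  exists2 M, 0 <= M & forall n, u n <= M.
Proof.
move=> u0 [M uM]; exists M; first by have := uM 0%N; rewrite big_ord0.
move=> n; apply: le_trans (uM n.+1); rewrite big_ord_recr /= lerDr.
exact: sumr_ge0.
Qed.

Lemma bounded_sumsM u v : (forall n, 0 <= u n) -> (forall n, 0 <= v n) ->
  bounded_sums u -> bounded_sums v -> bounded_sums (fun n => u n * v n).
Proof.
move=> u0 v0 /(bounded_sums_bounded u0)[M M0 uM] bv.
apply: bounded_sums_le (bounded_sumsZ M0 bv) => n.
by rewrite ler_wpM2r.
Qed.

Lemma bounded_sums_geo : bounded_sums (fun n => 2^-1 ^+ n).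
Proof.
exists 2 => n; suff -> : \sum_(i < n) 2^-1 ^+ i = 2 - 2 * 2^-1 ^+ n :> R.
  by rewrite gerBl mulr_ge0 // exprn_ge0 // invr_ge0.
elim: n => [|n IH]; first by rewrite big_ord0 expr0; ring.
by rewrite big_ord_recr /= IH exprS; field.
Qed.

Lemma nneseries_bounded_sums u : (forall n, 0 <= u n) ->
  ((\sum_(0 <= n <oo) (u n)%:E < +oo)%E <-> bounded_sums u).
Proof.
move=> u0; have sumE n : (\sum_(0 <= i < n) (u i)%:E = (\sum_(i < n) u i)%:E)%E.
  by rewrite sumEFin big_mkord.
split=> [fin|[M uM]].
  exists (fine (\sum_(0 <= n <oo) (u n)%:E)%E) => n.
  rewrite -lee_fin fineK; last first.
    by rewrite ge0_fin_numE // nneseries_ge0 // => i _ _; rewrite lee_fin.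
  by rewrite -sumE; apply: nneseries_lim_ge => i _ _; rewrite lee_fin.
apply: le_lt_trans (ltry M); apply: lime_le.
  by apply: is_cvg_nneseries => i _ _; rewrite lee_fin.
by apply: nearW => n; rewrite sumE lee_fin.
Qed.

Lemma bounded_sums_cvg0 u : (forall n, 0 <= u n) -> bounded_sums u ->
  u @ \oo --> (0 : R).
Proof.
move=> u0 [M uM]; apply: cvg_series_cvg_0.
apply: nondecreasing_is_cvgn.
  by apply/nondecreasing_seqP => n; rewrite /series /= big_nat_recr //= lerDl.
by exists M => _ [n _ <-]; rewrite /series /= big_mkord.
Qed.

Lemma bounded_sums_eventually_le u v : (forall n, 0 <= u n) ->
  (forall n, 0 <= v n) -> (\forall n \near \oo, u n <= v n) ->
  bounded_sums v -> bounded_sums u.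
Proof.
move=> u0 v0 [N _ uv] [M vM]; exists (\sum_(i < N) u i + M) => n.
apply: (@le_trans _ _ (\sum_(i < N) u i + \sum_(i < n) v i)); last by rewrite lerD2l.
elim: n => [|n IH]; first by rewrite !big_ord0 addr0 sumr_ge0.
have [nN|Nn] := ltnP n N.
  rewrite -[X in \sum_(i < X) u i + _](subnKC nN) big_split_ord /= -addrA lerDl.
  by rewrite addr_ge0 // sumr_ge0.
by rewrite !big_ord_recr /= addrA lerD // uv.
Qed.

(** If [l] were positive, [u n <= (l / 2)^-1 * (u n * v n)] would hold eventually, and [u] would be
    summable. *)
Lemma weighted_sums_cvg0 u v l : (forall n, 0 <= u n) ->
  (\sum_(0 <= n <oo) (u n)%:E = +oo)%E ->
  (forall n, 0 <= v n) -> bounded_sums (fun n => u n * v n) ->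
  v @ \oo --> (l : R) -> l = 0.
Proof.
move=> u0 uoo v0 buv vl; have l0 : 0 <= l.
  by apply: (ler_cvg_to (cvg_cst 0) vl); exact: nearW.
apply/eqP; rewrite eq_le l0 andbT leNgt; apply/negP => lt0.
suff : bounded_sums u by move/(nneseries_bounded_sums u0); rewrite uoo ltxx.
have l2 : 0 < l / 2 by rewrite divr_gt0.
have l2' : 0 <= (l / 2)^-1 by rewrite invr_ge0 ltW.
apply: (bounded_sums_eventually_le u0 _ _ (bounded_sumsZ l2' buv)).
  by move=> n; rewrite !mulr_ge0.
move/cvgrPdist_lt : vl => /(_ _ l2); apply: filterS => n.
rewrite ltr_norml ler_pdivlMl // => /andP[_ lt2].
by rewrite mulrC ler_wpM2l //; lra.
Qed.

End bounded_sums.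

(** * Conditional inequalities *)

Section adapted_functions.
Variables (d : measure_display) (Omega : measurableType d) (R : realType).
Variable G : set (set Omega).

(** The notion of [measurable_wrt], phrased on the generated type so that the closure properties of
    measurable functions apply. *)
Definition gmeas (f : Omega -> R) := measurable_fun [set: g_sigma_algebraType G] f.

Hypothesis HG : sub_sigma_field G.

Lemma gmeasE f : gmeas f <-> measurable_wrt G f.
Proof.
split=> [mf B mB|mf _ B mB].
  have := mf measurableT B mB; rewrite setTI.
  by rewrite /measurable/= sigma_algebra_id //; exact: HG.1.
by rewrite setTI; apply: sub_sigma_algebra; exact: mf.
Qed.

Lemma gmeas_set (D : set Omega) :
  measurable (D : set (g_sigma_algebraType G)) -> G D.
Proof. by rewrite /measurable/= sigma_algebra_id //; exact: HG.1. Qed.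

Lemma gmeas_measurable f : gmeas f -> measurable_fun setT f.
Proof.
by move=> /gmeasE mf _ B mB; rewrite setTI; apply: HG.2; exact: mf.
Qed.

End adapted_functions.

Lemma gmeasS (d : measure_display) (Omega : measurableType d) (R : realType)
    (G G' : set (set Omega)) (f : Omega -> R) :
  sub_sigma_field G -> sub_sigma_field G' -> G `<=` G' -> gmeas G f -> gmeas G' f.
Proof.
move=> HG HG' GG' /(gmeasE HG) mf; apply/(gmeasE HG') => B mB.
exact/GG'/mf.
Qed.

Lemma measurable_fun_sqrtr (d : measure_display) (T : measurableType d)
    (R : realType) (f : T -> R) :
  measurable_fun setT f -> measurable_fun setT (fun w => Num.sqrt (f w)).
Proof.
by move=> mf; apply: measurableT_comp => //; apply: continuous_measurable_fun;
  exact: sqrt_continuous.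
Qed.

Lemma measurable_fun_invr (d : measure_display) (T : measurableType d)
    (R : realType) (f : T -> R) : (forall w, 0 <= f w) ->
  measurable_fun setT f -> measurable_fun setT (fun w => (f w)^-1).
Proof.
move=> f0 mf; rewrite (_ : (fun w => _) = (fun w => f w `^ (- 1))).
  exact: (measurableT_comp (measurable_powR (- 1)) mf).
by apply/funext => w; rewrite powR_inv1.
Qed.

Section gmeas_operations.
Variables (d : measure_display) (Omega : measurableType d) (R : realType).
Variable G : set (set Omega).
Implicit Types f g : Omega -> R.

Lemma gmeas_cst (c : R) : gmeas G (fun=> c).
Proof. exact: measurable_cst. Qed.

Lemma gmeasD f g : gmeas G f -> gmeas G g -> gmeas G (fun w => f w + g w).
Proof. exact: measurable_funD. Qed.

Lemma gmeasB f g : gmeas G f -> gmeas G g -> gmeas G (fun w => f w - g w).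
Proof. exact: measurable_funB. Qed.

Lemma gmeasM f g : gmeas G f -> gmeas G g -> gmeas G (fun w => f w * g w).
Proof. exact: measurable_funM. Qed.

Lemma gmeasX f n : gmeas G f -> gmeas G (fun w => f w ^+ n).
Proof. exact: measurable_funX. Qed.

Lemma gmeasV f : (forall w, 0 <= f w) -> gmeas G f -> gmeas G (fun w => (f w)^-1).
Proof. by move=> f0 mf; apply: measurable_fun_invr. Qed.

Lemma gmeas_sqrt f : gmeas G f -> gmeas G (fun w => Num.sqrt (f w)).
Proof. exact: measurable_fun_sqrtr. Qed.

Lemma gmeas_sum n (f : nat -> Omega -> R) :
  (forall i : 'I_n, gmeas G (f i)) -> gmeas G (fun w => \sum_(i < n) f i w).
Proof. by move=> mf; apply: measurable_sum => i; exact: mf. Qed.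

Lemma gmeas_ifT (b : Omega -> bool) :
  measurable_fun [set: g_sigma_algebraType G] b ->
  gmeas G (fun w => if b w then 1 else 0 : R).
Proof. by move=> mb; apply: measurable_fun_ifT. Qed.

End gmeas_operations.

Lemma integral_setI_indic (d : measure_display) (T : measurableType d)
    (R : realType) (mu : measure T R) (D E : set T) (f : T -> R) :
  (\int[mu]_(w in D `&` E) (f w)%:E = \int[mu]_(w in D) (\1_E w * f w)%:E)%E.
Proof.
rewrite integral_mkcondr; apply: eq_integral => w _.
by rewrite patchE indicE; case: ifPn => _; rewrite ?mul1r ?mul0r.
Qed.

Section conditional_domination.
Import HBNNSimple.
Variables (d : measure_display) (Omega : measurableType d) (R : realType).
Variable (P : probability Omega R).

(* Means [E(f | G) <= E(g | G)]; it makes sense for all nonnegative measurable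
   functions, integrable or not. *)
Definition cond_le (G : set (set Omega)) (f g : Omega -> R) := forall D, G D ->
  (\int[P]_(w in D) (f w)%:E <= \int[P]_(w in D) (g w)%:E)%E.

Variable G : set (set Omega).
Hypothesis HG : sub_sigma_field G.
Implicit Types f g h : Omega -> R.

Let GM D : G D -> measurable D.
Proof. exact: HG.2. Qed.

Let mE f (D : set Omega) : measurable_fun setT f -> measurable_fun D (EFin \o f).
Proof. by move=> mf; apply/measurable_EFinP; exact: measurable_funTS. Qed.

Lemma ae_cond_le f g : (forall w, 0 <= f w) -> (forall w, 0 <= g w) ->
  measurable_fun setT f -> measurable_fun setT g ->
  {ae P, forall w, f w <= g w} -> cond_le G f g.
Proof.
move=> f0 g0 mf mg fg D GD; apply: ae_ge0_le_integral.
- exact: GM.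
- by move=> w _; rewrite lee_fin.
- exact: mE.
- by move=> w _; rewrite lee_fin.
- exact: mE.
- by apply: filterS fg => w fg _; rewrite lee_fin.
Qed.

Lemma cond_le_trans f g h : cond_le G f g -> cond_le G g h -> cond_le G f h.
Proof. by move=> fg gh D GD; apply: le_trans (fg D GD) (gh D GD). Qed.

Lemma cond_leD f g f' g' : (forall w, 0 <= f w) -> (forall w, 0 <= g w) ->
  (forall w, 0 <= f' w) -> (forall w, 0 <= g' w) ->
  measurable_fun setT f -> measurable_fun setT g ->
  measurable_fun setT f' -> measurable_fun setT g' ->
  cond_le G f g -> cond_le G f' g' ->
  cond_le G (fun w => f w + f' w) (fun w => g w + g' w).
Proof.
move=> f0 g0 f'0 g'0 mf mg mf' mg' fg fg' D GD.
have intD (k k' : Omega -> R) : (forall w, 0 <= k w) -> (forall w, 0 <= k' w) ->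
    measurable_fun setT k -> measurable_fun setT k' ->
    (\int[P]_(w in D) (k w + k' w)%:E =
     \int[P]_(w in D) (k w)%:E + \int[P]_(w in D) (k' w)%:E)%E.
  move=> k0 k'0 mk mk'; under eq_integral do rewrite EFinD.
  rewrite ge0_integralD//; first [by apply: GM|by apply: mE|by move=> w _;
    rewrite lee_fin].
by rewrite (intD f f') // (intD g g') // leeD // ?fg ?fg'.
Qed.

Lemma cond_leM h f g : (forall w, 0 <= h w) -> (forall w, 0 <= f w) ->
  (forall w, 0 <= g w) -> measurable_fun setT f -> measurable_fun setT g ->
  gmeas G h -> cond_le G f g ->
  cond_le G (fun w => h w * f w) (fun w => h w * g w).
Proof.
move=> h0 f0 g0 mf mg mh fg D GD.
have mh' : measurable_fun [set: g_sigma_algebraType G] (EFin \o h).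
  exact/measurable_EFinP.
have h0' (w : g_sigma_algebraType G) : setT w -> (0 <= (EFin \o h) w)%E.
  by move=> _; rewrite lee_fin.
pose s := nnsfun_approx measurableT mh'.
have ms n : measurable_fun setT (s n : Omega -> R).
  by apply: (gmeas_measurable HG); exact: measurable_funPT.
have sh w : (s n w)%:E @[n --> \oo] --> (h w)%:E.
  exact: (cvg_nnsfun_approx measurableT mh' h0' (Logic.I : setT w)).
have s_nd w m n : (m <= n)%N -> s m w <= s n w.
  by move=> mn; have /lefP := nd_nnsfun_approx measurableT mh' mn; apply.
have lim_s (k : Omega -> R) : (forall w, 0 <= k w) -> measurable_fun setT k ->
    (\int[P]_(w in D) (s n w * k w)%:E @[n --> \oo] -->
     \int[P]_(w in D) (h w * k w)%:E)%E.
  move=> k0 mk.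
  have -> : (\int[P]_(w in D) (h w * k w)%:E =
      \int[P]_(w in D) limn (fun n => (s n w * k w)%:E))%E.
    apply: eq_integral => w _; apply/esym/cvg_lim => //.
    under eq_fun do rewrite EFinM.
    by rewrite EFinM; apply: cvgeZr.
  apply: cvg_monotone_convergence.
  - exact: GM.
  - by move=> n; apply/mE/measurable_funM.
  - by move=> n w _; rewrite lee_fin mulr_ge0.
  - by move=> w _ m n mn; rewrite lee_fin ler_wpM2r // s_nd.
apply: (lee_cvg_to (lim_s _ f0 mf) (lim_s _ g0 mg)); apply: nearW => n.
have levelsE (k : Omega -> R) : (forall w, 0 <= k w) -> measurable_fun setT k ->
    (\int[P]_(w in D) (s n w * k w)%:E =
     \sum_(y \in range (s n)) y%:E * \int[P]_(w in D `&` (s n @^-1` [set y])) (k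
       w)%:E)%E.
  move=> k0 mk; have mDs y : measurable (D `&` (s n @^-1` [set y])).
    apply: measurableI; first exact: GM.
    by rewrite -[X in measurable X]setTI; exact: ms.
  (* [|y|] equals [y] on the range of [s n] and keeps the summand nonnegative for every other real
     [y]. *)
  transitivity (\int[P]_(w in D)
      (\sum_(y \in range (s n)) (`|y| * (\1_(s n @^-1` [set y]) w * k w))%:E)%E)%E.
    apply: eq_integral => w _; rewrite [in LHS]fimfunE mulr_fsuml fsumEFin //.
    congr EFin; apply: eq_fsbigr => y; rewrite inE => -[v _ <-].
    by rewrite ger0_norm // mulrA.
  have ind0 y (w : Omega) : 0 <= \1_(s n @^-1` [set y]) w * k w by rewrite mulr_ge0.
  have mind y : measurable_fun [set: Omega] (fun w :
    Omega => \1_(s n @^-1` [set y]) w * k w).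
    apply: measurable_funM => //; apply: measurable_indic.
    by rewrite -[X in measurable X]setTI; exact: ms.
  rewrite ge0_integral_fsum //; first last.
  - by move=> y w _; rewrite lee_fin mulr_ge0.
  - by move=> y; apply/mE/measurable_funM.
  - exact: GM.
  apply: eq_fsbigr => y; rewrite inE => -[v _ <-].
  under eq_integral do rewrite EFinM.
  rewrite ge0_integralZl_EFin // ?ger0_norm ?integral_setI_indic //.
  - exact: GM.
  - by move=> w _; rewrite lee_fin.
  - exact: mE.
rewrite (levelsE f) // (levelsE g) //.
apply: lee_fsum => // _ [w _ <-]; apply: lee_wpmul2l; rewrite ?lee_fin //.
apply: fg; rewrite -(setTI (s n @^-1` _)).
apply: gmeas_set => //; apply: measurableI; last exact: measurable_funPT.
exact: sub_sigma_algebra.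
Qed.

End conditional_domination.

(** * Supermartingales *)

Section upcrossings.
Variable R : realType.
Implicit Types (a b : R) (y : nat -> R).

(** Doob's betting strategy: a position opens when the value falls below [a] and is held until the
    value exceeds [b]. The decision for the step from [n] to [n.+1] uses only [y 0, ..., y n]. *)
Fixpoint active a b y n : bool :=
  if n is m.+1 then (if active a b y m then y n <= b else y n < a) else y 0%N < a.

Fixpoint upcrossings a b y n : nat :=
  if n is m.+1 then upcrossings a b y m + (active a b y m && (b < y n)) else 0%N.

(** The strategy gains at least [b - a] per upcrossing and loses at most [a] on the position still
    open, as [y] is nonnegative. Purchases and sales stand on different sides so that both sides can
    be integrated as nonnegative functions. *)
Lemma upcrossings_gain a b y n : 0 <= a -> a <= b -> (forall n, 0 <= y n) ->
  (b - a) * (upcrossings a b y n)%:R + \sum_(i < n) (active a b y i)%:R * y i <=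
  \sum_(i < n) (active a b y i)%:R * y i.+1 + a.
Proof.
move=> a0 ab y0.
(* The induction values an open position at [y n - a], which is at least [- a]. *)
suff : (b - a) * (upcrossings a b y n)%:R + (active a b y n)%:R * (y n - a)
    + \sum_(i < n) (active a b y i)%:R * y i <=
    \sum_(i < n) (active a b y i)%:R * y i.+1.
  have := y0 n; case: (active a b y n) => /=; lra.
elim: n => [|n IH].
  rewrite !big_ord0 /=; case: ltP => /= [ya|_]; lra.
rewrite !big_ord_recr /= natrD.
move: IH; case: (active a b y n) => /=; last first.
  by case: ltP => /= [ya|_]; lra.
by case: leP => /= [yb|yb]; lra.
Qed.

Lemma upcrossings_nd a b y : {homo upcrossings a b y : m n / (m <= n)%N}.
Proof. by apply: homo_leq => //= [n m p|n]; [exact: leq_trans|exact: leq_addr]. Qed.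

(** Once the count has become constant, an open position never closes, so [y] stays at most [b]; if
    none is ever open, [y] stays at least [a]. *)
Lemma upcrossings_bounded a b y N : (forall n, (upcrossings a b y n <= N)%N) ->
  (\forall n \near \oo, y n <= b) \/ (\forall n \near \oo, a <= y n).
Proof.
move=> upN; have [n0 n0P] : exists n0, forall n, (n0 <= n)%N ->
    upcrossings a b y n = upcrossings a b y n0.
  have [m mP] : exists m, forall n, (upcrossings a b y n <= upcrossings a b y m)%N.
    elim: N upN => [|N IH] upN.
      by exists 0%N => n; apply: leq_trans (upN n) _.
    have [[m mE]|noN] := pselect (exists m, upcrossings a b y m = N.+1).
      by exists m => n; rewrite mE.
    apply: IH => n; have := upN n; rewrite leq_eqVlt => /orP[/eqP nE|//].
    by case: noN; exists n.
  exists m => n mn; apply/eqP; rewrite eqn_leq mP /=.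
  exact: upcrossings_nd.
have noup n : (n0 <= n)%N -> active a b y n -> y n.+1 <= b.
  move=> n0n actn; have := n0P n.+1 (leqW n0n); rewrite /= (n0P n n0n) actn /=.
  by rewrite leNgt; case: ltP => //= _; lia.
have [[k n0k actk]|noact] := pselect (exists2 k, (n0 <= k)%N & active a b y k).
  left; exists k.+1 => // n /= kn.
  have act m : active a b y (k + m).
    elim: m => [|m IH]; first by rewrite addn0.
    by rewrite addnS /= IH; apply: noup => //; exact: leq_trans n0k (leq_addr _ _).
  case: n kn => // n; rewrite ltnS => kn; apply: noup.
    exact: leq_trans n0k kn.
  by rewrite -(subnKC kn).
right; exists n0.+1 => // -[//|n] /=; rewrite ltnS => n0n.
rewrite leNgt; apply/negP => ya; apply: noact; exists n.+1; first exact: leqW.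
rewrite /= ya; case: ifP => // actn; exact: noup.
Qed.

(** The limit is the supremum of the eventual lower bounds: two levels just above it force the first
    alternative. Rational levels keep the exceptional null sets countable in number. *)
Lemma cvg_of_no_oscillation y : (forall n, 0 <= y n) ->
  (forall a b : rat, (0 <= a < b)%R ->
    (\forall n \near \oo, y n <= ratr b) \/ (\forall n \near \oo, ratr a <= y n)) ->
  ~ (forall K : R, \forall n \near \oo, K <= y n) -> cvgn y.
Proof.
move=> y0 alt /existsNP[K nK].
pose S := [set a : R | \forall n \near \oo, a <= y n].
have S0 : S !=set0 by exists 0; apply: nearW.
have Sub : has_ubound S.
  exists K => a aS; rewrite leNgt; apply/negP => Ka; apply: nK.
  by apply: filterS aS => n; apply: le_trans; exact: ltW.
have supS : has_sup S by split.
have sup0 : 0 <= sup S by apply: ub_le_sup => //; apply: nearW.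
apply/cvg_ex; exists (sup S); apply/cvgrPdist_lt => e e0.
have [a aS lta] := sup_adherent e0 supS.
have /rat_in_itvoo[p] : sup S < sup S + e / 2 by lra.
have /rat_in_itvoo[q] : sup S + e / 2 < sup S + e by lra.
rewrite !in_itv /= => /andP[q1 q2] /andP[p1 p2].
have pq : (0 <= p < q)%R.
  rewrite -(ler0q R) -(ltr_rat R); apply/andP; split; lra.
have [yq|yp] := alt _ _ pq; last first.
  have := ub_le_sup Sub yp; lra.
apply: filterS2 aS yq => n an yq; rewrite ltr_norml; apply/andP; split; lra.
Qed.

End upcrossings.

Section supermartingales.
Variables (d : measure_display) (Omega : measurableType d) (R : realType).
Variable (P : probability Omega R).
Variable X : nat -> set (set Omega).
Hypothesis X_sub : forall n, sub_sigma_field (X n).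
Hypothesis X_nd : forall n, X n `<=` X n.+1.

Lemma filtration_le m n : (m <= n)%N -> X m `<=` X n.
Proof.
move=> mn; rewrite -(subnKC mn); elim: (n - m)%N => [|k IH]; first by rewrite addn0.
by rewrite addnS; apply: subset_trans IH _.
Qed.

Lemma gmeas_le m n (f : Omega -> R) : (m <= n)%N -> gmeas (X m) f -> gmeas (X n) f.
Proof. by move=> mn; apply: gmeasS => //; exact: filtration_le. Qed.

Section nonnegative.
Variable Y : nat -> Omega -> R.
Hypothesis Y_ge0 : forall n w, 0 <= Y n w.
Hypothesis Y_adapted : forall n, gmeas (X n) (Y n).
Hypothesis Y0_fin : (\int[P]_w (Y 0%N w)%:E < +oo)%E.
Hypothesis Y_super : forall n, cond_le P (X n) (Y n.+1) (Y n).

Let mY n : measurable_fun setT (Y n).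
Proof. exact: (gmeas_measurable (X_sub n) (@Y_adapted n)). Qed.

Let XT : X 0%N setT.
Proof. by have [[X00 XC _] _] := X_sub 0; rewrite -(setD0 setT); exact: XC. Qed.

Let intY n : (\int[P]_w (Y n w)%:E <= \int[P]_w (Y 0%N w)%:E)%E.
Proof.
elim: n => // n; apply: le_trans; apply: Y_super.
exact: filtration_le XT.
Qed.

Let active_adapted a b n : gmeas (X n) (fun w => (active a b (Y ^~ w) n)%:R : R).
Proof.
have natb (g : Omega -> bool) k : measurable_fun [set: g_sigma_algebraType (X k)] g ->
    gmeas (X k) (fun w => (g w)%:R : R).
  move=> mg; rewrite (_ : (fun w => _) = (fun w => if g w then 1 else 0)); last first.
    by apply/funext => w; case: (g w).
  by apply: measurable_fun_ifT.
apply: natb; elim: n => [|n IH] /=.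
  by apply: measurable_fun_ltr; [exact: Y_adapted|exact: measurable_cst].
have IH' : measurable_fun [set:
  g_sigma_algebraType (X n.+1)] (fun w => active a b (Y ^~ w) n).
  move=> _ B mB; rewrite setTI; apply: sub_sigma_algebra; apply: X_nd.
  apply: (gmeas_set (X_sub n)); rewrite -[X in measurable X]setTI; exact: IH.
apply: measurable_fun_ifT => //.
  by apply: measurable_fun_ler; [exact: Y_adapted|exact: measurable_cst].
by apply: measurable_fun_ltr; [exact: Y_adapted|exact: measurable_cst].
Qed.

Let mactive a b n : measurable_fun setT (fun w => (active a b (Y ^~ w) n)%:R : R).
Proof. exact: (gmeas_measurable (X_sub n) (@active_adapted a b n)). Qed.

Let mupcrossings a b n :
  measurable_fun setT (fun w => (upcrossings a b (Y ^~ w) n)%:R : R).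
Proof.
elim: n => [|n IH] /=; first exact: measurable_cst.
under eq_fun do rewrite natrD.
apply: measurable_funD => //.
rewrite (_ : (fun w => _) = (fun w =>
  (active a b (Y ^~ w) n)%:R * (if b < Y n.+1 w then 1 else 0))); last first.
  by apply/funext => w; case: (active _ _ _ n); case: ltP; rewrite ?mulr1 ?mulr0.
apply: measurable_funM => //; apply: measurable_fun_ifT => //.
exact: measurable_fun_ltr.
Qed.

(** The stake [act i] is nonnegative and [X i]-measurable, so [cond_leM] makes the expected gain of
    the strategy nonpositive; the bound [a] on the final loss remains. *)
Let upcrossings_integral a b n : 0 <= a -> a <= b ->
  (\int[P]_w ((b - a) * (upcrossings a b (Y ^~ w) n)%:R)%:E <= a%:E)%E.
Proof.
move=> a0 ab.
pose act i w : R := (active a b (Y ^~ w) i)%:R.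
pose f w := \sum_(i < n) act i w * Y i w.
pose g w := \sum_(i < n) act i w * Y i.+1 w.
have mf : measurable_fun setT f.
  by apply: measurable_sum => i; apply: measurable_funM => //; exact: mactive.
have mg : measurable_fun setT g.
  by apply: measurable_sum => i; apply: measurable_funM => //; exact: mactive.
have act0 i w : 0 <= act i w by rewrite /act.
have f0 w : 0 <= f w by apply: sumr_ge0 => i _; rewrite mulr_ge0.
have g0 w : 0 <= g w by apply: sumr_ge0 => i _; rewrite mulr_ge0.
have intD (h k : Omega -> R) : (forall w, 0 <= h w) -> (forall w, 0 <= k w) ->
    measurable_fun setT h -> measurable_fun setT k ->
    (\int[P]_w (h w + k w)%:E = \int[P]_w (h w)%:E + \int[P]_w (k w)%:E)%E.
  move=> h0 k0 mh mk; under eq_integral do rewrite EFinD.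
  rewrite ge0_integralD //.
  - by move=> w _; rewrite lee_fin.
  - exact/measurable_EFinP.
  - by move=> w _; rewrite lee_fin.
  - exact/measurable_EFinP.
have int_sum (h : nat -> Omega -> R) : (forall i w, 0 <= h i w) ->
    (forall i, measurable_fun setT (h i)) ->
    (\int[P]_w (\sum_(i < n) h i w)%:E = \sum_(i < n) \int[P]_w (h i w)%:E)%E.
  move=> h0 mh; under eq_integral do rewrite -sumEFin.
  rewrite ge0_integral_sum //.
  - by move=> i; exact/measurable_EFinP.
  - by move=> i w _; rewrite lee_fin.
have mh i j : measurable_fun setT (fun w => act i w * Y j w).
  by apply: measurable_funM => //; exact: mactive.
have h0 i j w : 0 <= act i w * Y j w by rewrite mulr_ge0.
have gf : (\int[P]_w (g w)%:E <= \int[P]_w (f w)%:E)%E.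
  rewrite (int_sum (fun i w => act i w * Y i w)) //.
  rewrite (int_sum (fun i w => act i w * Y i.+1 w)) //.
  apply: lee_sum => i _.
  apply: (cond_leM (X_sub i) (act0 i) (Y_ge0 i.+1) (Y_ge0 i) (@mY _) (@mY _)).
  - exact: active_adapted.
  - exact: Y_super.
  - exact: filtration_le XT.
(* Finiteness allows this integral to be cancelled at the end. *)
have fin_f : (\int[P]_w (f w)%:E < +oo)%E.
  rewrite (int_sum (fun i w => act i w * Y i w)) //.
  apply: lte_sum_pinfty => i _; apply: le_lt_trans (le_lt_trans (intY i) Y0_fin).
  apply: ge0_le_integral => //.
  - by move=> w _; rewrite lee_fin.
  - exact/measurable_EFinP.
  - exact/measurable_EFinP.
  - by move=> w _; rewrite lee_fin /act; case: active; rewrite ?mul1r ?mul0r.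
have fn : (\int[P]_w (f w)%:E)%E \is a fin_num.
  by rewrite ge0_fin_numE //; apply: integral_ge0 => w _; rewrite lee_fin.
have up0 w : 0 <= (b - a) * (upcrossings a b (Y ^~ w) n)%:R.
  by rewrite mulr_ge0 // subr_ge0.
have mup : measurable_fun setT (fun w => (b - a) * (upcrossings a b (Y ^~ w) n)%:R).
  by apply: measurable_funM.
have : (\int[P]_w ((b - a) * (upcrossings a b (Y ^~ w) n)%:R + f w)%:E <=
    \int[P]_w (g w + a)%:E)%E.
  apply: ge0_le_integral => //.
  - by move=> w _; rewrite lee_fin addr_ge0.
  - by apply/measurable_EFinP/measurable_funD.
  - by apply/measurable_EFinP/measurable_funD.
  - by move=> w _; rewrite lee_fin; exact: upcrossings_gain.
rewrite intD // (intD g (fun=> a)) //.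
have -> : (\int[P]_w a%:E = a%:E)%E.
  by rewrite (integral_cst P measurableT a%:E) [X in (_ * X)%E]probability_setT mule1.
move=> le_int.
by rewrite -(leeD2rE _ _ fn); apply: le_trans le_int _; rewrite addeC leeD2l.
Qed.

Let upcrossings_ae_bounded a b : 0 <= a -> a < b ->
  {ae P, forall w, exists N, forall n, (upcrossings a b (Y ^~ w) n <= N)%N}.
Proof.
move=> a0 ab; pose u n w : \bar R := ((b - a) * (upcrossings a b (Y ^~ w) n)%:R)%:E.
have ba : 0 < b - a by rewrite subr_gt0.
have u0 n w : (0 <= u n w)%E by rewrite lee_fin mulr_ge0 // ltW.
have u_nd w : {homo u ^~ w : m n / (m <= n)%N >-> (m <= n)%E}.
  move=> m n mn; rewrite lee_fin ler_wpM2l ?(ltW ba) // ler_nat.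
  exact: upcrossings_nd.
have mu n : measurable_fun setT (u n).
  by apply/measurable_EFinP; apply: measurable_funM.
have cvg_u : (\int[P]_w u n w @[n --> \oo] --> \int[P]_w limn (u ^~ w))%E.
  by apply: cvg_monotone_convergence => // w _; exact: u_nd.
have lim_int : (\int[P]_w limn (u ^~ w) <= a%:E)%E.
  rewrite -(cvg_lim _ cvg_u) //; apply: lime_le; first by apply/cvg_ex; eexists;
    exact: cvg_u.
  by apply: nearW => n; apply: upcrossings_integral => //; exact: ltW.
have lim0 w : (0 <= limn (u ^~ w))%E.
  apply: lime_ge; first exact: ereal_nondecreasing_is_cvgn.
  exact: nearW.
have int_lim : P.-integrable setT (fun w => limn (u ^~ w)).
  apply/integrableP; split.
    apply: (emeasurable_fun_cvg u) => // w _.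
    exact: ereal_nondecreasing_is_cvgn.
  under eq_integral do rewrite gee0_abs //.
  exact: le_lt_trans lim_int (ltry _).
have := integrable_ae measurableT int_lim.
apply: filterS => w /(_ Logic.I) fin.
exists (Num.truncn (fine (limn (u ^~ w)) / (b - a))) => n.
have q0 : 0 <= fine (limn (u ^~ w)) / (b - a).
  by rewrite divr_ge0 ?fine_ge0 // ltW.
rewrite truncn_ge_nat // ler_pdivlMr //.
rewrite mulrC -lee_fin fineK // -/(u n w).
have -> : limn (u ^~ w) = ereal_sup (range (u ^~ w)).
  by apply/cvg_lim => //; exact: ereal_nondecreasing_cvgn.
by apply: ereal_sup_ubound; exists n.
Qed.

(** Upcrossing bounds exclude oscillation; Fatou's lemma excludes divergence to [+oo], since no
    [Y n] has a larger integral than [Y 0]. *)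
Theorem supermartingale_cvg : {ae P, forall w, cvgn (Y ^~ w)}.
Proof.
(* [unpickle] enumerates the pairs of rationals, so that one null set serves them all. *)
have no_osc : {ae P, forall w, forall n, forall a b : rat, unpickle n = Some (a, b) ->
    0 <= a < b -> exists N, forall n, (upcrossings (ratr a) (ratr b) (Y ^~ w) n <=
      N)%N}.
  apply: ae_foralln => n; case: (unpickle n) => [[a b]|]; last by apply: aeW => w a b.
  have [ab|nab] := boolP (0 <= a < b); last first.
    by apply: aeW => w _ _ [<- <-] ab; rewrite ab in nab.
  have [a0 lt_ab] := andP ab.
  have := @upcrossings_ae_bounded (ratr a) (ratr b).
  rewrite ler0q ltr_rat => /(_ a0 lt_ab); apply: filterS => w ub _ _ [<- <-] _;
    exact: ub.
have fin_inf : {ae P, forall w, (limn_einf (fun n => (Y n w)%:E) < +oo)%E}.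
  have mEY n : measurable_fun setT (fun w => (Y n w)%:E) by exact/measurable_EFinP.
  have EY0 n w : setT w -> (0 <= (Y n w)%:E)%E by move=> _; rewrite lee_fin.
  pose L w := limn_einf (fun n => (Y n w)%:E).
  have L0 w : (0 <= L w)%E.
    rewrite /L limn_einf_lim; apply: lime_ge; first exact: is_cvg_einfs.
    by apply: nearW => n; apply: le_ereal_inf_tmp => _ [m _ <-]; rewrite lee_fin.
  have mL : measurable_fun setT L.
    have mes : measurable_fun setT (fun w => limn_esup (fun n => (- (Y n w)%:E)%E)).
      apply: measurable_fun_limn_esup => n.
      exact: (measurableT_comp (oppe_measurable (D := setT)) (mEY n)).
    exact: (measurableT_comp (oppe_measurable (D := setT)) mes).
  have int_L : P.-integrable setT L.
    apply/integrableP; split=> //.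
    under eq_integral do rewrite gee0_abs //.
    apply: le_lt_trans (fatou P measurableT mEY EY0) (le_lt_trans _ Y0_fin).
    rewrite limn_einf_lim; apply: lime_le; first exact: is_cvg_einfs.
    apply: nearW => n; apply: le_trans (intY n).
    by apply: ereal_inf_lbound; exists n => /=.
  apply: filterS (integrable_ae measurableT int_L) => w /(_ Logic.I).
  by rewrite ge0_fin_numE //; exact: L0.
apply: filterS2 no_osc fin_inf => w osc fin.
apply: cvg_of_no_oscillation => // [a b ab|infty].
  have [N NP] := osc (pickle (a, b)) a b (pickleK _) ab.
  exact: upcrossings_bounded NP.
suff [infE _] : (limn_einf (fun n => (Y n w)%:E) = +oo%E) *
    (limn_esup (fun n => (Y n w)%:E) = +oo%E) by rewrite infE ltxx in fin.
apply: cvg_limn_einf_sup; apply/cvgeryP/cvgryPge => K; exact: infty.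
Qed.

End nonnegative.

End supermartingales.

(** * The Robbins-Siegmund theorem *)

Section robbins_siegmund_paths.
Variable R : realType.
Implicit Types u chi eta th V : nat -> R.

Lemma bounded_sums_series_cvg u : (forall n, 0 <= u n) -> bounded_sums u ->
  cvgn (fun n => \sum_(i < n) u i).
Proof.
move=> u0 [M uM]; apply: nondecreasing_is_cvgn; last by exists M => _ [n _ <-].
by apply/nondecreasing_seqP => n; rewrite big_ord_recr lerDl.
Qed.

(** The integrating factor of the recursion [V n.+1 <= (1 + chi n) * V n]; dividing by it removes
    [chi]. *)
Definition growth chi n := \prod_(i < n) (1 + chi i).

Lemma growth_ge1 chi n : (forall n, 0 <= chi n) -> 1 <= growth chi n.
Proof.
move=> chi0; elim: n => [|n IH]; first by rewrite /growth big_ord0.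
by rewrite /growth big_ord_recr /= mulr_ege1 // lerDl.
Qed.

Lemma growth_bounded chi : (forall n, 0 <= chi n) -> bounded_sums chi ->
  exists2 C, 0 < C & forall n, growth chi n <= C.
Proof.
move=> chi0 [M chiM]; exists (expR M) => [|n]; first exact: expR_gt0.
apply: (@le_trans _ _ (expR (\sum_(i < n) chi i))); last by rewrite ler_expR.
elim: n => [|n IH]; first by rewrite /growth !big_ord0 expR0.
rewrite /growth !big_ord_recr /= expRD ler_pM ?expR_ge1Dx ?addr_ge0 //.
exact: le_trans (growth_ge1 n chi0).
Qed.

(* The values of the supermartingale stopped when the normalized perturbations
   exceed [K]. *)
Definition stopped V th chi eta (K : R) n :=
  (if \sum_(i < n) eta i / growth chi i.+1 <= K then 1 else 0) *
  (V n / growth chi n + \sum_(i < n) th i / growth chi i.+1 +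
   (K - \sum_(i < n) eta i / growth chi i.+1)).

(** Some integer [K] exceeds all normalized perturbations of the path, so the indicator in [stopped]
    is constantly 1. Their partial sums converge, hence so does [V n / growth chi n] plus the
    normalized sums of [th]; the latter are bounded and monotone, and both parts converge. *)
Lemma stopped_cvg V th chi eta :
  (forall n, 0 <= V n) -> (forall n, 0 <= th n) ->
  (forall n, 0 <= chi n) -> (forall n, 0 <= eta n) ->
  bounded_sums chi -> bounded_sums eta ->
  (forall K : nat, cvgn (stopped V th chi eta K%:R)) ->
  cvgn V /\ bounded_sums th.
Proof.
move=> V0 th0 chi0 eta0 bchi beta cvgY.
have [C C0 growthC] := growth_bounded chi0 bchi.
have growth0 n : 0 < growth chi n by apply: lt_le_trans (growth_ge1 n chi0).
have eta'0 n : 0 <= eta n / growth chi n.+1 by rewrite divr_ge0 // ltW.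
have th'0 n : 0 <= th n / growth chi n.+1 by rewrite divr_ge0 // ltW.
have V'0 n : 0 <= V n / growth chi n by rewrite divr_ge0 // ltW.
have beta' : bounded_sums (fun n => eta n / growth chi n.+1).
  apply: bounded_sums_le beta => n.
  by rewrite ler_pdivrMr // ler_peMr // growth_ge1.
have cvgN := bounded_sums_series_cvg eta'0 beta'.
have [M N_M] := beta'.
have [K MK] : exists K : nat, M <= K%:R.
  by exists (Num.bound M); apply/ltW/archi_boundP; have := N_M 0%N; rewrite big_ord0.
pose S n := \sum_(i < n) th i / growth chi i.+1.
have cvgVS : cvgn (fun n => V n / growth chi n + S n).
  have -> : (fun n => V n / growth chi n + S n) = (fun n =>
      stopped V th chi eta K%:R n + (\sum_(i < n) eta i / growth chi i.+1 - K%:R)).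
    apply/funext => n; rewrite /stopped (le_trans (N_M n) MK) mul1r -/(S n).
    by move: (\sum_(i < n) _) => N; ring.
  by apply: is_cvgD; [exact: cvgY|apply: is_cvgB => //; exact: is_cvg_cst].
have bth' : bounded_sums (fun n => th n / growth chi n.+1).
  have /cvg_seq_bounded/= [A [_ AP]] := cvgVS.
  exists (A + 1) => n; have := AP (A + 1); rewrite ltrDl ltr01 => /(_ isT n I) /=.
  by move/(le_trans (ler_norm _)); apply: le_trans; rewrite -/(S n) lerDr.
split.
  have -> : V = (fun n => (V n / growth chi n + S n - S n) * growth chi n).
    by apply/funext => n; rewrite addrK divfK // gt_eqF.
  apply: is_cvgM.
    by apply: is_cvgB => //; exact: bounded_sums_series_cvg bth'.
  apply: nondecreasing_is_cvgn; last by exists C => _ [n _ <-].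
  apply/nondecreasing_seqP => n; rewrite [leRHS]/growth big_ord_recr /=.
  by rewrite ler_peMr ?lerDl // ltW.
apply: bounded_sums_le (bounded_sumsZ (ltW C0) bth') => n.
by rewrite mulrCA ler_peMr // ler_pdivlMr // mul1r.
Qed.

End robbins_siegmund_paths.

Section robbins_siegmund.
Variables (d : measure_display) (Omega : measurableType d) (R : realType).
Variable (P : probability Omega R).
Variable X : nat -> set (set Omega).
Hypothesis X_sub : forall n, sub_sigma_field (X n).
Hypothesis X_nd : forall n, X n `<=` X n.+1.
Variables V th chi eta : nat -> Omega -> R.
Hypothesis V_ge0 : forall n w, 0 <= V n w.
Hypothesis th_ge0 : forall n w, 0 <= th n w.
Hypothesis chi_ge0 : forall n w, 0 <= chi n w.
Hypothesis eta_ge0 : forall n w, 0 <= eta n w.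
Hypothesis V_adapted : forall n, gmeas (X n) (V n).
Hypothesis th_adapted : forall n, gmeas (X n) (th n).
Hypothesis chi_adapted : forall n, gmeas (X n) (chi n).
Hypothesis eta_adapted : forall n, gmeas (X n) (eta n).
Hypothesis V0_fin : (\int[P]_w (V 0%N w)%:E < +oo)%E.
Hypothesis V_super : forall n, cond_le P (X n)
  (fun w => V n.+1 w + th n w) (fun w => (1 + chi n w) * V n w + eta n w).

Let gr n w := growth (chi ^~ w) n.

Let gr_gt0 n w : 0 < gr n w.
Proof. by apply: (@lt_le_trans _ _ 1) => //; exact: growth_ge1. Qed.

Let grS n w : gr n.+1 w = gr n w * (1 + chi n w).
Proof. by rewrite /gr /growth big_ord_recr. Qed.

Let gr_step n : gmeas (X n) (gr n) -> gmeas (X n) (gr n.+1).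
Proof.
move=> mgr; have -> : gr n.+1 = (fun w => gr n w * (1 + chi n w)).
  by apply/funext => w; exact: grS.
by apply: gmeasM => //; apply: gmeasD => //; exact: gmeas_cst.
Qed.

Let gr_adapted0 n : gmeas (X n) (gr n).
Proof.
elim: n => [|n IH]; last exact: (gmeas_le X_sub X_nd (leqnSn n) (gr_step IH)).
have -> : gr 0 = cst 1 by apply/funext => w; rewrite /gr /growth big_ord0.
exact: gmeas_cst.
Qed.

(** The index shift is predictability: [(gr n.+1)^-1] may multiply an inequality conditional on
    [X n]. *)
Let gr_adapted n : gmeas (X n) (gr n.+1).
Proof. exact: gr_step. Qed.

Let inv_adapted n k : (n <= k.+1)%N -> gmeas (X k) (fun w => (gr n w)^-1).
Proof.
move=> nk; apply: gmeasV => [w|]; first exact: ltW.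
case: n nk => [|n]; first by move=> _;
  exact: (gmeas_le X_sub X_nd (leq0n k) (@gr_adapted0 0)).
by rewrite ltnS => nk; exact: (gmeas_le X_sub X_nd nk (@gr_adapted n)).
Qed.

Let sum_adapted (f : nat -> Omega -> R) n k : (n <= k.+1)%N ->
  (forall i, gmeas (X i) (f i)) ->
  gmeas (X k) (fun w => \sum_(i < n) f i w / gr i.+1 w).
Proof.
move=> nk mf; apply: (@gmeas_sum _ _ _ _ _ (fun i w => f i w / gr i.+1 w)) => i;
  apply: gmeasM.
  by apply: (gmeas_le X_sub X_nd _ (mf i)); rewrite -ltnS (leq_trans (ltn_ord i)).
exact: inv_adapted (leq_trans (ltn_ord i) nk).
Qed.

Let normalized n : cond_le P (X n)
  (fun w => V n.+1 w / gr n.+1 w + th n w / gr n.+1 w)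
  (fun w => V n w / gr n w + eta n w / gr n.+1 w).
Proof.
have inv0 w : 0 <= (gr n.+1 w)^-1 by rewrite invr_ge0 ltW.
have := @cond_leM _ _ _ P _ (X_sub n) (fun w =>
  (gr n.+1 w)^-1) _ _ inv0 _ _ _ _ _ (@V_super n).
set f1 := (fun w => _ * _); set g1 := (fun w => _ * _).
have -> : f1 = (fun w => V n.+1 w / gr n.+1 w + th n w / gr n.+1 w).
  by apply/funext => w; rewrite /f1 mulrC mulrDl.
have -> : g1 = (fun w => V n w / gr n w + eta n w / gr n.+1 w).
  apply/funext => w; rewrite /g1 mulrC mulrDl; congr (_ + _).
  by rewrite grS; field; rewrite !gt_eqF // ltr_pwDl.
apply.
- by move=> w; rewrite addr_ge0.
- by move=> w; rewrite addr_ge0 // mulr_ge0 // addr_ge0.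
- apply: measurable_funD; first exact: (gmeas_measurable (X_sub n.+1)).
  exact: (gmeas_measurable (X_sub n)).
- apply: (gmeas_measurable (X_sub n)); apply: gmeasD => //.
  by apply: gmeasM => //; apply: gmeasD => //; exact: gmeas_cst.
- exact: (@inv_adapted n.+1 n (leqnn _)).
Qed.

Let Y K n w := stopped (V ^~ w) (th ^~ w) (chi ^~ w) (eta ^~ w) K n.
Let N n w := \sum_(i < n) eta i w / gr i.+1 w.
Let S n w := \sum_(i < n) th i w / gr i.+1 w.
Let ind K n w : R := if N n w <= K then 1 else 0.

Let YE K n w : Y K n w = ind K n w * (V n w / gr n w + S n w + (K - N n w)).
Proof. by []. Qed.

Let V'_ge0 n k w : 0 <= V n w / gr k w.
Proof. by rewrite divr_ge0 // ltW. Qed.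
Let th'_ge0 n k w : 0 <= th n w / gr k w.
Proof. by rewrite divr_ge0 // ltW. Qed.
Let eta'_ge0 n k w : 0 <= eta n w / gr k w.
Proof. by rewrite divr_ge0 // ltW. Qed.
Let S_ge0 n w : 0 <= S n w.
Proof. exact: sumr_ge0. Qed.

Let ind_adapted K n k : (n <= k.+1)%N -> gmeas (X k) (ind K n).
Proof.
move=> nk; apply: gmeas_ifT.
by apply: measurable_fun_ler; [exact: (sum_adapted nk)|exact: gmeas_cst].
Qed.

Let Y_ge0 K n w : 0 <= Y K n w.
Proof.
rewrite YE /ind; case: ifP => [NK|_]; last by rewrite mul0r.
by rewrite mul1r addr_ge0 ?subr_ge0 // addr_ge0.
Qed.

Let Y_adapted K n : gmeas (X n) (Y K n).
Proof.
apply: gmeasM; first exact: ind_adapted.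
apply: gmeasD; last first.
  by apply: gmeasB; [exact: gmeas_cst|exact: sum_adapted].
apply: gmeasD; last exact: sum_adapted.
by apply: gmeasM => //; exact: inv_adapted.
Qed.

(** [N n.+1] involves [eta] up to [n] only, so the indicator at time [n.+1] is a legitimate factor
    given [X n]. Where it vanishes the next value is 0, and [Y K n] is nonnegative. *)
Let Y_super K n : cond_le P (X n) (Y K n.+1) (Y K n).
Proof.
pose b w := ind K n.+1 w * (S n w + (K - N n.+1 w)).
have ind0 w : 0 <= ind K n.+1 w by rewrite /ind; case: ifP.
have b0 w : 0 <= b w.
  rewrite /b /ind; case: ifP => [NK|_]; last by rewrite mul0r.
  by rewrite mul1r addr_ge0 ?subr_ge0.
have mb : gmeas (X n) b.
  apply: gmeasM; first exact: ind_adapted.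
  apply: gmeasD; first exact: sum_adapted.
  by apply: gmeasB; [exact: gmeas_cst|exact: sum_adapted].
have mL : measurable_fun setT (fun w => V n.+1 w / gr n.+1 w + th n w / gr n.+1 w).
  apply: (gmeas_measurable (X_sub n.+1)); apply: gmeasD.
    by apply: gmeasM => //; exact: inv_adapted.
  apply: gmeasM; last exact: inv_adapted.
  exact: (gmeas_le X_sub X_nd (leqnSn n)).
have mR : gmeas (X n) (fun w => V n w / gr n w + eta n w / gr n.+1 w).
  by apply: gmeasD; apply: gmeasM => //; exact: inv_adapted.
have mR' := gmeas_measurable (X_sub n) mR.
have mind := @ind_adapted K n.+1 n (leqnn _).
have mind' := gmeas_measurable (X_sub n) mind.
have mb' := gmeas_measurable (X_sub n) mb.
have step : cond_le P (X n)
    (fun w => ind K n.+1 w * (V n.+1 w / gr n.+1 w + th n w / gr n.+1 w) + b w)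
    (fun w => ind K n.+1 w * (V n w / gr n w + eta n w / gr n.+1 w) + b w).
  apply: cond_leD => //.
  - by move=> w; rewrite mulr_ge0 // addr_ge0.
  - by move=> w; rewrite mulr_ge0 // addr_ge0.
  - exact: measurable_funM.
  - exact: measurable_funM.
  - by apply: cond_leM => // w; rewrite addr_ge0.
have -> : Y K n.+1 = (fun w =>
    ind K n.+1 w * (V n.+1 w / gr n.+1 w + th n w / gr n.+1 w) + b w).
  apply/funext => w; rewrite YE /b -mulrDr; congr (_ * _).
  by rewrite /S big_ord_recr /=; ring.
apply: (cond_le_trans step); apply: ae_cond_le => //.
- by move=> w; rewrite addr_ge0 // mulr_ge0 // addr_ge0.
- by apply: measurable_funD => //; exact: measurable_funM.
- exact: (gmeas_measurable (X_sub n) (@Y_adapted K n)).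
- apply: aeW => w; have := @Y_ge0 K n w; rewrite YE /b /ind.
  have NS : N n.+1 w = N n w + eta n w / gr n.+1 w by rewrite /N big_ord_recr.
  have := eta'_ge0 n n.+1 w.
  case: (leP (N n.+1 w) K) => NK e0; last by rewrite !mul0r addr0.
  rewrite (_ : N n w <= K); last by lra.
  rewrite NS; lra.
Qed.

Theorem robbins_siegmund :
  {ae P, forall w, bounded_sums (chi ^~ w)} ->
  {ae P, forall w, bounded_sums (eta ^~ w)} ->
  {ae P, forall w, cvgn (V ^~ w) /\ bounded_sums (th ^~ w)}.
Proof.
move=> bchi beta.
have Ycvg : {ae P, forall w, forall K : nat, cvgn (Y K%:R ^~ w)}.
  apply: ae_foralln => K; apply: (supermartingale_cvg X_sub X_nd).
  - exact: Y_ge0.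
  - exact: Y_adapted.
  - have -> : Y K%:R 0 = (fun w => V 0%N w + K%:R).
      apply/funext => w; rewrite YE /ind /N /S !big_ord0 ler0n /gr /growth.
      by rewrite big_ord0; field.
    under eq_integral do rewrite EFinD.
    rewrite ge0_integralD //.
    + rewrite (integral_cst P measurableT K%:R%:E) [X in (_ * X)%E]probability_setT
      mule1.
      by rewrite lte_add_pinfty // ltry.
    + by move=> w _; rewrite lee_fin.
    + by apply/measurable_EFinP; exact: (gmeas_measurable (X_sub 0)).
  - exact: Y_super.
move: Ycvg; apply: filterS3 bchi beta => w bchi beta Ycvg.
exact: stopped_cvg beta Ycvg.
Qed.

End robbins_siegmund.

(** * Measurability in separable Hilbert spaces *)

Section separable_hilbert_measurability.
Variables (R : realType) (H : completeNormedModType R).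
Variable (dot : {dot H for idfun}).
Hypothesis Hdot : induces_norm dot.
Hypothesis Hsep : separable H.
Variables (d : measure_display) (Omega : measurableType d).
Implicit Types f g : Omega -> H.

Lemma dense_sequence : exists c : nat -> H, forall v e, 0 < e ->
  exists k, `|v - c k| < e.
Proof.
have [D cD dD] := Hsep; have /countable_injP[i i_inj] := cD.
exists (fun k => xget 0 [set v | D v /\ i v = k]) => v e e0.
have [||u [vu Du]] := dD (ball v e).
- by exists v; exact: ballxx.
- exact: ball_open.
exists (i u); case: xgetP => [u' _ [Du' iu']|/(_ u)[]//].
have -> : u' = u by apply: i_inj; rewrite ?inE.
by rewrite -ball_normE in vu.
Qed.

Lemma open_ball_norm (V : normedModType R) (U : set V) v : open U -> U v ->
  exists2 e : R, 0 < e & forall u, `|v - u| < e -> U u.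
Proof.
move=> oU Uv; have /nbhs_ballP[e /= e0 eU] : nbhs v U by apply: open_nbhs_nbhs.
by exists e => // u uv; apply: eU; rewrite -ball_normE.
Qed.

Variable G : set (set Omega).
Hypothesis HG : sub_sigma_field G.

Let G0 : G set0. Proof. by have [[]] := HG. Qed.
Let GC D : G D -> G (~` D).
Proof. by have [[_ GC _] _] := HG => GD; rewrite -setTD; exact: GC. Qed.
Let GT : G setT. Proof. by rewrite -setC0; exact: GC. Qed.
Let Gcup (F : nat -> set Omega) : (forall n, G (F n)) -> G (\bigcup_n F n).
Proof. by have [[_ _ +] _] := HG; apply. Qed.
Let Gcap (F : nat -> set Omega) : (forall n, G (F n)) -> G (\bigcap_n F n).
Proof.
move=> GF; rewrite -[X in G X]setCK setC_bigcap; apply/GC/Gcup => n; exact: GC.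
Qed.
Let GI D E : G D -> G E -> G (D `&` E).
Proof.
move=> GD GE; rewrite -bigcap2E; apply: Gcap => n.
by rewrite /bigcap2; case: ifP => // _; case: ifP.
Qed.

Lemma hmeasurable_open f : (forall U : set H, open U -> G (f @^-1` U)) ->
  hmeasurable G f.
Proof.
move=> fo; suff sub : <<s @open H >> `<=` [set B | G (f @^-1` B)].
  by move=> B mB; exact: sub.
apply: smallest_sub; last by move=> U oU; exact: fo.
split.
- by rewrite /= preimage_set0.
- by move=> A GA /=; rewrite setTD preimage_setC; exact: GC.
- by move=> F GF /=; rewrite preimage_bigcup; exact: Gcup.
Qed.

Lemma hmeasurable_preimage_open f (U : set H) : hmeasurable G f -> open U ->
  G (f @^-1` U).
Proof. by move=> mf oU; apply: mf; exact: (@sub_sigma_algebra _ setT (@open H)). Qed.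

Lemma gmeas_open (f : Omega -> R) : (forall U : set R, open U -> G (f @^-1` U)) ->
  gmeas G f.
Proof.
move=> fo; apply: (measurability _ (RGenOpens.measurableE R)) => _ [_ [a [b ->] <-]].
by rewrite setTI; apply: sub_sigma_algebra; apply: fo; exact: interval_open.
Qed.

(** A dense sequence makes the preimage of [U] a countable union of rectangles, the preimages of
    pairs of balls that [phi] sends into [U]. Linear combinations and norms are instances. *)
Lemma preimage_open_lipschitz2 (V : normedModType R) (phi : H -> H -> V) K f g
    (U : set V) : 0 <= K ->
  (forall u v u' v', `|phi u v - phi u' v'| <= K * (`|u - u'| + `|v - v'|)) ->
  hmeasurable G f -> hmeasurable G g -> open U ->
  G ((fun w => phi (f w) (g w)) @^-1` U).
Proof.
move=> K0 lip mf mg oU; have [c cP] := dense_sequence.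
pose rect (p : nat * nat * nat) := f @^-1` ball (c p.1.1) p.2.+1%:R^-1 `&`
  g @^-1` ball (c p.1.2) p.2.+1%:R^-1.
pose good (p : nat * nat * nat) := forall u v, ball (c p.1.1) p.2.+1%:R^-1 u ->
  ball (c p.1.2) p.2.+1%:R^-1 v -> U (phi u v).
have -> : (fun w => phi (f w) (g w)) @^-1` U = \bigcup_n
    (if unpickle n is Some p then (if `[<good p>] then rect p else set0) else set0).
  apply/seteqP; split=> [w /= Uw|w [n _]]; last first.
    by case: (unpickle n) => // p; case: asboolP => // gp [/= fw gw]; exact: gp.
  have [e e0 eU] := open_ball_norm oU Uw.
  (* Four distances below [m.+1%:R^-1] add up: from [f w] and [g w] to the centers, and from the
     centers to [u] and [v]. *)
  have K4 : 0 < 4 * (K + 1) by lra.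
  have [m mP] : exists m : nat, m.+1%:R^-1 < e / (4 * (K + 1)) :> R.
    have /cvgrPdist_lt/(_ (e / (4 * (K + 1)))) := @cvg_harmonic R.
    rewrite divr_gt0 // => /(_ isT)[N _ /(_ N (leqnn N))] /=.
    by rewrite sub0r normrN ger0_norm // => NP; exists N.
  have m0 : 0 < m.+1%:R^-1 :> R by rewrite invr_gt0.
  have [k kP] := cP (f w) _ m0; have [l lP] := cP (g w) _ m0.
  exists (pickle (k, l, m)) => //; rewrite pickleK.
  have -> : `[<good (k, l, m)>] = true.
    apply/asboolP => u v /=; rewrite -ball_normE /= => ku lv; apply: eU.
    apply: le_lt_trans (lip _ _ _ _) _.
    have fu : `|f w - u| <= `|f w - c k| + `|c k - u|.
      by rewrite -[f w - u](subrKA (c k)) ler_normD.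
    have gv : `|g w - v| <= `|g w - c l| + `|c l - v|.
      by rewrite -[g w - v](subrKA (c l)) ler_normD.
    move: mP; rewrite ltr_pdivlMr // => mP.
    have S4 : `|f w - u| + `|g w - v| <= 4 * m.+1%:R^-1.
      by move: fu gv kP lP ku lv; move: (m.+1%:R^-1) => i; lra.
    have := ler_wpM2l K0 S4; move: mP m0.
    move: (m.+1%:R^-1) => i; nra.
  by split=> /=; rewrite -ball_normE /= distrC.
apply: Gcup => n; case: (unpickle n) => // p; case: ifP => // _.
by apply: GI; apply: hmeasurable_preimage_open => //; exact: ball_open.
Qed.

Lemma hmeasurable_lipschitz (phi : H -> H) K f : 0 <= K ->
  (forall u v, `|phi u - phi v| <= K * `|u - v|) ->
  hmeasurable G f -> hmeasurable G (fun w => phi (f w)).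
Proof.
move=> K0 lip mf; apply: hmeasurable_open => U oU.
apply: (preimage_open_lipschitz2 (phi := fun u _ => phi u) K0 _ mf mf oU).
by move=> u v u' v'; apply: le_trans (lip u u') _; rewrite ler_wpM2l // lerDl.
Qed.

Lemma hmeasurable_lin (a b : R) f g : hmeasurable G f -> hmeasurable G g ->
  hmeasurable G (fun w => a *: f w + b *: g w).
Proof.
move=> mf mg; apply: hmeasurable_open => U oU.
apply: (preimage_open_lipschitz2 (phi := fun u v => a *: u + b *: v)
  (K := `|a| + `|b|)) mf mg oU => [|u v u' v']; first exact: addr_ge0.
rewrite opprD addrACA -!scalerBr; apply: le_trans (ler_normD _ _) _.
rewrite !normrZ.
have a0 := normr_ge0 a; have b0 := normr_ge0 b.
have u0 := normr_ge0 (u - u'); have v0 := normr_ge0 (v - v').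
have := mulr_ge0 a0 v0; have := mulr_ge0 b0 u0; lra.
Qed.

Lemma hmeasurableD f g : hmeasurable G f -> hmeasurable G g ->
  hmeasurable G (fun w => f w + g w).
Proof.
move=> mf mg; have := hmeasurable_lin 1 1 mf mg.
by under eq_fun do rewrite !scale1r.
Qed.

Lemma hmeasurableB f g : hmeasurable G f -> hmeasurable G g ->
  hmeasurable G (fun w => f w - g w).
Proof.
move=> mf mg; have := hmeasurable_lin 1 (- 1) mf mg.
by under eq_fun do rewrite scale1r scaleN1r.
Qed.

Lemma hmeasurableZ (a : R) f : hmeasurable G f -> hmeasurable G (fun w => a *: f w).
Proof.
move=> mf; have := hmeasurable_lin a 0 mf mf.
by under eq_fun do rewrite scale0r addr0.
Qed.

Lemma hmeasurable_cst (v : H) : hmeasurable G (fun=> v).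
Proof.
move=> B _; have [Bv|Bv] := pselect (B v).
  by rewrite (_ : _ @^-1` _ = setT) //; apply/seteqP; split.
by rewrite (_ : _ @^-1` _ = set0) //; apply/seteqP; split.
Qed.

Lemma gmeas_norm f : hmeasurable G f -> gmeas G (fun w => `|f w|).
Proof.
move=> mf; apply: gmeas_open => U oU.
apply: (preimage_open_lipschitz2 (phi := fun u _ => `|u|) (K := 1) _ _ mf mf oU) => //.
move=> u v u' v'; rewrite mul1r; apply: le_trans (ler_dist_dist _ _) _.
by rewrite lerDl.
Qed.

Lemma gmeas_dot f g : hmeasurable G f -> hmeasurable G g ->
  gmeas G (fun w => dot (f w) (g w)).
Proof.
move=> mf mg; have -> : (fun w => dot (f w) (g w)) =
    (fun w => 4^-1 * (`|f w + g w| ^+ 2 - `|f w - g w| ^+ 2)).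
  by apply/funext => w; rewrite (sqnormD Hdot) (sqnormB Hdot); field.
apply: gmeasM; first exact: gmeas_cst.
by apply: gmeasB; apply: gmeasX; apply: gmeas_norm;
  [exact: hmeasurableD|exact: hmeasurableB].
Qed.

(** Pettis' theorem: closed balls are countable intersections of half-spaces given by a dense
    sequence of test vectors, and open sets are countable unions of closed balls. It serves to show
    that the weak limit is measurable. *)
Lemma hmeasurable_weak f : (forall h, gmeas G (fun w => dot (f w) h)) ->
  hmeasurable G f.
Proof.
move=> mf; have [c cP] := dense_sequence.
have cball v r : 0 <= r -> G [set w | `|f w - v| <= r].
  move=> r0; rewrite (_ : [set _ | _] =
      \bigcap_k [set w | dot (f w) (c k) - dot v (c k) <= r * `|c k|]).
    apply: Gcap => k; apply: (gmeas_set HG).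
    rewrite -[X in measurable X]setTI.
    have mle : measurable_fun [set: g_sigma_algebraType G]
        (fun w => dot (f w) (c k) - dot v (c k) <= r * `|c k|).
      apply: measurable_fun_ler; last exact: gmeas_cst.
      by apply: gmeasB; [exact: mf|exact: gmeas_cst].
    exact: (mle measurableT [set true]).
  apply/seteqP; split=> w /= => [le_r k _ /=|all_le].
    rewrite -(dotNl dot v) -(dotDl dot (f w)); apply: le_trans (ler_dot Hdot _ _) _.
    by rewrite ler_wpM2r.
  apply: (norm_le_dot Hdot r0) => h; apply/ler_addgt0Pr => e e0.
  pose K := `|f w - v| + r + 1.
  have K0 : 0 < K by rewrite ltr_wpDl // addr_ge0.
  have [k kP] := cP h (e / K) (divr_gt0 e0 K0).
  have /= := all_le k Logic.I; rewrite -(dotNl dot v) -(dotDl dot (f w)).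
  have -> : dot (f w - v) h = dot (f w - v) (c k) + dot (f w - v) (h - c k).
    by rewrite -dotDr addrCA subrr addr0.
  have := ler_dot Hdot (f w - v) (h - c k).
  have : `|c k| <= `|h| + `|h - c k|.
    by rewrite -{1}(subrK h (c k)) addrC (distrC h); exact: ler_normD.
  move: kP; rewrite ltr_pdivlMr // /K.
  have := normr_ge0 (h - c k); have := normr_ge0 (f w - v).
  move: `|f w - v| `|h - c k| `|c k| => A E C A0 E0 EK CE D1 D2.
  have : r * C <= r * (`|h| + E) by rewrite ler_wpM2l.
  nra.
apply: hmeasurable_open => U oU.
pose good (p : nat * nat) := forall u, `|u - c p.1| <= p.2.+1%:R^-1 -> U u.
have -> : f @^-1` U = \bigcup_n
    (if unpickle n is Some p then
      (if `[<good p>] then [set w | `|f w - c p.1| <=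
        p.2.+1%:R^-1] else set0) else set0).
  apply/seteqP; split=> [w /= Uw|w [n _]]; last first.
    by case: (unpickle n) => // p; case: asboolP => // gp; exact: gp.
  have [e e0 eU] := open_ball_norm oU Uw.
  have e2 : 0 < e / 2 by rewrite divr_gt0.
  have [m mP] : exists m : nat, m.+1%:R^-1 < e / 2 :> R.
    have /cvgrPdist_lt/(_ _ e2) [N _ /(_ N (leqnn N))] /= := @cvg_harmonic R.
    by rewrite sub0r normrN ger0_norm // => NP; exists N.
  have m0 : 0 < m.+1%:R^-1 :> R by rewrite invr_gt0.
  have [k kP] := cP (f w) _ m0.
  exists (pickle (k, m)) => //; rewrite pickleK.
  have -> : `[<good (k, m)>] = true; last exact: ltW.
  apply/asboolP => u /= um; apply: eU.
  rewrite -[f w - u](subrKA (c k)); apply: le_lt_trans (ler_normD _ _) _.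
  move: kP um mP; rewrite (distrC (c k)); move: (m.+1%:R^-1) => i; lra.
apply: Gcup => n; case: (unpickle n) => // p; case: ifP => // _.
by apply: cball; rewrite invr_ge0.
Qed.

End separable_hilbert_measurability.

(** * Bochner integrals and conditional orthogonality *)

Section hilbert_conditional_expectation.
Variables (R : realType) (H : completeNormedModType R).
Variable (dot : {dot H for idfun}).
Hypothesis Hdot : induces_norm dot.
Hypothesis Hsep : separable H.
Variables (d : measure_display) (Omega : measurableType d).
Variable (P : probability Omega R).
Implicit Types (f g e q : Omega -> H) (h : H) (D : set Omega).

Lemma measurable_sub_sigma_field : sub_sigma_field (@measurable _ Omega).
Proof.
split=> //; split=> [|A mA|F mF]; first exact: measurable0.
- exact: measurableD.
- exact: bigcup_measurable.
Qed.

Let Hm := measurable_sub_sigma_field.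

Lemma hilbert_rv_hmeasurable (G : set (set Omega)) f :
  sub_sigma_field G -> hmeasurable G f -> hilbert_rv f.
Proof. by move=> HG mf B mB; apply: HG.2; exact: mf. Qed.

Lemma measurable_norm_rv f : hilbert_rv f -> measurable_fun setT (fun w => `|f w|).
Proof. by move=> mf; apply: (gmeas_measurable Hm); exact: (gmeas_norm Hsep Hm mf). Qed.

Lemma measurable_dot_rv f g : hilbert_rv f -> hilbert_rv g ->
  measurable_fun setT (fun w => dot (f w) (g w)).
Proof.
move=> mf mg; apply: (gmeas_measurable Hm); exact: (gmeas_dot Hdot Hsep Hm mf mg).
Qed.

Lemma hilbert_rv_step m (E : nat -> set Omega) (c : nat -> H) :
  (forall i, measurable (E i)) -> hilbert_rv (step_fun (R := R) m E c).
Proof.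
move=> mE; rewrite /step_fun; elim: m => [|m IH].
  rewrite (_ : (fun w => _) = fun=> 0); first exact: (hmeasurable_cst Hm).
  by apply/funext => w; rewrite big_ord0.
under eq_fun do rewrite big_ord_recr /=.
apply: (hmeasurableD Hsep Hm) => //; apply: (hmeasurable_open Hm) => U oU.
rewrite (_ : _ @^-1` U = (if `[<U (c m)>] then E m else set0) `|`
  (if `[<U 0>] then ~` E m else set0)).
  by apply: measurableU; case: ifP => // _; exact: measurableC.
apply/seteqP; split=> w /=; rewrite indicE.
  have [Ew|Ew] := pselect (E m w).
    by rewrite mem_set // scale1r => Uc; left; rewrite asboolT.
  by rewrite memNset // scale0r => Uc; right; rewrite asboolT.
by case=> [|]; case: asboolP => // Uc Ew;
  [rewrite mem_set // scale1r|rewrite memNset // scale0r].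
Qed.

Lemma integral_dot_step D m (E : nat -> set Omega) (c : nat -> H) h :
  measurable D -> (forall i, measurable (E i)) ->
  P.-integrable D (EFin \o (fun w => dot (step_fun (R := R) m E c w) h)) /\
  (\int[P]_(w in D) (dot (step_fun (R := R) m E c w) h)%:E =
   (dot (step_integral P D m E c) h)%:E)%E.
Proof.
move=> mD mE; rewrite /step_fun /step_integral.
have int_ind i : P.-integrable D (fun w => ((dot (c i) h) * \1_(E i) w)%:E).
  under eq_fun do rewrite EFinM.
  apply: integrableZl => //.
  by apply: (@integrableS _ _ _ P setT) => //; exact: integrable_indic.
elim: m => [|m [IHi IHe]].
  rewrite big_ord0 dot0l; under eq_fun do rewrite /= big_ord0 dot0l.
  split; first exact: integrable0.
  under eq_integral do rewrite big_ord0 dot0l; exact: integral0.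
have splitE w : (dot (\sum_(i < m.+1) (\1_(E i) w : R) *: c i) h)%:E =
    ((dot (\sum_(i < m) (\1_(E i) w : R) *: c i) h)%:E +
     (dot (c m) h * \1_(E m) w)%:E)%E.
  by rewrite big_ord_recr dotDl dotZl -EFinD [_ * dot _ _]mulrC.
split.
  have -> : EFin \o (fun w => dot (\sum_(i < m.+1) (\1_(E i) w : R) *: c i) h) =
      ((EFin \o (fun w => dot (\sum_(i < m) (\1_(E i) w : R) *: c i)%R h)) \+
       (fun w => (dot (c m) h * \1_(E m) w)%:E))%E.
    by apply/funext => w; exact: splitE.
  exact: integrableD.
under eq_integral do rewrite splitE.
rewrite integralD // IHe big_ord_recr dotDl dotZl EFinD /=; congr (_ + _)%E.
under eq_integral do rewrite EFinM.
rewrite integralZl //; last first.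
  by apply: (@integrableS _ _ _ P setT) => //; exact: integrable_indic.
rewrite integral_indic // setIC mulrC EFinM fineK //.
by apply: fin_num_measure; exact: measurableI.
Qed.

Lemma integrable_dot D f h : measurable D -> hilbert_rv f ->
  (\int[P]_(w in D) `|f w|%:E < +oo)%E ->
  P.-integrable D (EFin \o (fun w => dot (f w) h)).
Proof.
move=> mD mf fin; apply: (@le_integrable _ _ _ P D mD _
  (fun w => `|h|%:E * `|f w|%:E)%E).
- apply/measurable_EFinP; apply: measurable_funTS.
  by apply: measurable_dot_rv => //; exact: (hmeasurable_cst Hm).
- move=> w _ /=; rewrite lee_fin normrM !normr_id mulrC.
  exact: (cauchy_schwarz Hdot).
- apply: integrableZl => //; apply/integrableP; split.
    by apply/measurable_EFinP; apply: measurable_funTS; exact: measurable_norm_rv.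
  by under eq_integral do rewrite /= normr_id.
Qed.

(** [dot (s k) h] tends to both sides: to [dot v h] by continuity, and to the integral because by
    Cauchy-Schwarz the error is at most [|h|] times the L1 distance to the step functions. *)
Lemma bochner_integral_dot D f v h : measurable D ->
  (\int[P]_(w in D) `|f w|%:E < +oo)%E -> bochner_integral P D f v ->
  (\int[P]_(w in D) (dot (f w) h)%:E = (dot v h)%:E)%E.
Proof.
move=> mD fin [mf [m [E [c [mE app stepv]]]]].
have int_f := integrable_dot h mD mf fin.
have intf_fin := integrable_fin_num mD int_f.
set I := (\int[P]_(w in D) _)%E in intf_fin *.
pose s k := step_integral P D (m k) (E k) (c k).
have sv : dot (s k) h @[k --> \oo] --> dot v h by exact: (dot_cvgl Hdot).
rewrite -(fineK intf_fin); congr EFin; apply: cvg_unique sv => //=.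
have close k : (`|fine I - dot (s k) h|%:E <=
    `|h|%:E * \int[P]_(w in D) `|f w - step_fun (m k) (E k) (c k) w|%:E)%E.
  have [int_s sE] := integral_dot_step (m k) (c k) h mD (mE k).
  rewrite -/(s k) in sE.
  have -> : (`|fine I - dot (s k) h|%:E = `|\int[P]_(w in D)
      ((dot (f w) h)%:E - (dot (step_fun (m k) (E k) (c k) w) h)%:E)|)%E.
    by rewrite integralB // sE -/I -{2}(fineK intf_fin) -EFinB.
  have mfs : hilbert_rv (fun w => f w - step_fun (R := R) (m k) (E k) (c k) w).
    by apply: (hmeasurableB Hsep Hm) => //; exact: hilbert_rv_step.
  have mn := measurable_norm_rv mfs.
  apply: le_trans (le_abse_integral P mD _) _.
    apply: measurable_int (integrableB mD int_f int_s).
  rewrite -ge0_integralZl_EFin //; last 1 first.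
    by apply/measurable_EFinP; apply: measurable_funTS.
  apply: ge0_le_integral => //.
  - apply: measurableT_comp => //.
    exact: measurable_int (integrableB mD int_f int_s).
  - by apply/measurable_EFinP; apply: measurable_funM => //; exact: measurable_funTS.
  - move=> w _; rewrite -EFinB -EFinM lee_fin mulrC.
    rewrite -(dotNl dot (step_fun _ _ _ w)) -(dotDl dot (f w)).
    exact: (cauchy_schwarz Hdot).
apply/cvgrPdist_le => e e0.
have lim0 : (`|h|%:E * \int[P]_(w in D) `|f w - step_fun (m k) (E k) (c k) w|%:E
    @[k --> \oo] --> 0)%E.
  by rewrite -(mule0 `|h|%:E); exact: cvgeZl.
have /fine_cvgP[fin_lim /cvgrPdist_lt/(_ _ e0) lim_lt] := lim0.
apply: filterS2 fin_lim lim_lt => k fin_k; rewrite sub0r normrN => lt_e.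
have := close k; rewrite -(fineK fin_k) lee_fin => /le_trans; apply.
exact: le_trans (ler_norm _) (ltW lt_e).
Qed.

(** Only the cross term is at stake. [D] is cut into countably many pieces of [G] on which [q] is
    within [eps] of some [c k]; there [2 * dot (q w) (e w)] is replaced by [2 * dot (e w) (c k)], of
    integral 0, with an error of at most [2 * eps * |e w|], and [eps] tends to 0. *)
Lemma pythagoras_cond_le (G : set (set Omega)) q e : sub_sigma_field G ->
  hmeasurable G q -> hilbert_rv e ->
  (\int[P]_w (`|e w| ^+ 2)%:E < +oo)%E ->
  (forall D h, G D -> \int[P]_(w in D) (dot (e w) h)%:E = 0)%E ->
  cond_le P G (fun w => `|q w + e w| ^+ 2) (fun w => `|q w| ^+ 2 + `|e w| ^+ 2).
Proof.
move=> HG mq me e2 e_orth D GD.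
have mD := HG.2 _ GD.
have mq' := hilbert_rv_hmeasurable HG mq.
have mqn := measurable_norm_rv mq'.
have men := measurable_norm_rv me.
have mE (k : Omega -> R) (D' : set Omega) : measurable_fun setT k ->
    measurable_fun D' (EFin \o k).
  by move=> mk; apply/measurable_EFinP; exact: measurable_funTS.
have mqe : measurable_fun setT (fun w => `|q w + e w| ^+ 2).
  by apply: measurable_funX; apply: measurable_norm_rv; exact: (hmeasurableD Hsep Hm).
have mqe2 : measurable_fun setT (fun w => `|q w| ^+ 2 + `|e w| ^+ 2).
  by apply: measurable_funD; exact: measurable_funX.
have intZD (k1 k2 : Omega -> R) (D' : set Omega) : measurable D' ->
    (forall w, 0 <= k1 w) -> (forall w, 0 <= k2 w) ->
    measurable_fun setT k1 -> measurable_fun setT k2 ->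
    (\int[P]_(w in D') (k1 w + k2 w)%:E =
     \int[P]_(w in D') (k1 w)%:E + \int[P]_(w in D') (k2 w)%:E)%E.
  move=> mD' k10 k20 mk1 mk2; under eq_integral do rewrite EFinD.
  rewrite ge0_integralD //.
  - by move=> w _; rewrite lee_fin.
  - exact: mE.
  - by move=> w _; rewrite lee_fin.
  - exact: mE.
have e1 D' : measurable D' -> (\int[P]_(w in D') `|e w|%:E <=
    1 + \int[P]_w (`|e w| ^+ 2)%:E)%E.
  move=> mD'; apply: (@le_trans _ _ (\int[P]_w (1 + `|e w| ^+ 2)%:E)%E).
    apply: (@le_trans _ _ (\int[P]_w `|e w|%:E)%E).
      apply: ge0_subset_integral => //; first exact: mE.
    apply: ge0_le_integral => //.
    - exact: mE.
    - by apply: (mE (fun w => 1 + `|e w| ^+ 2)); apply: measurable_funD => //;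
      exact: measurable_funX.
    - move=> w _; rewrite lee_fin; have := normr_ge0 (e w); nra.
  rewrite (intZD (fun=> 1)) //; last exact: measurable_funX.
  by rewrite (integral_cst P measurableT 1%E) [X in (_ * X)%E]probability_setT mule1.
have [c cP] := dense_sequence Hsep.
set C := (\int[P]_w (`|e w| ^+ 2)%:E)%E in e2 e1 *.
have Cfin : C \is a fin_num.
  by rewrite ge0_fin_numE // /C; apply: integral_ge0 => w _; rewrite lee_fin exprn_ge0.
have C0 : (0 <= fine C) by rewrite fine_ge0 // /C; apply: integral_ge0 => w _;
  rewrite lee_fin exprn_ge0.
suff approx eps : 0 < eps -> (\int[P]_(w in D) (`|q w + e w| ^+ 2)%:E <=
    \int[P]_(w in D) (`|q w| ^+ 2 + `|e w| ^+ 2)%:E +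
    (2 * eps)%:E * \int[P]_(w in D) `|e w|%:E)%E.
  apply/lee_addgt0Pr => r r0; pose eps := r / (2 * (1 + fine C)).
  have C1 : 0 < 2 * (1 + fine C) by lra.
  apply: le_trans (approx eps _) _; first by rewrite divr_gt0.
  apply: leeD2l; apply: (@le_trans _ _ ((2 * eps)%:E * (1 + C))%E).
    by apply: lee_wpmul2l (e1 _ mD); rewrite lee_fin mulr_ge0 // divr_ge0 // ltW.
  rewrite -(fineK Cfin) -EFinD -EFinM lee_fin /eps.
  by rewrite [2 * _]mulrC -mulrA divfK // gt_eqF.
move=> eps0.
pose near_c k := [set w | `|q w - c k| < eps].
have Gnear k : G (near_c k).
  have -> : near_c k = q @^-1` ball (c k) eps.
    by apply/seteqP; split=> w /=; rewrite -ball_normE /= distrC.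
  exact: (hmeasurable_preimage_open mq (ball_open _ _)).
pose pc k := D `&` seqDU near_c k.
have Gpc k : G (pc k).
  have mG E : G E -> measurable (E : set (g_sigma_algebraType G)).
    by move=> GE; apply: sub_sigma_algebra.
  apply: (gmeas_set HG); apply: measurableI; first exact: mG.
  by apply: (@seqDU_measurable _ (g_sigma_algebraType G)) => n; exact: mG.
have mpc k : measurable (pc k) by exact: HG.2.
have DE : D = \bigcup_k pc k.
  rewrite -setI_bigcupr -seqDU_bigcup_eq; apply/esym/setIidl => w _.
  by have [k kP] := cP (q w) _ eps0; exists k.
have pc_triv : trivIset setT pc.
  by apply: trivIset_setIl; exact: trivIset_seqDU.
pose F w := `|q w| ^+ 2 + `|e w| ^+ 2 + 2 * eps * `|e w|.
have F0 w : 0 <= F w by rewrite !addr_ge0 // !mulr_ge0 // ltW.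
have mF : measurable_fun setT F.
  by apply: measurable_funD => //; apply: measurable_funM.
have piece k : (\int[P]_(w in pc k) (`|q w + e w| ^+ 2)%:E <=
    \int[P]_(w in pc k) (F w)%:E)%E.
  (* [q] is bounded on this piece, so [F] is integrable there even if [|q w| ^+ 2] is not integrable
     over [D]; this is why the zero integral is added piece by piece. *)
  have int_F : P.-integrable (pc k) (EFin \o F).
    apply/integrableP; split; first exact: (mE F).
    under eq_integral do rewrite gee0_abs ?lee_fin //.
    (* From [|q w| <= |c k| + eps] and [2 * |e w| <= 1 + |e w| ^+ 2]. *)
    pose A := (`|c k| + eps) ^+ 2 + eps.
    have A0 : 0 <= A by rewrite addr_ge0 ?exprn_ge0 // ?addr_ge0 // ltW.
    have mA : measurable_fun setT (fun w => A + (1 + eps) * `|e w| ^+ 2).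
      by apply: measurable_funD => //; apply: measurable_funM => //;
        exact: measurable_funX.
    apply: (@le_lt_trans _ _ (\int[P]_(w in pc k) (A + (1 + eps) * `|e w| ^+ 2)%:E)%E).
      apply: ge0_le_integral => //.
        by move=> w _; rewrite /= lee_fin.
        exact: (mE F).
        exact: (mE (fun w => A + (1 + eps) * `|e w| ^+ 2)).
      move=> w [_ [+ _]]; rewrite /near_c /= => qc; rewrite lee_fin /F /A.
      have qle : `|q w| <= `|c k| + eps.
        rewrite -(subrK (c k) (q w)) addrC; apply: le_trans (ler_normD _ _) _.
        by rewrite lerD2l ltW.
      have : `|q w| ^+ 2 <= (`|c k| + eps) ^+ 2.
        by rewrite ler_pXn2r ?nnegrE // (le_trans _ qle).
      have : 0 <= eps * (`|e w| - 1) ^+ 2 by rewrite mulr_ge0 ?(ltW eps0) // sqr_ge0.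
      lra.
    apply: (@le_lt_trans _ _ (\int[P]_w (A + (1 + eps) * `|e w| ^+ 2)%:E)%E).
      apply: ge0_subset_integral => //.
        exact: (mE (fun w => A + (1 + eps) * `|e w| ^+ 2)).
      by move=> w _; rewrite lee_fin addr_ge0 // mulr_ge0 // addr_ge0 // ltW.
    rewrite (intZD (fun=> A) (fun w => (1 + eps) * `|e w| ^+ 2)) //; last 2 first.
    - by move=> w; rewrite mulr_ge0 // addr_ge0 // ltW.
    - by apply: measurable_funM => //; exact: measurable_funX.
    rewrite (integral_cst P measurableT A%:E) [X in (_ * X)%E]probability_setT mule1.
    under eq_integral do rewrite EFinM.
    rewrite ge0_integralZl_EFin //.
    - by rewrite -/C -(fineK Cfin) -EFinM -EFinD ltry.
    - by apply: (mE (fun w => `|e w| ^+ 2)); exact: measurable_funX.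
    - by rewrite addr_ge0 // ltW.
  have int_e : P.-integrable (pc k) (EFin \o (fun w => dot (e w) (c k))).
    apply: integrable_dot => //; apply: le_lt_trans (e1 _ (mpc k)) _.
    by rewrite -(fineK Cfin) -EFinD ltry.
  have int_e2 : P.-integrable (pc k) (fun w => 2%:E * (dot (e w) (c k))%:E)%E.
    exact: integrableZl.
  have -> : (\int[P]_(w in pc k) (F w)%:E =
      \int[P]_(w in pc k) ((F w)%:E + 2%:E * (dot (e w) (c k))%:E))%E.
    by rewrite integralD // integralZl // e_orth // mule0 adde0.
  apply: ge0_le_integral => //.
  - by apply: (mE (fun w => `|q w + e w| ^+ 2)).
  - exact: measurable_int (integrableD (mpc k) int_F int_e2).
  - move=> w [_ [+ _]]; rewrite /near_c /= => qc.
    rewrite -EFinM -EFinD lee_fin (sqnormD Hdot) /F.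
    have -> : dot (q w) (e w) = dot (q w - c k) (e w) + dot (e w) (c k).
      by rewrite (dotC dot (e w)) -(dotDl dot) subrK.
    have := ler_dot Hdot (q w - c k) (e w).
    have := ler_wpM2r (normr_ge0 (e w)) (ltW qc); lra.
have -> : (\int[P]_(w in D) (`|q w| ^+ 2 + `|e w| ^+ 2)%:E +
    (2 * eps)%:E * \int[P]_(w in D) `|e w|%:E = \int[P]_(w in D) (F w)%:E)%E.
  rewrite (intZD (fun w => `|q w| ^+ 2 + `|e w| ^+ 2) (fun w => 2 * eps * `|e w|)) //.
  - congr (_ + _)%E; under [RHS]eq_integral do rewrite EFinM.
    rewrite ge0_integralZl_EFin //; first exact: mE.
    by rewrite mulr_ge0 // ltW.
  - by move=> w; rewrite !mulr_ge0 // ltW.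
  - exact: measurable_funM.
have sumE (k : Omega -> R) : (forall w, 0 <= k w) -> measurable_fun setT k ->
    (\int[P]_(w in D) (k w)%:E = \sum_(0 <= i <oo) \int[P]_(w in pc i) (k w)%:E)%E.
  move=> k0 mk; rewrite [in LHS]DE ge0_integral_bigcup //.
  - exact: mE.
  - by move=> w _; rewrite lee_fin.
rewrite (sumE F) // (sumE (fun w => `|q w + e w| ^+ 2)) //.
apply: lee_nneseries => [k _ _|k _]; last exact: piece.
by apply: integral_ge0 => w _; rewrite lee_fin exprn_ge0.
Qed.

End hilbert_conditional_expectation.

(** * The perturbed forward-backward iteration *)

Section perturbed_iteration.
Variables (R : realType) (H : completeNormedModType R).
Variable (dot : {dot H for idfun}).
Hypothesis Hdot : induces_norm dot.
Variables (A : H -> set H) (theta : R) (B : H -> H).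
Hypothesis HA : maximally_monotone dot A.
Hypothesis theta_gt0 : 0 < theta.
Hypothesis HB : cocoercive dot theta B.

Lemma sqnormD_young (k : R) (u v : H) : 0 < k ->
  `|u + v| ^+ 2 <= (1 + k) * `|u| ^+ 2 + (1 + k^-1) * `|v| ^+ 2.
Proof.
move=> k0; rewrite (sqnormD Hdot).
have := exprn_ge0 2 (normr_ge0 (k *: u - v)).
rewrite (sqnormB Hdot (k *: u)) (sqnormZ Hdot) dotZl => h.
have : 0 <= k^-1 * (k ^+ 2 * `|u| ^+ 2 - 2 * (k * dot u v) + `|v| ^+ 2).
  by rewrite mulr_ge0 // invr_ge0 ltW.
have -> : k^-1 * (k ^+ 2 * `|u| ^+ 2 - 2 * (k * dot u v) + `|v| ^+ 2) =
    k * `|u| ^+ 2 - 2 * dot u v + k^-1 * `|v| ^+ 2 by field; rewrite gt_eqF.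
lra.
Qed.

Lemma sqnorm_convex (l : R) (u v : H) : 0 <= l <= 1 ->
  `|(1 - l) *: u + l *: v| ^+ 2 <= (1 - l) * `|u| ^+ 2 + l * `|v| ^+ 2.
Proof.
move=> /andP[l0 l1]; rewrite (sqnormD Hdot ((1 - l) *: u)) !(sqnormZ Hdot) dotZl dotZr.
have := exprn_ge0 2 (normr_ge0 (u - v)); rewrite (sqnormB Hdot u) => h.
have : 0 <= l * (1 - l) * (`|u| ^+ 2 - 2 * dot u v + `|v| ^+ 2).
  by rewrite !mulr_ge0 // subr_ge0.
lra.
Qed.

Let J (c : R) := resolvent (op_scale c A).
Let T := forward_backward A B.

Section step.
Variables (gamma lambda : R) (x u a Eu z : H).
Hypothesis gamma_in : 0 < gamma < 2 * theta.
Hypothesis lambda_in : 0 < lambda <= 1.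
Let x1 := x + lambda *: (J gamma (x - gamma *: u) + a - x).
Let q := x - z - gamma *: (B x - B z) - gamma *: (Eu - B x).

(** Young's inequality with weight [lambda * kappa] splits off [a]; convexity and [resolvent_step]
    treat the rest. The latter produces the square of [S'], formed with [u], whereas (ii) asks for
    [S], formed with [B x]. By [resolvent_conexp] the exchange costs a multiple of bias and noise,
    and the factor [delta] makes this cost small. *)
Lemma iteration_step (kappa delta : R) : 0 < kappa -> 0 <= delta <= 1 -> A z (- B z) ->
  `|x1 - z| ^+ 2 + lambda * (delta / 2) *
    `|x - gamma *: B x - J gamma (x - gamma *: B x) + gamma *: B z| ^+ 2 <=
  (1 + lambda * kappa) * ((1 - lambda) * `|x - z| ^+ 2
     + lambda * `|q + - gamma *: (u - Eu)| ^+ 2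
     + 2 * lambda * delta * gamma ^+ 2 * (`|Eu - B x| ^+ 2 + `|u - Eu| ^+ 2))
  + (lambda / kappa + lambda ^+ 2) * `|a| ^+ 2.
Proof.
move=> kappa0 /andP[d0 d1] Az; have /andP[g0 _] := gamma_in;
  have /andP[l0 l1] := lambda_in.
pose t := J gamma (x - gamma *: u).
set S := x - _ - _ + _.
pose S' := x - gamma *: u - t - gamma *: (- B z).
pose Y := (1 - lambda) *: (x - z) + lambda *: (t - z).
have x1E : x1 - z = Y + lambda *: a.
  by rewrite /x1 -/t /Y; apply: (dot_inj Hdot) => h; rewrite !dotE; ring.
have := @sqnormD_young (lambda * kappa) Y (lambda *: a) (mulr_gt0 l0 kappa0).
rewrite -x1E (sqnormZ Hdot) => le1.
have le1' : (1 + (lambda * kappa)^-1) * (lambda ^+ 2 * `|a| ^+ 2) =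
    (lambda / kappa + lambda ^+ 2) * `|a| ^+ 2.
  by field; rewrite !gt_eqF.
have leY : `|Y| ^+ 2 <= (1 - lambda) * `|x - z| ^+ 2 + lambda * `|t - z| ^+ 2.
  by apply: sqnorm_convex; rewrite l1 ltW.
have lt := resolvent_step Hdot HA (x - gamma *: u) g0 Az.
have qE : x - gamma *: u - (z + gamma *: - B z) = q + - gamma *: (u - Eu).
  by rewrite /q; apply: (dot_inj Hdot) => h; rewrite !dotE; ring.
rewrite qE -/(J gamma) -/t -/S' in lt.
have SS' : `|S - S'| <= gamma * `|(Eu - B x) + (u - Eu)|.
  have -> : S - S' = (x - gamma *: B x - J gamma (x - gamma *: B x)) -
      (x - gamma *: u - J gamma (x - gamma *: u)).
    by rewrite /S /S' -/t; apply: (dot_inj Hdot) => h; rewrite !dotE; ring.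
  apply: le_trans (resolvent_conexp Hdot HA _ _ g0) _.
  have -> : x - gamma *: B x - (x - gamma *: u) = gamma *: ((Eu - B x) + (u - Eu)).
    by apply: (dot_inj Hdot) => h; rewrite !dotE; ring.
  by rewrite normrZ gtr0_norm.
have SS'2 : `|S - S'| ^+ 2 <= gamma ^+ 2 * (2 * `|Eu - B x| ^+ 2 + 2 * `|u - Eu| ^+ 2).
  apply: (@le_trans _ _ (gamma ^+ 2 * `|(Eu - B x) + (u - Eu)| ^+ 2)).
    by rewrite -exprMn ler_pXn2r ?nnegrE // mulr_ge0 // ltW.
  rewrite ler_wpM2l ?exprn_ge0 ?(ltW g0) //.
  by have := @sqnormD_young 1 (Eu - B x) (u - Eu) ltr01; rewrite invr1; lra.
have S2 : `|S| ^+ 2 <= 2 * `|S'| ^+ 2 + 2 * `|S - S'| ^+ 2.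
  have := @sqnormD_young 1 S' (S - S') ltr01; rewrite invr1 addrC subrK; lra.
have SS0 := exprn_ge0 2 (normr_ge0 S'); have S0 := exprn_ge0 2 (normr_ge0 S).
have lk : 0 <= lambda * kappa by rewrite mulr_ge0 // ltW.
set E := `|Eu - B x| ^+ 2 + `|u - Eu| ^+ 2.
have dS : lambda * (delta / 2) * `|S| ^+ 2 <=
    lambda * `|S'| ^+ 2 + 2 * lambda * delta * gamma ^+ 2 * E.
  have ld : 0 <= lambda * (delta / 2) by rewrite mulr_ge0 ?(ltW l0) // divr_ge0.
  have S2' : `|S| ^+ 2 <= 2 * `|S'| ^+ 2 + 2 * (gamma ^+ 2 * (2 * E)).
    by rewrite /E mulrDr; lra.
  apply: le_trans (ler_wpM2l ld S2') _.
  have : 0 <= lambda * (1 - delta) * `|S'| ^+ 2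
    by rewrite !mulr_ge0 ?subr_ge0 ?(ltW l0).
  lra.
rewrite le1' in le1.
pose bracket := (1 - lambda) * `|x - z| ^+ 2
     + lambda * `|q + - gamma *: (u - Eu)| ^+ 2
     + 2 * lambda * delta * gamma ^+ 2 * E.
have YS : `|Y| ^+ 2 + lambda * (delta / 2) * `|S| ^+ 2 <= bracket.
  have := ler_wpM2l (ltW l0) lt; rewrite /bracket; lra.
have := ler_wpM2l lk YS.
have : 0 <= lambda * kappa * (lambda * (delta / 2) * `|S| ^+ 2).
  by rewrite !mulr_ge0 ?divr_ge0 ?(ltW l0) ?(ltW kappa0).
rewrite -/bracket; lra.
Qed.

(** [e2] stands for the bound on the conditional noise and [b] for the bias. Forward step and noise
    leave the margin [gamma * (2 * theta - (1 + tau) * gamma)] in front of [|B x - B z| ^+ 2], which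
    pays for the noise weighted by [delta] and for [c]. The bias enters through
    [2 * b * |p| <= b * (1 + |p| ^+ 2)] and so feeds both the growth factor and the additive
    term. *)
Lemma iteration_bound (kappa delta tau zeta c e2 b : R) :
  0 <= kappa -> 0 <= delta <= 1 -> 0 <= tau -> 0 <= zeta -> 0 <= c ->
  2 * delta * gamma ^+ 2 * tau + c <= gamma * (2 * theta - (1 + tau) * gamma) ->
  e2 = tau * `|B x - B z| ^+ 2 + zeta -> b = `|Eu - B x| ->
  (1 + lambda * kappa) * ((1 - lambda) * `|x - z| ^+ 2
     + lambda * (`|q| ^+ 2 + gamma ^+ 2 * e2)
     + 2 * lambda * delta * gamma ^+ 2 * (b ^+ 2 + e2))
  + lambda * c * `|B x - B z| ^+ 2 <=
  (1 + lambda * kappa) * (1 + lambda * gamma * b) * `|x - z| ^+ 2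
  + (1 + lambda * kappa) * (lambda * gamma * b + 3 * lambda * gamma ^+ 2 * (b ^+ 2 +
    zeta)).
Proof.
move=> kappa0 /andP[d0 d1] tau0 zeta0 c0 hc e2E bE.
have /andP[g0 _] := gamma_in; have /andP[l0 l1] := lambda_in.
pose p := x - z - gamma *: (B x - B z).
have p2 : `|p| ^+ 2 <= `|x - z| ^+ 2 - gamma * (2 * theta - gamma) * `|B x - B z| ^+ 2.
  exact: (forward_step Hdot HB _ _ (ltW g0)).
have q2 : `|q| ^+ 2 <= `|p| ^+ 2 + gamma * b * (1 + `|p| ^+ 2) + gamma ^+ 2 * b ^+ 2.
  rewrite /q -/p (sqnormB Hdot p) (sqnormZ Hdot) dotZr -bE.
  have := ler_dot Hdot (- p) (Eu - B x); rewrite dotNl normrN -bE => dotp.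
  have b0 : 0 <= gamma * b by rewrite bE mulr_ge0 // ltW.
  have : gamma * (- dot p (Eu - B x)) <= gamma * (`|p| * b) by rewrite ler_pM2l.
  have : 0 <= gamma * b * (`|p| - 1) ^+ 2 by rewrite mulr_ge0 // sqr_ge0.
  lra.
set V := `|x - z| ^+ 2 in p2 *; set be := `|B x - B z| ^+ 2 in p2 e2E *.
have be0 : 0 <= be by exact: exprn_ge0.
have V0 : 0 <= V by exact: exprn_ge0.
have b0 : 0 <= b by rewrite bE.
have pV : `|p| ^+ 2 <= V.
  apply: le_trans p2 _; rewrite gerBl !mulr_ge0 ?(ltW g0) // subr_ge0.
  by have /andP[_ /ltW] := gamma_in.
have lgb : 0 <= gamma * b by rewrite mulr_ge0 // ltW.
have q2' : `|q| ^+ 2 <=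
  V - gamma * (2 * theta - gamma) * be + gamma * b * (1 + V) + gamma ^+ 2 * b ^+ 2.
  have := ler_wpM2l lgb pV; lra.
have hcb : (2 * delta * gamma ^+ 2 * tau + c) * be <=
  gamma * (2 * theta - (1 + tau) * gamma) * be.
  by rewrite ler_wpM2r.
have g2 : 0 <= gamma ^+ 2 by rewrite exprn_ge0 // ltW.
have dg : 2 * delta * gamma ^+ 2 * (b ^+ 2 + zeta) <= 2 * gamma ^+ 2 * (b ^+ 2 + zeta).
  have : 0 <= (1 - delta) * (gamma ^+ 2 * (b ^+ 2 + zeta)).
    by apply: mulr_ge0; [rewrite subr_ge0|apply: mulr_ge0 => //;
      rewrite addr_ge0 ?exprn_ge0].
  lra.
have inner : `|q| ^+ 2 + gamma ^+ 2 * e2 + 2 * delta * gamma ^+ 2 * (b ^+ 2 + e2) +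
  c * be <=
    V + gamma * b * (1 + V) + 3 * gamma ^+ 2 * (b ^+ 2 + zeta).
  rewrite e2E; lra.
have outer : (1 - lambda) * V + lambda * (`|q| ^+ 2 + gamma ^+ 2 * e2)
     + 2 * lambda * delta * gamma ^+ 2 * (b ^+ 2 + e2) + lambda * c * be <=
    (1 + lambda * gamma * b) * V + (lambda * gamma * b +
      3 * lambda * gamma ^+ 2 * (b ^+ 2 + zeta)).
  have := ler_wpM2l (ltW l0) inner; lra.
have lk : 0 <= lambda * kappa by rewrite mulr_ge0 // ltW.
have lk1 : 0 <= 1 + lambda * kappa by lra.
have := ler_wpM2l lk1 outer.
have : 0 <= lambda * kappa * (lambda * c * be) by rewrite !mulr_ge0 // ltW.
lra.
Qed.

(** With [n = T gamma x], the old residual enters [|x1 - n|] with coefficient [1 - lambda] and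
    [|x1 - x|] with coefficient [lambda]. The total is exactly 1, provided that both residuals are
    taken with the same [gamma]. *)
Lemma residual_step :
  `|x1 - T gamma x1| <= `|x - T gamma x| + 2 * lambda *
    (gamma * `|Eu - B x| + gamma * `|u - Eu| + `|a|).
Proof.
have /andP[g0 _] := gamma_in; have /andP[l0 l1] := lambda_in.
pose t := J gamma (x - gamma *: u).
have tT : `|t - T gamma x| <= gamma * (`|Eu - B x| + `|u - Eu|).
  apply: le_trans (resolvent_nonexp Hdot HA _ _ g0) _.
  have -> : x - gamma *: u - (x - gamma *: B x) = - gamma *: ((Eu - B x) + (u - Eu)).
    by apply: (dot_inj Hdot) => h; rewrite !dotE; ring.
  by rewrite normrZ normrN gtr0_norm // ler_pM2l // ler_normD.
set n := T gamma x in tT *.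
have step1 : `|x1 - x| <= lambda * (`|x - n| + `|t - n| + `|a|).
  have -> : x1 - x = lambda *: ((n - x) + (t - n) + a).
    by rewrite /x1 -/t; apply: (dot_inj Hdot) => h; rewrite !dotE; ring.
  rewrite normrZ gtr0_norm // ler_pM2l //.
  apply: le_trans (ler_normD _ _) _; rewrite lerD2r.
  by apply: le_trans (ler_normD _ _) _; rewrite distrC.
have step2 : `|x1 - n| <= (1 - lambda) * `|x - n| + lambda * (`|t - n| + `|a|).
  have -> : x1 - n = (1 - lambda) *: (x - n) + lambda *: ((t - n) + a).
    by rewrite /x1 -/t; apply: (dot_inj Hdot) => h; rewrite !dotE; ring.
  apply: le_trans (ler_normD _ _) _; rewrite !normrZ ger0_norm ?subr_ge0 //.
  by rewrite lerD2l gtr0_norm // ler_pM2l // ler_normD.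
have nonexp : `|n - T gamma x1| <= `|x - x1|
  by exact: (forward_backward_nonexp Hdot HA HB).
have := ler_distD n x1 (T gamma x1).
rewrite (distrC x x1) in nonexp.
have := ler_wpM2l (ltW l0) tT; lra.
Qed.

End step.

End perturbed_iteration.

(** * Calculus of conditional upper bounds *)

Section domination.
Variables (d : measure_display) (Omega : measurableType d) (R : realType).
Variable (P : probability Omega R).
Variable G : set (set Omega).
Hypothesis HG : sub_sigma_field G.
Implicit Types f g h : Omega -> R.

Definition nonneg_gmeas f := (forall w, 0 <= f w) /\ gmeas G f.

(** [cond_le] bundled with the side conditions under which such bounds can be added and multiplied:
    [g] is [G]-measurable, [f] merely measurable. *)
Definition dominated f g := [/\ forall w, 0 <= f w, measurable_fun setT f,
  nonneg_gmeas g & cond_le P G f g].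

Lemma nonneg_gmeasD f g : nonneg_gmeas f -> nonneg_gmeas g ->
  nonneg_gmeas (fun w => f w + g w).
Proof.
by move=> [f0 mf] [g0 mg]; split=> [w|]; [rewrite addr_ge0|exact: gmeasD].
Qed.

Lemma nonneg_gmeasM f g : nonneg_gmeas f -> nonneg_gmeas g ->
  nonneg_gmeas (fun w => f w * g w).
Proof.
by move=> [f0 mf] [g0 mg]; split=> [w|]; [rewrite mulr_ge0|exact: gmeasM].
Qed.

Lemma nonneg_gmeasX f n : nonneg_gmeas f -> nonneg_gmeas (fun w => f w ^+ n).
Proof. by move=> [f0 mf]; split=> [w|]; [rewrite exprn_ge0|exact: gmeasX]. Qed.

Lemma nonneg_gmeasV f : nonneg_gmeas f -> nonneg_gmeas (fun w => (f w)^-1).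
Proof. by move=> [f0 mf]; split=> [w|]; [rewrite invr_ge0|exact: gmeasV]. Qed.

Lemma nonneg_gmeas_sqrt f : gmeas G f -> nonneg_gmeas (fun w => Num.sqrt (f w)).
Proof. by move=> mf; split=> [w|]; [exact: sqrtr_ge0|exact: gmeas_sqrt]. Qed.

Lemma nonneg_gmeas_cst (c : R) : 0 <= c -> nonneg_gmeas (fun=> c).
Proof. by move=> c0; split=> // ; exact: gmeas_cst. Qed.

Lemma dominated_refl f : nonneg_gmeas f -> dominated f f.
Proof.
move=> [f0 mf]; by split=> //; exact: (gmeas_measurable HG mf).
Qed.

Lemma dominatedD f g f' g' : dominated f g -> dominated f' g' ->
  dominated (fun w => f w + f' w) (fun w => g w + g' w).
Proof.
move=> [f0 mf gg fg] [f'0 mf' gg' fg']; split.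
- by move=> w; rewrite addr_ge0.
- exact: measurable_funD.
- exact: nonneg_gmeasD.
- have [g0 mg] := gg; have [g'0 mg'] := gg'.
  by apply: cond_leD => //; exact: (gmeas_measurable HG).
Qed.

Lemma dominatedM h f g : nonneg_gmeas h -> dominated f g ->
  dominated (fun w => h w * f w) (fun w => h w * g w).
Proof.
move=> hh [f0 mf gg fg]; have [h0 mh] := hh; have [g0 mg] := gg; split.
- by move=> w; rewrite mulr_ge0.
- by apply: measurable_funM => //; exact: (gmeas_measurable HG).
- exact: nonneg_gmeasM.
- by apply: cond_leM => //; exact: (gmeas_measurable HG).
Qed.

Lemma dominatedZ (c : R) f g : 0 <= c -> dominated f g ->
  dominated (fun w => c * f w) (fun w => c * g w).
Proof. by move=> c0; apply: dominatedM; exact: nonneg_gmeas_cst. Qed.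

Lemma dominated_ler f g g' : nonneg_gmeas g' -> {ae P, forall w, g w <= g' w} ->
  dominated f g -> dominated f g'.
Proof.
move=> gg' le_g [f0 mf [g0 mg] fg]; split=> //; have [g'0 mg'] := gg'.
apply: (cond_le_trans fg); apply: (ae_cond_le HG) => //; exact: (gmeas_measurable HG).
Qed.

Lemma dominated_lel f f' g : (forall w, 0 <= f' w) -> measurable_fun setT f' ->
  {ae P, forall w, f' w <= f w} -> dominated f g -> dominated f' g.
Proof.
move=> f'0 mf' le_f [f0 mf gg fg]; split=> //.
by apply: cond_le_trans fg; exact: (ae_cond_le HG).
Qed.

(* A conditional Jensen inequality, weakened by [r] to avoid dividing by 0. *)
Lemma dominated_sqrt (r : R) f v : 0 < r -> (forall w, 0 <= f w) ->
  measurable_fun setT f -> dominated (fun w => f w ^+ 2) v ->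
  dominated f (fun w => Num.sqrt (v w) + r).
Proof.
move=> r0 f0 mf fv; have [_ _ [v0 mv] _] := fv.
pose k w := Num.sqrt (v w) + r.
have k0 w : 0 < k w by rewrite ltr_wpDl // sqrtr_ge0.
have kk : nonneg_gmeas k.
  by apply: nonneg_gmeasD; [exact: nonneg_gmeas_sqrt|apply: nonneg_gmeas_cst;
    exact: ltW].
have half : 0 <= (2^-1 : R) by rewrite invr_ge0.
have dom := dominatedD (dominatedM (nonneg_gmeasM (nonneg_gmeas_cst half)
  (nonneg_gmeasV kk)) fv)
  (dominatedZ half (dominated_refl kk)).
apply: dominated_ler kk _ _; last apply: (dominated_lel f0 mf _ dom).
  apply: aeW => w; have vk : v w <= k w ^+ 2.
    rewrite -{1}(sqr_sqrtr (v0 w)) ler_pXn2r ?nnegrE ?sqrtr_ge0 ?(ltW (k0 w)) //.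
    by rewrite /k lerDl ltW.
  have : (k w)^-1 * v w <= k w by rewrite ler_pdivrMl // -expr2.
  lra.
apply: aeW => w; have : 0 <= (k w)^-1 * (f w - k w) ^+ 2.
  by rewrite mulr_ge0 ?sqr_ge0 // invr_ge0 ltW.
have -> : (k w)^-1 * (f w - k w) ^+ 2 = (k w)^-1 * f w ^+ 2 - 2 * f w + k w.
  by field; rewrite gt_eqF.
lra.
Qed.

(** A version [g] can be negative on a null set; [Num.sqrt (g w) ^+ 2] is its positive part. *)
Lemma cond_exp_dominated f g : (forall w, 0 <= f w) -> cond_exp P G f g ->
  dominated f (fun w => Num.sqrt (g w) ^+ 2).
Proof.
move=> f0 [/(gmeasE HG) mg int_f int_g fg].
have mf : measurable_fun setT f by apply/measurable_EFinP; exact: measurable_int int_f.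
have gg := nonneg_gmeas_sqrt mg.
split=> //; first exact: nonneg_gmeasX.
move=> D GD; rewrite fg //; have mD := HG.2 _ GD.
have g2 : measurable_fun setT (fun w => Num.sqrt (g w) ^+ 2).
  by apply: (gmeas_measurable HG); exact: (nonneg_gmeasX 2 gg).2.
have gle w : g w <= Num.sqrt (g w) ^+ 2.
  have [g0|g0] := leP 0 (g w); first by rewrite sqr_sqrtr.
  by rewrite (le_trans (ltW g0)) // exprn_ge0 // sqrtr_ge0.
have abs_le w : Num.sqrt (g w) ^+ 2 <= `|g w|.
  have [g0|g0] := leP 0 (g w); first by rewrite sqr_sqrtr // ler_norm.
  by rewrite ltr0_sqrtr // expr2 mul0r.
have int_gD : P.-integrable D (EFin \o g) by apply: (@integrableS _ _ _ P setT).
apply: le_integral => //.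
- apply: le_integrable int_gD => //; first by apply/measurable_EFinP;
  exact: measurable_funTS.
  by move=> w _ /=; rewrite lee_fin ger0_norm // exprn_ge0 // sqrtr_ge0.
- by move=> w _; rewrite lee_fin.
Qed.

End domination.

Section domination_convergence.
Variables (d : measure_display) (Omega : measurableType d) (R : realType).
Variable (P : probability Omega R).

Lemma dominated_robbins_siegmund (X : nat -> set (set Omega)) (V th chi eta :
  nat -> Omega -> R) :
  (forall n, sub_sigma_field (X n)) -> (forall n, X n `<=` X n.+1) ->
  (forall n, nonneg_gmeas (X n) (V n)) -> (forall n, nonneg_gmeas (X n) (th n)) ->
  (forall n, nonneg_gmeas (X n) (chi n)) -> (forall n, nonneg_gmeas (X n) (eta n)) ->
  (\int[P]_w (V 0%N w)%:E < +oo)%E ->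
  (forall n, dominated P (X n) (fun w => V n.+1 w + th n w)
    (fun w => (1 + chi n w) * V n w + eta n w)) ->
  {ae P, forall w, bounded_sums (chi ^~ w)} ->
  {ae P, forall w, bounded_sums (eta ^~ w)} ->
  {ae P, forall w, cvgn (V ^~ w) /\ bounded_sums (th ^~ w)}.
Proof.
move=> X_sub X_nd VV tt cc ee V0 step.
apply: (robbins_siegmund X_sub X_nd) => //.
- by move=> n w; exact: (VV n).1.
- by move=> n w; exact: (tt n).1.
- by move=> n w; exact: (cc n).1.
- by move=> n w; exact: (ee n).1.
- by move=> n; exact: (VV n).2.
- by move=> n; exact: (tt n).2.
- by move=> n; exact: (cc n).2.
- by move=> n; exact: (ee n).2.
- by move=> n; have [] := step n.
Qed.

End domination_convergence.

(** * The stochastic forward-backward iteration *)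

Section stochastic_forward_backward.
Variables (R : realType) (H : completeNormedModType R).
Variable (dot : {dot H for idfun}).
Hypothesis Hdot : induces_norm dot.
Hypothesis Hsep : separable H.
Variables (d : measure_display) (Omega : measurableType d).
Variable (P : probability Omega R).
Variables (A : H -> set H) (theta : R) (B : H -> H).
Hypothesis HA : maximally_monotone dot A.
Hypothesis theta_gt0 : 0 < theta.
Hypothesis HB : cocoercive dot theta B.
Let T := forward_backward A B.

Variables (x u a : nat -> Omega -> H) (lambda gamma tau : nat -> R).
Hypothesis x0_L2 : L2 P (x 0%N).
Hypothesis u_L2 : forall n, L2 P (u n).
Hypothesis a_L2 : forall n, L2 P (a n).
Hypothesis lambda_in : forall n, 0 < lambda n <= 1.
Hypothesis gamma_in : forall n, 0 < gamma n < 2 * theta.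
Hypothesis x_rec : forall n, {ae P, forall w,
  x n.+1 w = x n w + lambda n *:
    (resolvent (op_scale (gamma n) A) (x n w - gamma n *: u n w) + a n w - x n w)}.
Hypothesis tau_ge0 : forall n, 0 <= tau n.
Variable X : nat -> set (set Omega).
Hypothesis X_sub : forall n, sub_sigma_field (X n).
Hypothesis X_nd : forall n, X n `<=` X n.+1.
Hypothesis x_adapted : forall n, hmeasurable (X n) (x n).
Variables (Eu : nat -> Omega -> H) (Ea Vu : nat -> Omega -> R).
Hypothesis Eu_def : forall n, cond_exp_H P (X n) (u n) (Eu n).
Hypothesis Ea_def : forall n, cond_exp P (X n) (fun w => `|a n w| ^+ 2) (Ea n).
Hypothesis Vu_def : forall n,
  cond_exp P (X n) (fun w => `|u n w - Eu n w| ^+ 2) (Vu n).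
Hypothesis Ea_sum : {ae P, forall w,
  bounded_sums (fun n => lambda n * Num.sqrt (Ea n w))}.
Hypothesis Eu_sum : {ae P, forall w,
  bounded_sums (fun n => Num.sqrt (lambda n) * `|Eu n w - B (x n w)|)}.

Let Hm := @measurable_sub_sigma_field _ Omega.

Lemma integral_norm_lty (f : Omega -> H) D : hilbert_rv f -> measurable D ->
  (\int[P]_w (`|f w| ^+ 2)%:E < +oo)%E -> (\int[P]_(w in D) `|f w|%:E < +oo)%E.
Proof.
move=> mf mD f2; have mfn := measurable_norm_rv Hsep mf.
have mE (k : Omega -> R) D' : measurable_fun setT k -> measurable_fun D' (EFin \o k).
  by move=> mk; apply/measurable_EFinP; exact: measurable_funTS.
apply: (@le_lt_trans _ _ (\int[P]_w `|f w|%:E)%E).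
  by apply: ge0_subset_integral => //; exact: mE.
apply: (@le_lt_trans _ _ (\int[P]_w (1 + `|f w| ^+ 2)%:E)%E).
  apply: ge0_le_integral => //; first exact: mE.
    apply: (mE (fun w => 1 + `|f w| ^+ 2)).
    by apply: measurable_funD => //; exact: measurable_funX.
  by move=> w _; rewrite lee_fin; have := normr_ge0 (f w); nra.
under eq_integral do rewrite EFinD.
rewrite ge0_integralD //.
- rewrite (integral_cst P measurableT 1%E) [X in (_ * X)%E]probability_setT mule1.
  by rewrite lte_add_pinfty // ltry.
- by apply: (mE (fun w => `|f w| ^+ 2)); exact: measurable_funX.
Qed.

Let noise n w := u n w - Eu n w.

Let Eu_rv n : hilbert_rv (Eu n).
Proof. exact: hilbert_rv_hmeasurable (X_sub n) (Eu_def n).1. Qed.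

Let noise_rv n : hilbert_rv (noise n).
Proof. by apply: (hmeasurableB Hsep Hm); [exact: (u_L2 n).1|exact: Eu_rv]. Qed.

Let noise_L2 n : (\int[P]_w (`|noise n w| ^+ 2)%:E < +oo)%E.
Proof.
have [_ int_e _ _] := Vu_def n; exact: (integrable_lty measurableT int_e).
Qed.

Let noise_orth n D h : X n D -> (\int[P]_(w in D) (dot (noise n w) h)%:E = 0)%E.
Proof.
move=> XD; have mD := (X_sub n).2 _ XD.
have [v bu bE] := (Eu_def n).2 _ XD.
have u1 := integral_norm_lty (u_L2 n).1 mD (u_L2 n).2.
have e1 := integral_norm_lty (@noise_rv n) mD (@noise_L2 n).
have mu := measurable_norm_rv Hsep (u_L2 n).1.
have me := measurable_norm_rv Hsep (@noise_rv n).
have mE (k : Omega -> R) D' : measurable_fun setT k -> measurable_fun D' (EFin \o k).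
  by move=> mk; apply/measurable_EFinP; exact: measurable_funTS.
have E1 : (\int[P]_(w in D) `|Eu n w|%:E < +oo)%E.
  apply: (@le_lt_trans _ _ (\int[P]_(w in D) (`|u n w| + `|noise n w|)%:E)%E).
    apply: ge0_le_integral => //.
    - by apply: mE; exact: measurable_norm_rv.
    - by apply: (mE (fun w => `|u n w| + `|noise n w|)); exact: measurable_funD.
    - move=> w _; rewrite lee_fin.
      have -> : Eu n w = u n w - noise n w by rewrite /noise opprB addrC subrK.
      exact: ler_normB.
  under eq_integral do rewrite EFinD.
  rewrite ge0_integralD //; [exact: lte_add_pinfty|exact: mE|exact: mE].
have iu := integrable_dot Hdot Hsep h mD (u_L2 n).1 u1.
have iE := integrable_dot Hdot Hsep h mD (@Eu_rv n) E1.
transitivity (\int[P]_(w in D) ((dot (u n w) h)%:E - (dot (Eu n w) h)%:E))%E.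
  by apply: eq_integral => w _; rewrite /noise dotDl dotNl EFinB.
rewrite integralB // (bochner_integral_dot Hdot Hsep h mD u1 bu).
by rewrite (bochner_integral_dot Hdot Hsep h mD E1 bE) subee.
Qed.

Let Bx_adapted n : hmeasurable (X n) (fun w => B (x n w)).
Proof.
apply: (hmeasurable_lipschitz Hsep (X_sub n) (K := theta^-1)).
- by rewrite invr_ge0 ltW.
- by move=> v v'; rewrite ler_pdivlMl //; exact: (cocoercive_lipschitz Hdot HB).
- exact: x_adapted.
Qed.

Let bias_adapted n : nonneg_gmeas (X n) (fun w => `|Eu n w - B (x n w)|).
Proof.
split=> // ; apply: (gmeas_norm Hsep (X_sub n)).
by apply: (hmeasurableB Hsep (X_sub n)); [exact: (Eu_def n).1|exact: Bx_adapted].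
Qed.

Let a_dom n : dominated P (X n) (fun w => `|a n w| ^+ 2)
  (fun w => Num.sqrt (Ea n w) ^+ 2).
Proof. by apply: (cond_exp_dominated (X_sub n)) => // w; exact: exprn_ge0. Qed.

(* The term [2^-1 ^+ n] keeps this weight of Young's inequality positive where
   [Ea n] vanishes. *)
Let kappa n w := Num.sqrt (Ea n w) + 2^-1 ^+ n.

Let kappa_gt0 n w : 0 < kappa n w.
Proof. by rewrite ltr_wpDl ?sqrtr_ge0 // exprn_gt0 // invr_gt0. Qed.

Let kappa_adapted n : nonneg_gmeas (X n) (kappa n).
Proof.
apply: nonneg_gmeasD; last by apply: nonneg_gmeas_cst; rewrite exprn_ge0 // invr_ge0.
by apply: nonneg_gmeas_sqrt; have [/(gmeasE (X_sub n))] := Ea_def n.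
Qed.

Let lambda_ge0 n : 0 <= lambda n.
Proof. by have /andP[/ltW] := lambda_in n. Qed.

Let gamma_ge0 n : 0 <= gamma n.
Proof. by have /andP[/ltW] := gamma_in n. Qed.

Let gamma_le n : gamma n <= 2 * theta.
Proof. by have /andP[_ /ltW] := gamma_in n. Qed.

Let lambda_le_sqrt n : lambda n <= Num.sqrt (lambda n).
Proof.
have /andP[_ l1] := lambda_in n.
rewrite -{1}(sqr_sqrtr (lambda_ge0 n)) expr2 ler_piMl ?sqrtr_ge0 //.
by rewrite -[leRHS]sqrtr1 ler_wsqrtr.
Qed.

Let kappa_sum : {ae P, forall w, bounded_sums (fun n => lambda n * kappa n w)}.
Proof.
apply: filterS Ea_sum => w sw;
  apply: bounded_sums_le (bounded_sumsD sw (@bounded_sums_geo R)).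
move=> n; rewrite mulrDr lerD2l ler_piMl ?exprn_ge0 ?invr_ge0 //.
by have /andP[] := lambda_in n.
Qed.

(** The first sum rests on [lambda n <= Num.sqrt (lambda n)]. For the second, squaring the summable
    sequence of [Eu_sum] turns the root of [lambda n] into [lambda n]. *)
Let bias_sum : {ae P, forall w,
  bounded_sums (fun n => lambda n * gamma n * `|Eu n w - B (x n w)|) /\
  bounded_sums (fun n => lambda n * gamma n ^+ 2 * `|Eu n w - B (x n w)| ^+ 2)}.
Proof.
apply: filterS Eu_sum => w sw; split.
  have th2 : 0 <= 2 * theta by rewrite mulr_ge0 // ltW.
  apply: bounded_sums_le (bounded_sumsZ th2 sw) => n.
  rewrite [lambda n * _]mulrC -mulrA ler_pM ?mulr_ge0 //.
  by rewrite ler_wpM2r.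
have th4 : 0 <= (2 * theta) ^+ 2 by rewrite exprn_ge0 // mulr_ge0 // ltW.
have s0 n : 0 <= Num.sqrt (lambda n) * `|Eu n w - B (x n w)|.
  by rewrite mulr_ge0 // sqrtr_ge0.
apply: bounded_sums_le (bounded_sumsZ th4 (bounded_sumsM s0 s0 sw sw)) => n.
have -> : Num.sqrt (lambda n) * `|Eu n w - B (x n w)| *
   (Num.sqrt (lambda n) * `|Eu n w - B (x n w)|) = lambda n * `|Eu n w - B (x n w)|
     ^+ 2.
  by rewrite -{3}(sqr_sqrtr (lambda_ge0 n)); ring.
rewrite [lambda n * _]mulrC -mulrA ler_wpM2r ?mulr_ge0 ?exprn_ge0 //.
by rewrite ler_pXn2r ?nnegrE ?mulr_ge0 // ltW.
Qed.

Section fejer.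
Variables (g0 tau_max eps : R).
Hypothesis g0_gt0 : 0 < g0.
Hypothesis g0_le : forall n, g0 <= gamma n.
Hypothesis tau_le : forall n, tau n <= tau_max.
Hypothesis eps_gt0 : 0 < eps.
Hypothesis eps_le : forall n, eps <= 2 * theta - (1 + tau n) * gamma n.
Variable z : H.
Hypothesis Az : A z (- B z).
Variable zeta : nat -> Omega -> R.
Hypothesis zeta_adapted : forall n, nonneg_gmeas (X n) (zeta n).
Hypothesis zeta_sum : {ae P, forall w,
  bounded_sums (fun n => Num.sqrt (lambda n * zeta n w))}.
Hypothesis Vu_le : forall n, {ae P, forall w,
  Vu n w <= tau n * `|B (x n w) - B z| ^+ 2 + zeta n w}.

Let dist_adapted n : nonneg_gmeas (X n) (fun w => `|x n w - z| ^+ 2).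
Proof.
apply: nonneg_gmeasX; split=> //; apply: (gmeas_norm Hsep (X_sub n)).
by apply: (hmeasurableB Hsep (X_sub n));
  [exact: x_adapted|exact: hmeasurable_cst (X_sub n) _].
Qed.

Let B_dist_adapted n : nonneg_gmeas (X n) (fun w => `|B (x n w) - B z| ^+ 2).
Proof.
apply: nonneg_gmeasX; split=> //; apply: (gmeas_norm Hsep (X_sub n)).
by apply: (hmeasurableB Hsep (X_sub n));
  [exact: Bx_adapted|exact: hmeasurable_cst (X_sub n) _].
Qed.

Let noise_bound n w := tau n * `|B (x n w) - B z| ^+ 2 + zeta n w.

Let noise_bound_adapted n : nonneg_gmeas (X n) (noise_bound n).
Proof.
by apply: nonneg_gmeasD => //; apply: nonneg_gmeasM => //; exact: nonneg_gmeas_cst.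
Qed.

Lemma noise_dom n : dominated P (X n) (fun w => `|noise n w| ^+ 2) (noise_bound n).
Proof.
have := cond_exp_dominated (X_sub n) (fun w =>
  exprn_ge0 2 (normr_ge0 (noise n w))) (Vu_def n).
apply: (dominated_ler (X_sub n)) => //.
apply: filterS (Vu_le n) => w; rewrite -/(noise_bound n w) => le_w.
have nb0 : 0 <= noise_bound n w by exact: (noise_bound_adapted n).1.
have [V0|V0] := leP 0 (Vu n w); first by rewrite sqr_sqrtr.
by rewrite ltr0_sqrtr // expr2 mul0r.
Qed.

Let residual n w := x n w - gamma n *: B (x n w)
  - resolvent (op_scale (gamma n) A) (x n w - gamma n *: B (x n w)) + gamma n *: B z.

Let residual_adapted n : nonneg_gmeas (X n) (fun w => `|residual n w| ^+ 2).
Proof.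
have /andP[gn0 _] := gamma_in n.
have mfw : hmeasurable (X n) (fun w => x n w - gamma n *: B (x n w)).
  apply: (hmeasurableB Hsep (X_sub n)); first exact: x_adapted.
  exact: (hmeasurableZ Hsep (X_sub n)).
apply: nonneg_gmeasX; split=> //; apply: (gmeas_norm Hsep (X_sub n)).
apply: (hmeasurableD Hsep (X_sub n)); last exact: hmeasurable_cst (X_sub n) _.
apply: (hmeasurableB Hsep (X_sub n)) => //.
apply: (hmeasurable_lipschitz Hsep (X_sub n) (K := 1)) mfw => // v v'.
by rewrite mul1r; exact: (resolvent_nonexp Hdot HA).
Qed.

Let drift n w := x n w - z - gamma n *: (B (x n w) - B z) - gamma n *:
  (Eu n w - B (x n w)).

Let drift_adapted n : hmeasurable (X n) (drift n).
Proof.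
have Hs := X_sub n; have mc v := hmeasurable_cst Hs v.
have mx := x_adapted n; have mB := @Bx_adapted n; have mEu := (Eu_def n).1.
by do ?[apply: (hmeasurableB Hsep Hs) | apply: (hmeasurableZ Hsep Hs)].
Qed.

Let drift_noise_dom n : dominated P (X n)
  (fun w => `|drift n w + - gamma n *: noise n w| ^+ 2)
  (fun w => `|drift n w| ^+ 2 + gamma n ^+ 2 * noise_bound n w).
Proof.
have mgn : hilbert_rv (fun w => - gamma n *: noise n w).
  by apply: (hmeasurableZ Hsep Hm); exact: noise_rv.
have mdr := hilbert_rv_hmeasurable (X_sub n) (@drift_adapted n).
have gn2 w : `|- gamma n *: noise n w| ^+ 2 = gamma n ^+ 2 * `|noise n w| ^+ 2.
  by rewrite (sqnormZ Hdot) sqrrN.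
have mn2 : measurable_fun setT (fun w => `|noise n w| ^+ 2).
  by apply: measurable_funX; apply: (measurable_norm_rv Hsep); exact: noise_rv.
have dr : nonneg_gmeas (X n) (fun w => `|drift n w| ^+ 2).
  by apply: nonneg_gmeasX; split=> //; apply: (gmeas_norm Hsep (X_sub n));
    exact: drift_adapted.
have [_ _ rhs0 dom] := dominatedD (X_sub n) (dominated_refl P (X_sub n) dr)
  (dominatedZ (X_sub n) (exprn_ge0 2 (gamma_ge0 n)) (noise_dom n)).
split=> //.
- apply: measurable_funX; apply: (measurable_norm_rv Hsep).
  exact: (hmeasurableD Hsep Hm).
- apply: cond_le_trans dom.
  have := pythagoras_cond_le Hdot Hsep (X_sub n) (@drift_adapted n) mgn.
  have -> : (fun w => `|drift n w| ^+ 2 + `|- gamma n *: noise n w| ^+ 2) =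
      (fun w => `|drift n w| ^+ 2 + gamma n ^+ 2 * `|noise n w| ^+ 2).
    by apply/funext => w; rewrite gn2.
  apply.
    under eq_integral do rewrite gn2 EFinM.
    rewrite ge0_integralZl_EFin //; [|exact/measurable_EFinP|exact: exprn_ge0].
    rewrite (_ : (\int[P]_w (`|noise n w| ^+ 2)%:E)%E =
      (fine (\int[P]_w (`|noise n w| ^+ 2)%:E)%E)%:E); first by rewrite -EFinM ltry.
    rewrite fineK // ge0_fin_numE ?noise_L2 //.
    by apply: integral_ge0 => w _; rewrite lee_fin exprn_ge0.
  move=> D h XD.
  have mD := (X_sub n).2 _ XD.
  under eq_integral do rewrite dotZl EFinM.
  rewrite integralZl ?noise_orth ?mule0 //.
  apply: (integrable_dot Hdot Hsep h mD (@noise_rv n)).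
  exact: (integral_norm_lty (@noise_rv n) mD (@noise_L2 n)).
Qed.

(** Half of [g0 * eps], a lower bound of the margin in [iteration_bound], is kept as the coefficient
    for (i). *)
Let c := g0 * eps / 2.
(* [delta] is so small that the noise in (ii), of size at most
   [tau n * |B x_n - B z| ^ 2], uses only half of the margin [g0 * eps]. *)
Let delta := Num.min 1 (c / (2 * (2 * theta) ^+ 2 * (tau_max + 1))).

Let c_gt0 : 0 < c. Proof. by rewrite divr_gt0 // mulr_gt0. Qed.

Let tau_max_ge0 : 0 <= tau_max. Proof. exact: le_trans (tau_ge0 0) (tau_le 0). Qed.

Let delta_gt0 : 0 < delta.
Proof.
rewrite lt_min ltr01 /= divr_gt0 // mulr_gt0 ?ltr_wpDl //.
by rewrite mulr_gt0 // exprn_gt0 // mulr_gt0.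
Qed.

Let delta_in : 0 <= delta <= 1.
Proof. by rewrite (ltW delta_gt0) ge_min lexx. Qed.

Let delta_bound n : 2 * delta * gamma n ^+ 2 * tau n + c <=
  gamma n * (2 * theta - (1 + tau n) * gamma n).
Proof.
pose K := 2 * (2 * theta) ^+ 2 * (tau_max + 1).
have K0 : 0 < K.
  by rewrite /K mulr_gt0 ?ltr_wpDl // mulr_gt0 // exprn_gt0 // mulr_gt0.
have dK : delta * K <= c.
  by rewrite -ler_pdivlMr // /delta ge_min lexx orbT.
have g2 : gamma n ^+ 2 <= (2 * theta) ^+ 2.
  by rewrite ler_pXn2r ?nnegrE // mulr_ge0 // ltW.
have gt : gamma n ^+ 2 * tau n <= (2 * theta) ^+ 2 * (tau_max + 1).
  apply: ler_pM => //; first exact: exprn_ge0.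
  by apply: le_trans (tau_le n) _; rewrite lerDl.
have d0 := ltW delta_gt0.
have : 2 * delta * (gamma n ^+ 2 * tau n) <= delta * K.
  have -> : delta * K = 2 * delta * ((2 * theta) ^+ 2 * (tau_max + 1)) by rewrite /K;
    ring.
  by rewrite ler_wpM2l // mulr_ge0.
have : g0 * eps <= gamma n * (2 * theta - (1 + tau n) * gamma n).
  by apply: ler_pM => //; exact: ltW.
have cE : c + c = g0 * eps by rewrite /c; field.
lra.
Qed.

(** The product comes from [iteration_bound]; the last two terms are [(lambda n / kappa n w + lambda
    n ^+ 2) * kappa n w ^+ 2], which covers [a n]. *)
Let eta n w := (1 + lambda n * kappa n w) *
    (lambda n * gamma n * `|Eu n w - B (x n w)|
     + 3 * lambda n * gamma n ^+ 2 * (`|Eu n w - B (x n w)| ^+ 2 + zeta n w))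
  + (lambda n * kappa n w + (lambda n * kappa n w) ^+ 2).

(** [1 + chi n w] is the product of [1 + lambda n * kappa n w] and [1 + lambda n * gamma n * b],
    with [b] the bias. *)
Let chi n w := lambda n * kappa n w + lambda n * gamma n * `|Eu n w - B (x n w)|
  + lambda n * kappa n w * (lambda n * gamma n * `|Eu n w - B (x n w)|).

Let th n w := lambda n * (delta / 2) * `|residual n w| ^+ 2
  + lambda n * c * `|B (x n w) - B z| ^+ 2.

Let lk_adapted n : nonneg_gmeas (X n) (fun w => lambda n * kappa n w).
Proof. by apply: nonneg_gmeasM => //; exact: nonneg_gmeas_cst. Qed.

Let lb_adapted n : nonneg_gmeas (X n)
  (fun w => lambda n * gamma n * `|Eu n w - B (x n w)|).
Proof.
by apply: nonneg_gmeasM => //; apply: nonneg_gmeas_cst; rewrite mulr_ge0.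
Qed.

Let chi_adapted n : nonneg_gmeas (X n) (chi n).
Proof. by apply: nonneg_gmeasD; [exact: nonneg_gmeasD|exact: nonneg_gmeasM]. Qed.

Let eta_adapted n : nonneg_gmeas (X n) (eta n).
Proof.
apply: nonneg_gmeasD; last by apply: nonneg_gmeasD => //; exact: nonneg_gmeasX.
apply: nonneg_gmeasM.
  by apply: nonneg_gmeasD => //; exact: nonneg_gmeas_cst.
apply: nonneg_gmeasD => //; apply: nonneg_gmeasM.
  by apply: nonneg_gmeas_cst; rewrite !mulr_ge0 // exprn_ge0.
by apply: nonneg_gmeasD => //; exact: nonneg_gmeasX.
Qed.

Let th_adapted n : nonneg_gmeas (X n) (th n).
Proof.
apply: nonneg_gmeasD; apply: nonneg_gmeasM => //; apply: nonneg_gmeas_cst.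
  by rewrite mulr_ge0 // divr_ge0 // ltW.
by rewrite mulr_ge0 // ltW.
Qed.

(** The order matters: [iteration_step] holds path by path, its random terms are then replaced by
    conditional bounds, and only the resulting [X n]-measurable expression is estimated by
    [iteration_bound]. *)
Let step n : dominated P (X n) (fun w => `|x n.+1 w - z| ^+ 2 + th n w)
  (fun w => (1 + chi n w) * `|x n w - z| ^+ 2 + eta n w).
Proof.
have Hs := X_sub n; have l1 : lambda n <= 1 by have /andP[] := lambda_in n.
have k1 : nonneg_gmeas (X n) (fun w => 1 + lambda n * kappa n w).
  by apply: nonneg_gmeasD => //; exact: nonneg_gmeas_cst.
have l1' : 0 <= 1 - lambda n by rewrite subr_ge0.
have ld2 : 0 <= 2 * lambda n * delta * gamma n ^+ 2.
  by rewrite !mulr_ge0 ?exprn_ge0 // ltW.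
have dom1 := dominatedZ Hs l1' (dominated_refl P Hs (dist_adapted n)).
have dom2 := dominatedZ Hs (lambda_ge0 n) (@drift_noise_dom n).
have dom3 := dominatedZ Hs ld2 (dominatedD Hs
  (dominated_refl P Hs (nonneg_gmeasX 2 (@bias_adapted n))) (noise_dom n)).
have dom4 := dominatedM Hs k1 (dominatedD Hs (dominatedD Hs dom1 dom2) dom3).
have kk : nonneg_gmeas (X n) (fun w => lambda n / kappa n w + lambda n ^+ 2).
  apply: nonneg_gmeasD; last by apply: nonneg_gmeas_cst; exact: exprn_ge0.
  apply: nonneg_gmeasM; first exact: nonneg_gmeas_cst.
  exact: nonneg_gmeasV.
have dom5 := dominatedM Hs kk (a_dom n).
(* This part of [th n] is added on both sides; [iteration_bound] absorbs it on the right. *)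
have dom6 : nonneg_gmeas (X n) (fun w => lambda n * c * `|B (x n w) - B z| ^+ 2).
  by apply: nonneg_gmeasM => //; apply: nonneg_gmeas_cst; rewrite mulr_ge0 // ltW.
have dom := dominatedD Hs (dominatedD Hs dom4 dom5) (dominated_refl P Hs dom6).
apply: (dominated_ler Hs) (dominated_lel Hs _ _ _ dom).
- apply: nonneg_gmeasD => //; apply: nonneg_gmeasM => //.
  by apply: nonneg_gmeasD => //; exact: nonneg_gmeas_cst.
- apply: aeW => w.
  have := iteration_bound (x := x n w) (Eu := Eu n w) (z :=
    z) Hdot HB (gamma_in n) (lambda_in n)
    (ltW (kappa_gt0 n w)) delta_in (tau_ge0 n) ((zeta_adapted n).1 w) (ltW c_gt0)
    (delta_bound n) erefl erefl.
  rewrite -/(noise_bound n w) -/(drift n w).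
  have Ea_k : Num.sqrt (Ea n w) ^+ 2 <= kappa n w ^+ 2.
    rewrite ler_pXn2r ?nnegrE ?sqrtr_ge0 ?(ltW (kappa_gt0 n w)) //.
    by rewrite lerDl exprn_ge0 // invr_ge0.
  have := ler_wpM2l (kk.1 w) Ea_k.
  have -> : (lambda n / kappa n w + lambda n ^+ 2) * kappa n w ^+ 2 =
      lambda n * kappa n w + (lambda n * kappa n w) ^+ 2.
    by field; rewrite gt_eqF.
  rewrite /eta /chi; lra.
- by move=> w; rewrite addr_ge0 ?exprn_ge0 // (th_adapted n).1.
- apply: measurable_funD;
  first exact: (gmeas_measurable (X_sub n.+1) (dist_adapted n.+1).2).
  exact: (gmeas_measurable Hs (@th_adapted n).2).
- apply: filterS (x_rec n) => w ->; rewrite /th addrA lerD2r.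
  exact: (iteration_step Hdot HA (x n w) (u n w) (a n w) (Eu n w) (gamma_in n)
    (lambda_in n) (kappa_gt0 n w) delta_in Az).
Qed.

Let zeta_sum1 : {ae P, forall w, bounded_sums (fun n => lambda n * zeta n w)}.
Proof.
apply: filterS zeta_sum => w sw.
have s0 n : 0 <= Num.sqrt (lambda n * zeta n w) by exact: sqrtr_ge0.
apply: bounded_sums_le (bounded_sumsM s0 s0 sw sw) => n.
by rewrite -expr2 sqr_sqrtr // mulr_ge0 // (zeta_adapted n).1.
Qed.

Let x0_fin : (\int[P]_w (`|x 0%N w - z| ^+ 2)%:E < +oo)%E.
Proof.
  have mx := measurable_norm_rv Hsep x0_L2.1.
  apply: (@le_lt_trans _ _ (\int[P]_w (2 * `|x 0%N w| ^+ 2 + 2 * `|z| ^+ 2)%:E)%E).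
    apply: ge0_le_integral => //.
    - by apply/measurable_EFinP; exact: (gmeas_measurable (X_sub 0) (dist_adapted 0).2).
    - apply/measurable_EFinP; apply: measurable_funD => //.
      by apply: measurable_funM => //; exact: measurable_funX.
    - move=> w _; rewrite lee_fin.
      by have := sqnormD_young Hdot (x 0%N w) (- z) ltr01; rewrite invr1 normrN; lra.
  under eq_integral do rewrite EFinD EFinM.
  rewrite ge0_integralD //.
  - rewrite ge0_integralZl_EFin //; last first.
      by apply/measurable_EFinP; exact: measurable_funX.
    rewrite (integral_cst P measurableT (2 * `|z| ^+ 2)%:E) [X in (_ +
      _ * X)%E]probability_setT mule1.
    rewrite lte_add_pinfty ?ltry // lte_mul_pinfty // ?x0_L2.2 //.
  - by apply: emeasurable_funM => //; apply/measurable_EFinP; exact: measurable_funX.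
Qed.

Lemma fejer_cvg : {ae P, forall w, [/\ cvgn (fun n => `|x n w - z|),
  bounded_sums (fun n => lambda n * `|B (x n w) - B z| ^+ 2) &
  bounded_sums (fun n => lambda n * `|residual n w| ^+ 2)]}.
Proof.
have chi_sum : {ae P, forall w, bounded_sums (chi ^~ w)}.
  apply: filterS2 kappa_sum bias_sum => w sk [sb _].
  apply: bounded_sumsD; first exact: bounded_sumsD.
  apply: bounded_sumsM => // n; [exact: (lk_adapted n).1|exact: (lb_adapted n).1].
have eta_sum : {ae P, forall w, bounded_sums (eta ^~ w)}.
  apply: filterS3 kappa_sum bias_sum zeta_sum1 => w sk [sb sb2] sz.
  have lk0 n : 0 <= lambda n * kappa n w by exact: (lk_adapted n).1.
  apply: bounded_sumsD; last first.
    by apply: bounded_sumsD => //; exact: bounded_sumsM.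
  pose r n := lambda n * gamma n * `|Eu n w - B (x n w)|
     + 3 * lambda n * gamma n ^+ 2 * (`|Eu n w - B (x n w)| ^+ 2 + zeta n w).
  have sr : bounded_sums r.
    apply: bounded_sumsD => //.
    have th4 : 0 <= 3 * (2 * theta) ^+ 2
      by rewrite mulr_ge0 // exprn_ge0 // mulr_ge0 // ltW.
    have three : 0 <= (3 : R) by [].
    apply: bounded_sums_le (bounded_sumsD (bounded_sumsZ three sb2) (bounded_sumsZ
      th4 sz)) => n.
    have : gamma n ^+ 2 <= (2 * theta) ^+ 2.
      by rewrite ler_pXn2r ?nnegrE ?mulr_ge0 // ltW.
    have lz : 0 <= lambda n * zeta n w by rewrite mulr_ge0 // (zeta_adapted n).1.
    move/(ler_wpM2r lz); lra.
  have r0 n : 0 <= r n.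
    rewrite addr_ge0 //; first exact: (lb_adapted n).1.
    by rewrite !mulr_ge0 ?addr_ge0 ?exprn_ge0 // (zeta_adapted n).1.
  apply: bounded_sums_le (bounded_sumsD sr (bounded_sumsM lk0 r0 sk sr)) => n.
  by rewrite mulrDl mul1r.
suff : {ae P, forall w, cvgn (fun n => `|x n w - z| ^+ 2) /\ bounded_sums (th ^~ w)};
  last by apply: (dominated_robbins_siegmund (X := X) (V :=
    fun n w => `|x n w - z| ^+ 2)
    (chi := chi) (eta := eta)).
apply: filterS => w [cvgV sth]; split.
- have -> : (fun n => `|x n w - z|) = (fun n => Num.sqrt (`|x n w - z| ^+ 2)).
    by apply/funext => n; rewrite sqrtr_sqr normr_id.
  have /cvg_ex[l cvgl] := cvgV; apply/cvg_ex; exists (Num.sqrt l).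
  by apply: (continuous_cvg _ (@sqrt_continuous R l) cvgl).
- have c1 : 0 <= c^-1 by rewrite invr_ge0 ltW.
  apply: bounded_sums_le (bounded_sumsZ c1 sth) => n.
  rewrite ler_pdivlMl // /th.
  have : 0 <= lambda n * (delta / 2) * `|residual n w| ^+ 2.
    by rewrite !mulr_ge0 ?divr_ge0 ?exprn_ge0 // ltW.
  lra.
- have d2 : 0 < delta / 2 by rewrite divr_gt0.
  have c1 : 0 <= (delta / 2)^-1 by rewrite invr_ge0 ltW.
  apply: bounded_sums_le (bounded_sumsZ c1 sth) => n.
  rewrite ler_pdivlMl // /th.
  have : 0 <= lambda n * c * `|B (x n w) - B z| ^+ 2.
    by rewrite !mulr_ge0 ?exprn_ge0 // ltW.
  lra.
Qed.

(** The recursion of the residuals involves first moments of [noise n] and [a n], which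
    [dominated_sqrt] extracts from the second moments at the price of the summands [2^-1 ^+ n]. *)
Lemma residual_cvg (gam : R) : (forall n, gamma n = gam) -> bounded_sums tau ->
  {ae P, forall w, cvgn (fun n => `|x n w - T (gamma n) (x n w)|)}.
Proof.
move=> gammaE tau_sum.
have gam_in : 0 < gam < 2 * theta by rewrite -(gammaE 0%N).
pose W n w := `|x n w - T gam (x n w)|.
pose sd n w := Num.sqrt (noise_bound n w) + 2^-1 ^+ n.
pose etaW n w := 2 * lambda n *
  (gam * `|Eu n w - B (x n w)| + gam * sd n w + kappa n w).
have gam0 : 0 <= gam by rewrite -(gammaE 0%N).
have Tx n k : hmeasurable (X k) (x n) -> gmeas (X k) (W n).
  move=> mx; apply: (gmeas_norm Hsep (X_sub k));
    apply: (hmeasurableB Hsep (X_sub k)) => //.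
  apply: (hmeasurable_lipschitz Hsep (X_sub k) (K := 1)) => // v v'.
  by rewrite mul1r; exact: (forward_backward_nonexp Hdot HA HB).
have WW n : nonneg_gmeas (X n) (W n).
  split=> [w|]; first exact: normr_ge0.
  by apply: Tx; exact: x_adapted.
have half n : 0 < (2^-1 : R) ^+ n by rewrite exprn_gt0 // invr_gt0.
have sdd n : nonneg_gmeas (X n) (sd n).
  apply: nonneg_gmeasD; last by apply: nonneg_gmeas_cst; exact: ltW.
  by apply: nonneg_gmeas_sqrt; exact: (noise_bound_adapted n).2.
have ee n : nonneg_gmeas (X n) (etaW n).
  apply: nonneg_gmeasM; first by apply: nonneg_gmeas_cst; rewrite mulr_ge0.
  apply: nonneg_gmeasD => //; apply: nonneg_gmeasD; apply: nonneg_gmeasM => //;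
    exact: nonneg_gmeas_cst.
have W0_fin : (\int[P]_w (W 0%N w)%:E < +oo)%E.
  have mW : hilbert_rv (fun w => x 0%N w - z).
    by apply: (hmeasurableB Hsep Hm); [exact: x0_L2.1|exact: hmeasurable_cst Hm _].
  have int1 := integral_norm_lty mW measurableT x0_fin.
  (* As [z] is fixed, the initial residual is at most twice the distance to [z]. *)
  have Tz : T gam z = z by apply/(forward_backward_fix Hdot HA) => //;
    have /andP[] := gam_in.
  apply: (@le_lt_trans _ _ (\int[P]_w (2 * `|x 0%N w - z|)%:E)%E).
    apply: ge0_le_integral => //.
    - by move=> w _; rewrite lee_fin; exact: normr_ge0.
    - by apply/measurable_EFinP; exact: (gmeas_measurable (X_sub 0) (WW 0%N).2).
    - by apply/measurable_EFinP; apply: measurable_funM => //;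
      exact: (measurable_norm_rv Hsep mW).
    - move=> w _; rewrite lee_fin /W.
      have := forward_backward_nonexp Hdot HA HB z (x 0%N w) gam_in.
      rewrite -/T Tz (distrC z (x 0%N w)).
      have := ler_distD z (x 0%N w) (T gam (x 0%N w)); lra.
  under eq_integral do rewrite EFinM.
  rewrite ge0_integralZl_EFin //; first by rewrite lte_mul_pinfty.
  by apply/measurable_EFinP; exact: (measurable_norm_rv Hsep mW).
have stepW n : dominated P (X n) (fun w => W n.+1 w + 0) (fun w => (1 + 0) * W n w +
  etaW n w).
  have Hs := X_sub n.
  have mn := measurable_norm_rv Hsep (@noise_rv n).
  have ma := measurable_norm_rv Hsep (a_L2 n).1.
  have noise1 : dominated P (X n) (fun w => `|noise n w|) (sd n).
    by apply: (dominated_sqrt Hs) => //; exact: noise_dom.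
  have a1 : dominated P (X n) (fun w => `|a n w|) (kappa n).
    have := dominated_sqrt Hs (half n) (fun w => normr_ge0 (a n w)) ma (a_dom n).
    rewrite (_ : (fun w => Num.sqrt (Num.sqrt (Ea n w) ^+ 2) + 2^-1 ^+ n) = kappa n) //.
    by apply/funext => w; rewrite sqrtr_sqr ger0_norm ?sqrtr_ge0.
  have l2 : 0 <= 2 * lambda n by rewrite mulr_ge0.
  have bb := dominated_refl P Hs (nonneg_gmeasM (nonneg_gmeas_cst (X n) gam0)
    (@bias_adapted n)).
  have dom := dominatedD Hs (dominated_refl P Hs (WW n)) (dominatedZ Hs l2
    (dominatedD Hs (dominatedD Hs bb (dominatedZ Hs gam0 noise1)) a1)).
  apply: (dominated_ler Hs) (dominated_lel Hs _ _ _ dom).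
  - apply: nonneg_gmeasD => //; apply: nonneg_gmeasM => //.
    by apply: nonneg_gmeas_cst; rewrite addr0.
  - by apply: aeW => w; rewrite addr0 mul1r.
  - by move=> w; rewrite addr0; exact: normr_ge0.
  - under eq_fun do rewrite addr0.
    exact: (gmeas_measurable (X_sub n.+1) (WW n.+1).2).
  - apply: filterS (x_rec n) => w; rewrite gammaE addr0 /W => ->.
    exact: (residual_step Hdot HA HB (x n w) (u n w) (a n w) (Eu n w) gam_in
      (lambda_in n)).
have etaW_sum : {ae P, forall w, bounded_sums (etaW ^~ w)}.
  have Bsum : {ae P, forall w, bounded_sums (fun n =>
    lambda n * `|B (x n w) - B z| ^+ 2)}.
    by apply: filterS fejer_cvg => w [].
  apply: filterS2 (filterI Bsum bias_sum) (filterI zeta_sum kappa_sum) =>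
    w [sB [sb _]] [sz sk].
  have two : 0 <= (2 : R) by [].
  have tg : 0 <= 2 * gam by rewrite mulr_ge0.
  have s1 := bounded_sumsD (bounded_sumsZ two sb) (bounded_sumsZ two sk).
  have s2 := bounded_sumsZ tg (bounded_sumsD (bounded_sumsD (bounded_sumsD tau_sum
    sB) sz)
    (@bounded_sums_geo R)).
  apply: bounded_sums_le (bounded_sumsD s1 s2) => n.
  have l1 : lambda n <= 1 by have /andP[] := lambda_in n.
  (* The product of [Num.sqrt (tau n)] and the distance [be] is split by Young's inequality, and
     summability of [tau] and (i) control the two parts; [lambda n <= Num.sqrt (lambda n)] handles
     [zeta]. *)
  have lsd : lambda n * sd n w <= tau n + lambda n * `|B (x n w) - B z| ^+ 2 +
      Num.sqrt (lambda n * zeta n w) + 2^-1 ^+ n.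
    rewrite /sd /noise_bound.
    set be := `|B (x n w) - B z|; have z0 : 0 <= zeta n w by exact: (zeta_adapted n).1.
    have be0 : 0 <= be by exact: normr_ge0.
    have sq : Num.sqrt (tau n * be ^+ 2 + zeta n w) <=
      Num.sqrt (tau n) * be + Num.sqrt (zeta n w).
      rewrite -[leRHS]ger0_norm ?addr_ge0 ?mulr_ge0 ?sqrtr_ge0 // -sqrtr_sqr
        ler_wsqrtr //.
      rewrite sqrrD exprMn !sqr_sqrtr // addrAC lerDl.
      by rewrite mulrn_wge0 // !mulr_ge0 ?sqrtr_ge0.
    have lz : lambda n * Num.sqrt (zeta n w) <= Num.sqrt (lambda n * zeta n w).
      by rewrite sqrtrM // ler_wpM2r ?sqrtr_ge0.
    have : 0 <= lambda n * (Num.sqrt (tau n) - be) ^+ 2 by rewrite mulr_ge0 // sqr_ge0.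
    have := sqr_sqrtr (tau_ge0 n); have := ler_wpM2l (lambda_ge0 n) sq.
    have := half n; have := sqrtr_ge0 (tau n).
    have : lambda n * tau n <= tau n by rewrite ler_piMl.
    have : lambda n * 2^-1 ^+ n <= 2^-1 ^+ n by rewrite ler_piMl ?(ltW (half n)).
    have : 0 <= lambda n * be ^+ 2 by rewrite mulr_ge0 ?exprn_ge0.
    have := tau_ge0 n.
    move: (Num.sqrt (tau n)) (2^-1 ^+ n) => st h *; nra.
  have := ler_wpM2l tg lsd; rewrite /etaW gammaE; lra.
have zero n : nonneg_gmeas (X n) (fun=> 0 : R) by exact: nonneg_gmeas_cst.
have := dominated_robbins_siegmund (P := P) (V := W) (th := fun _ _ => 0) (chi :=
  fun _ _ => 0)
  X_sub X_nd WW zero zero ee W0_fin stepW.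
have sum0 : {ae P, forall w : Omega, bounded_sums (fun n => 0 : R)}.
  by apply: aeW => w; exists 0 => n; rewrite big1.
move=> /(_ sum0 etaW_sum); apply: filterS => w [cvgW _].
by under eq_fun do rewrite gammaE.
Qed.

End fejer.

End stochastic_forward_backward.

(** * Conclusion *)

Section extended_bounds.
Variables (R : realType) (u : nat -> R).

Lemma ereal_inf_range_gt0 : (0 < ereal_inf (range (fun n => (u n)%:E)))%E ->
  exists2 r, 0 < r & forall n, r <= u n.
Proof.
have lb n : (ereal_inf (range (fun n => (u n)%:E)) <= (u n)%:E)%E.
  by apply: ereal_inf_lbound; exists n.
case: (ereal_inf _) lb => [r||] //= lb r0; last by have := lb 0%N.
by exists r; rewrite -?lte_fin // => n; rewrite -lee_fin.
Qed.

Lemma ereal_sup_range_lt (M : R) : (ereal_sup (range (fun n => (u n)%:E)) < M%:E)%E ->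
  exists2 r, r < M & forall n, u n <= r.
Proof.
have ub n : ((u n)%:E <= ereal_sup (range (fun n => (u n)%:E)))%E.
  by apply: ereal_sup_ubound; exists n.
case: (ereal_sup _) ub => [r||] //= ub rM; last by have := ub 0%N.
by exists r; rewrite -?lte_fin // => n; rewrite -lee_fin.
Qed.

Lemma ereal_sup_range_lty : (ereal_sup (range (fun n => (u n)%:E)) < +oo)%E ->
  exists r, forall n, u n <= r.
Proof.
have ub n : ((u n)%:E <= ereal_sup (range (fun n => (u n)%:E)))%E.
  by apply: ereal_sup_ubound; exists n.
case: (ereal_sup _) ub => [r||] //= ub rM; last by have := ub 0%N.
by exists r => n; rewrite -lee_fin.
Qed.

Lemma cvgn_uniform_limit : (forall e, 0 < e -> exists2 v : nat -> R, cvgn v &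
  forall n, `|u n - v n| <= e) -> cvgn u.
Proof.
move=> uv; apply/cauchy_cvgP/cauchy_exP => e e0.
have e2 : 0 < e / 2 by rewrite divr_gt0.
have [v /cvg_ex[l vl] uve] := uv _ e2.
exists l; move/cvgrPdist_lt : vl => /(_ _ e2).
apply: filterS => n lv; rewrite -ball_normE /=.
have -> : l - u n = (l - v n) - (u n - v n) by ring.
apply: le_lt_trans (ler_normB _ _) _; have := uve n; lra.
Qed.

Lemma cvg0_of_sqr : (forall n, 0 <= u n) ->
  u n ^+ 2 @[n --> \oo] --> (0 : R) -> u @ \oo --> (0 : R).
Proof.
move=> u0 /cvgrPdist_lt u2; apply/cvgrPdist_lt => e e0.
have := u2 _ (exprn_gt0 2 e0); apply: filterS => n.
rewrite !sub0r !normrN !ger0_norm ?exprn_ge0 //.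
by rewrite ltr_pXn2r ?nnegrE // ltW.
Qed.

End extended_bounds.

(** A dense sequence of [H] may avoid [F], so each small ball around one of its points contributes a
    point of [F] if it meets [F], and the default [z0] otherwise. *)
Lemma dense_sequence_in (R : realType) (H : completeNormedModType R) (F : set H) :
  separable H -> F !=set0 -> exists2 f : nat -> H, forall k, F (f k) &
    forall z e, F z -> 0 < e -> exists k, `|z - f k| < e.
Proof.
move=> Hsep [z0 Fz0]; have [c cP] := dense_sequence Hsep.
pose near_c (p : nat * nat) := [set v | F v /\ `|v - c p.1| < p.2.+1%:R^-1].
exists (fun i => if unpickle i is Some p then xget z0 (near_c p) else z0).
  by move=> k; case: unpickle => // p; case: xgetP => [v _ [] |].
move=> z e Fz e0; have e2 : 0 < e / 2 by rewrite divr_gt0.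
have [m mP] : exists m : nat, m.+1%:R^-1 < e / 2 :> R.
  have /cvgrPdist_lt/(_ _ e2) [N _ /(_ N (leqnn N))] /= := @cvg_harmonic R.
  by rewrite sub0r normrN ger0_norm // => NP; exists N.
have m0 : 0 < m.+1%:R^-1 :> R by rewrite invr_gt0.
have [k kP] := cP z _ m0.
exists (pickle (k, m)); rewrite pickleK.
case: xgetP => [v _ [_ /= vk]|/(_ z) []//].
rewrite -[z - v](subrKA (c k)); apply: le_lt_trans (ler_normD _ _) _.
move: kP vk mP; rewrite (distrC v); move: (m.+1%:R^-1) => i; lra.
Qed.

Theorem theorem4p1 (R : realType)
  (H : completeNormedModType R) (dot : {dot H for idfun})
  (Hdot : induces_norm dot) (Hsep : separable H)
  (d : measure_display) (Omega : measurableType d) (P : probability Omega R)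
  (A : H -> set H) (HA : maximally_monotone dot A)
  (theta : R) (Htheta : 0 < theta)
  (B : H -> H) (HB : cocoercive dot theta B)
  (F : set H) (F_def : F = zeros (op_add A (of_fun B)))
  (F_neq0 : F !=set0)
  (x u a : nat -> Omega -> H)
  (x0_L2 : L2 P (x 0%N))
  (u_L2 : forall n, L2 P (u n))
  (a_L2 : forall n, L2 P (a n))
  (lambda gamma : nat -> R)
  (lambda_in : forall n, 0 < lambda n <= 1)
  (gamma_in : forall n, 0 < gamma n < 2 * theta)
  (x_rec : forall n, {ae P, forall w,
     x n.+1 w = x n w + lambda n *:
       (resolvent (op_scale (gamma n) A) (x n w - gamma n *: u n w)
        + a n w - x n w)})
  (tau : nat -> R) (tau_ge0 : forall n, 0 <= tau n)
  (X : nat -> set (set Omega))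
  (X_sub : forall n, sub_sigma_field (X n))
  (* versions of E(u_n | X_n), E(||a_n||^2 | X_n) and
     E(||u_n - E(u_n | X_n)||^2 | X_n) *)
  (Eu : nat -> Omega -> H) (Ea Vu : nat -> Omega -> R)
  (Eu_def : forall n, cond_exp_H P (X n) (u n) (Eu n))
  (Ea_def : forall n, cond_exp P (X n) (fun w => `|a n w| ^+ 2) (Ea n))
  (Vu_def : forall n,
     cond_exp P (X n) (fun w => `|u n w - Eu n w| ^+ 2) (Vu n))
  (hyp_a : forall n, sigma_upto x n `<=` X n /\ X n `<=` X n.+1)
  (hyp_b : {ae P, forall w,
     (\sum_(0 <= n <oo) (lambda n * Num.sqrt (Ea n w))%:E < +oo)%E})
  (hyp_c : {ae P, forall w,
     (\sum_(0 <= n <oo)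
        (Num.sqrt (lambda n) * `|Eu n w - B (x n w)|)%:E < +oo)%E})
  (hyp_d : forall z, F z -> exists zeta : nat -> Omega -> R,
     [/\ ell_plus_infty P X zeta,
         ell_plus_p P X 2^-1 (fun n w => lambda n * zeta n w)
       & forall n, {ae P, forall w,
           Vu n w <= tau n * `|B (x n w) - B z| ^+ 2 + zeta n w}])
  (hyp_e : [/\ (0 < ereal_inf (range (fun n => (gamma n)%:E)))%E,
               (ereal_sup (range (fun n => (tau n)%:E)) < +oo)%E
             & (ereal_sup (range (fun n => ((1 + tau n) * gamma n)%:E))
                < (2 * theta)%:E)%E])
  (hyp_f : (0 < ereal_inf (range (fun n => (lambda n)%:E)))%E \/
     [/\ exists g : R, forall n, gamma n = g,
         (\sum_(0 <= n <oo) (tau n)%:E < +oo)%E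
       & (\sum_(0 <= n <oo) (lambda n)%:E = +oo)%E]) :
  exists xoo : Omega -> H,
    [/\ hilbert_rv xoo,
        forall w, F (xoo w) &
    [/\ (* (i) *)
        forall z, F z -> {ae P, forall w,
          (\sum_(0 <= n <oo)
             (lambda n * `|B (x n w) - B z| ^+ 2)%:E < +oo)%E},
        (* (ii) *)
        forall z, F z -> {ae P, forall w,
          (\sum_(0 <= n <oo)
             (lambda n *
              `|x n w - gamma n *: B (x n w)
                - resolvent (op_scale (gamma n) A)
                    (x n w - gamma n *: B (x n w))
                + gamma n *: B z| ^+ 2)%:E < +oo)%E},
        (* (iii) *)
        {ae P, forall w, weakly_converges dot (x ^~ w) (xoo w)}
      & (* (iv) *)
        (forall z, F z -> demiregular dot A z) \/
        (forall z, F z -> demiregular dot (of_fun B) z) ->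
        {ae P, forall w, x n w @[n --> \oo] --> xoo w}]].
Proof.
have FE z : F z <-> A z (- B z) by rewrite F_def zeros_sumE.
have lambda_ge0 n : 0 <= lambda n by have /andP[/ltW] := lambda_in n.
have gamma_ge0 n : 0 <= gamma n by have /andP[/ltW] := gamma_in n.
have X_nd n : X n `<=` X n.+1 by exact: (hyp_a n).2.
have x_adapted n : hmeasurable (X n) (x n).
  move=> C mC; apply: (hyp_a n).1; apply: sub_sigma_algebra.
  by exists n => //=; exists C => //; rewrite setTI.
have [/ereal_inf_range_gt0[g0 g0_gt0 g0_le] /ereal_sup_range_lty[tau_max tau_le]
  /ereal_sup_range_lt[s s_lt s_ge]] := hyp_e.
have eps_gt0 : 0 < 2 * theta - s by rewrite subr_gt0.
have eps_le n : 2 * theta - s <= 2 * theta - (1 + tau n) * gamma n.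
  by have := s_ge n; lra.
have Ea_sum : {ae P, forall w, bounded_sums (fun n => lambda n * Num.sqrt (Ea n w))}.
  apply: filterS hyp_b => w; apply: (nneseries_bounded_sums _).1 => n.
  by rewrite mulr_ge0 // sqrtr_ge0.
have Eu_sum : {ae P, forall w,
    bounded_sums (fun n => Num.sqrt (lambda n) * `|Eu n w - B (x n w)|)}.
  apply: filterS hyp_c => w; apply: (nneseries_bounded_sums _).1 => n.
  by rewrite mulr_ge0 // sqrtr_ge0.
have zetaP z : F z -> exists zeta, [/\ forall n, nonneg_gmeas (X n) (zeta n),
    {ae P, forall w, bounded_sums (fun n => Num.sqrt (lambda n * zeta n w))} &
    forall n, {ae P, forall w, Vu n w <= tau n * `|B (x n w) - B z| ^+ 2 + zeta n w}].
  move=> /hyp_d[zeta [[zeta_plus _] [_ zeta_sum] Vu_le]]; exists zeta; split=> //.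
    move=> n; have [zeta0 mzeta] := zeta_plus n; split=> //.
    exact/(gmeasE (X_sub n)).
  apply: filterS zeta_sum => w zs.
  apply: (nneseries_bounded_sums _).1 => [n|]; first exact: sqrtr_ge0.
  move: zs; under eq_eseriesr do rewrite powR12_sqrt ?mulr_ge0 ?(zeta_plus _).1 //.
  done.
have fejer z : F z -> {ae P, forall w, [/\ cvgn (fun n => `|x n w - z|),
    bounded_sums (fun n => lambda n * `|B (x n w) - B z| ^+ 2) &
    bounded_sums (fun n => lambda n * `|x n w - gamma n *: B (x n w)
      - resolvent (op_scale (gamma n) A) (x n w - gamma n *: B (x n w))
      + gamma n *: B z| ^+ 2)]}.
  move=> Fz; have [zeta [mzeta szeta Vu_le]] := zetaP z Fz.
  exact: (fejer_cvg Hdot Hsep HA Htheta HB x0_L2 u_L2 lambda_in gamma_in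
    x_rec tau_ge0 X_sub X_nd x_adapted Eu_def Ea_def Vu_def Ea_sum Eu_sum g0_gt0 g0_le
    tau_le eps_gt0 eps_le ((FE z).1 Fz) mzeta szeta Vu_le).
pose T := forward_backward A B.
pose W w n := `|x n w - T (gamma n) (x n w)|.
have [z0 Fz0] := F_neq0.
have W_sum : {ae P, forall w, bounded_sums (fun n => lambda n * W w n ^+ 2)}.
  apply: filterS (fejer z0 Fz0) => w [_ sB sS].
  have two : 0 <= (2 : R) by [].
  have th2 : 0 <= 2 * (2 * theta) ^+ 2
    by rewrite mulr_ge0 // exprn_ge0 // mulr_ge0 // ltW.
  apply: bounded_sums_le (bounded_sumsD (bounded_sumsZ two sS) (bounded_sumsZ th2
    sB)) => n.
  set S := x n w - _ - _ + _.
  (* The residual differs from the vector in (ii) by [gamma n *: (B (x n w) - B z0)], which (i)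
     controls. *)
  have -> : W w n = `|S + gamma n *: (B (x n w) - B z0)|.
    by rewrite /W; congr `|_|; rewrite /S /T /forward_backward;
      apply: (dot_inj Hdot) => h; rewrite !dotE; ring.
  have := sqnormD_young Hdot S (gamma n *: (B (x n w) - B z0)) ltr01.
  rewrite invr1 (sqnormZ Hdot) => le1.
  have g2 : gamma n ^+ 2 <= (2 * theta) ^+ 2.
    rewrite ler_pXn2r ?nnegrE ?mulr_ge0 // ?(ltW Htheta) //.
    by have /andP[_ /ltW] := gamma_in n.
  have := ler_wpM2r (exprn_ge0 2 (normr_ge0 (B (x n w) - B z0))) g2 => le2.
  have := ler_wpM2l (lambda_ge0 n) le1; have := ler_wpM2l (lambda_ge0 n) le2; lra.
have W0 : {ae P, forall w, W w @ \oo --> (0 : R)}.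
  case: hyp_f => [/ereal_inf_range_gt0[l l0 l_le]|[[g gammaE] tau_sum lambda_oo]].
    apply: filterS W_sum => w sW; apply: cvg0_of_sqr => [n|]; first exact: normr_ge0.
    apply: bounded_sums_cvg0 => [n|]; first by rewrite exprn_ge0 // normr_ge0.
    have l1 : 0 <= l^-1 by rewrite invr_ge0 ltW.
    apply: bounded_sums_le (bounded_sumsZ l1 sW) => n.
    by rewrite ler_pdivlMl // ler_wpM2r // exprn_ge0 // normr_ge0.
  have [zeta [mzeta szeta Vu_le]] := zetaP z0 Fz0.
  have tau_bounded := (nneseries_bounded_sums tau_ge0).1 tau_sum.
  have := residual_cvg Hdot Hsep HA Htheta HB x0_L2 u_L2 a_L2 lambda_in gamma_in
    x_rec tau_ge0 X_sub X_nd x_adapted Eu_def Ea_def Vu_def Ea_sum Eu_sum g0_gt0 g0_le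
    tau_le eps_gt0 eps_le ((FE z0).1 Fz0) mzeta szeta Vu_le gammaE tau_bounded.
  apply: filterS2 W_sum => w sW /cvg_ex[l Wl].
  have W2l : W w n ^+ 2 @[n --> \oo] --> l ^+ 2.
    by rewrite expr2; under eq_fun do rewrite expr2; exact: cvgM.
  apply: cvg0_of_sqr => [n|]; first exact: normr_ge0.
  rewrite -(weighted_sums_cvg0 lambda_ge0 lambda_oo _ sW W2l) // => n.
  by rewrite exprn_ge0 // normr_ge0.
have [f Ff f_dense] := dense_sequence_in Hsep F_neq0.
pose good w := W w @ \oo --> (0 : R) /\
  forall z, F z -> cvgn (fun n => `|x n w - z|).
have good_ae : {ae P, forall w, good w}.
  have : {ae P, forall w, forall k, cvgn (fun n => `|x n w - f k|)}.
    by apply: ae_foralln => k; apply: filterS (fejer _ (Ff k)) => w [].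
  apply: filterS2 W0 => w Ww cvgf; split=> // z Fz.
  (* For [f k] close to [z], the two sequences of distances differ by at most [e], uniformly in
     [n]. *)
  apply: cvgn_uniform_limit => e e0; have [k kP] := f_dense z e Fz e0.
  exists (fun n => `|x n w - f k|) => // n.
  apply: le_trans (ler_dist_dist _ _) _.
  have -> : x n w - z - (x n w - f k) = - (z - f k).
    by apply: (dot_inj Hdot) => h; rewrite !dotE; ring.
  by rewrite normrN ltW.
have weak w : good w -> exists2 y, F y & weakly_converges dot (x ^~ w) y.
  move=> [Ww cvgF]; rewrite F_def in cvgF F_neq0 *.
  exact: (forward_backward_weak Hdot HA Htheta HB g0_gt0 g0_le gamma_in Ww cvgF).
(* The measurable null set [N] contains all exceptional paths; on it the value [z0] keeps [xoo]
   measurable and in [F] everywhere. *)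
have [N [mN PN0 subN]] := good_ae.
have goodN w : ~ N w -> good w.
  by move=> Nw; apply: contrapT => ngood; apply: Nw; exact: subN.
pose limits w := [set y | F y /\ weakly_converges dot (x ^~ w) y].
pose xoo w := if w \in N then z0 else xget z0 (limits w).
have xooP w : ~ N w -> F (xoo w) /\ weakly_converges dot (x ^~ w) (xoo w).
  move=> Nw; rewrite /xoo memNset //; have [y Fy xy] := weak w (goodN w Nw).
  have : limits w (xget z0 (limits w)) by apply: (@xgetPex _ z0); exists y.
  by case.
have aeN (Q : Omega -> Prop) : (forall w, ~ N w -> Q w) -> {ae P, forall w, Q w}.
  move=> NQ; exists N; split=> // w nQ; apply: contrapT => Nw; apply: nQ; exact: NQ.
have Hm := @measurable_sub_sigma_field _ Omega.
exists xoo; split; [| |split].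
- apply: (hmeasurable_weak Hdot Hsep Hm) => h.
  (* Patched on [N], these functions converge to [dot (xoo w) h] at every [w], so the limit is
     measurable without completing the sigma-algebra. *)
  pose v n w := if w \in N then dot z0 h else dot (x n w) h.
  have mv n : measurable_fun setT (v n).
    apply: measurable_fun_ifT => //.
      apply: (measurable_fun_bool true); rewrite setTI.
      rewrite (_ : _ @^-1` _ = N) //; apply/seteqP; split=> w /=; first exact: set_mem.
      exact: mem_set.
    apply: (measurable_dot_rv Hdot Hsep); last exact: (hmeasurable_cst Hm).
    exact: hilbert_rv_hmeasurable (X_sub n) (@x_adapted n).
  have mlim : measurable_fun setT (fun w => dot (xoo w) h).
    apply: (measurable_fun_cvg mv) => w _; rewrite /v.
    have [Nw|Nw] := pselect (N w).
      by rewrite /xoo mem_set //; exact: cvg_cst.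
    by rewrite memNset //; exact: (xooP w Nw).2.
  by apply/(gmeasE Hm) => C mC; rewrite -[X in measurable X]setTI; exact: mlim.
- move=> w; have [Nw|Nw] := pselect (N w); last exact: (xooP w Nw).1.
  by rewrite /xoo mem_set.
- move=> z Fz; apply: filterS (fejer z Fz) => w [_ sB _].
  by apply/nneseries_bounded_sums => // n; rewrite mulr_ge0 // exprn_ge0.
- move=> z Fz; apply: filterS (fejer z Fz) => w [_ _ sS].
  by apply/nneseries_bounded_sums => // n; rewrite mulr_ge0 // exprn_ge0.
- by apply: aeN => w /xooP[].
- move=> reg; apply: aeN => w Nw; have [Fxoo xw] := xooP w Nw.
  have [Ww cvgF] := goodN w Nw.
  have reg_xoo : demiregular dot A (xoo w) \/ demiregular dot (of_fun B) (xoo w).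
    by case: reg => reg; [left|right]; exact: reg.
  rewrite F_def in cvgF Fxoo.
  exact: (forward_backward_strong Hdot HA Htheta HB g0_gt0 g0_le gamma_in Ww cvgF
    Fxoo xw).
Qed.
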